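(* Let $H$, $A$, $m$ be as in the context. Let $(u_0,u_1)\in D(A^{3/4})\times D(A^{1/4})$, and for every $\varepsilon>0$ let $(u_{0\varepsilon},u_{1\varepsilon})\in D(A^{3/4})\times D(A^{1/4})$ be such that $$|u_1-u_{1\varepsilon}|^2+|A^{1/4}(u_1-u_{1\varepsilon})|^2+|A^{1/2}(u_0-u_{0\varepsilon})|^2+|A^{3/4}(u_0-u_{0\varepsilon})|^2\le\varepsilon^2.$$ Let $\mathcal{LS}(u_{0\varepsilon},u_{1\varepsilon})\in(0,+\infty]$ denote the life span of the solution to $u''(t)+m(|A^{1/2}u(t)|^2)Au(t)=0$ with initial data $(u_{0\varepsilon},u_{1\varepsilon})$. Then the following hold. (1) (Finite dimensional data) If $u_0$ and $u_1$ are finite linear combinations of eigenvectors of $A$, then there exist positive real numbers $\gamma_0$ and $\varepsilon_0$ such that $$\mathcal{LS}(u_{0\varepsilon},u_{1\varepsilon})\ge\frac1{\gamma_0}|\log\varepsilon|\qquad\forall\varepsilon\in(0,\varepsilon_0).$$ (2) (Analytic data) Let $r_0>0$ be real and $\varphi(\sigma):=r_0\sigma$ for all $\sigma\ge0$. If $(u_0,u_1)\in\mathcal{G}_{\varphi,3/4}(A)\times\mathcal{G}_{\varphi,1/4}(A)$, then there exist positive real numbers $\gamma_1$ and $\varepsilon_1$ such that $$\mathcal{LS}(u_{0\varepsilon},u_{1\varepsilon})\ge\frac1{\gamma_1}\log(|\log\varepsilon|)\qquad\forall\varepsilon\in(0,\varepsilon_1).$$ (3) (Classical quasi-analytic data)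 Let $\varphi(\sigma):=\dfrac{\sigma}{\log(2+\sigma)}$ for all $\sigma\ge0$. If $(u_0,u_1)\in\mathcal{G}_{\varphi,3/4}(A)\times\mathcal{G}_{\varphi,1/4}(A)$, then there exist positive real numbers $\gamma_2$ and $\varepsilon_2$ such that $$\mathcal{LS}(u_{0\varepsilon},u_{1\varepsilon})\ge\frac1{\gamma_2}\log(\log(|\log\varepsilon|))\qquad\forall\varepsilon\in(0,\varepsilon_2).$$
   Context: Standing assumptions. $H$ is a real Hilbert space with norm $|\cdot|$ and inner product $\langle\cdot,\cdot\rangle$. $A$ is a self-adjoint operator on $H$ with domain $D(A)$ for which there are an orthonormal basis $\{e_k\}_{k\ge1}$ of $H$ and a sequence $\{\lambda_k\}$ of nonnegative reals with $Ae_k=\lambda_k^2e_k$ for all $k$. For $\alpha\ge0$, $D(A^\alpha)=\{z\in H:\sum_k\lambda_k^{4\alpha}\langle z,e_k\rangle^2<\infty\}$ with the graph norm, and $A^\alpha z=\sum_k\lambda_k^{2\alpha}\langle z,e_k\rangle e_k$. The function $m:[0,+\infty)\to\mathbb{R}$ is of class $C^1$ and there is a constant $\nu_0>0$ with $m(\sigma)\ge\nu_0$ for all $\sigma\ge0$. Generalized Sobolev–Gevrey spaces. For $\alpha\ge0$ and $\varphi:[0,+\infty)\to\mathbb{R}$, $\mathcal{G}_{\varphi,\alpha}(A)$ is the set of $z\in H$ with $\sum_{k=1}^\infty\lambda_k^{4\alpha}\exp(\varphi(\lambda_k))\langle z,e_k\rangle^2<+\infty$. Solutions. A solution on $[0,T]$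 is a function $u\in C^0([0,T],D(A^{3/4}))\cap C^1([0,T],D(A^{1/4}))$ satisfying the equation componentwise: $u_k''+m(|A^{1/2}u(t)|^2)\lambda_k^2u_k=0$ with $u_k=\langle u,e_k\rangle$. Known local theory: for every $(u_0,u_1)\in D(A^{3/4})\times D(A^{1/4})$ there is a unique solution with $u(0)=u_0$, $u'(0)=u_1$ on some $[0,T]$, $T>0$; the quantity $|u'(t)|^2+\int_0^{|A^{1/2}u(t)|^2}m(s)\,ds$ is constant in $t$; if $(u_0,u_1)\in D(A^{\alpha+3/4})\times D(A^{\alpha+1/4})$ with $\alpha\ge0$ then $u\in C^0([0,T],D(A^{\alpha+3/4}))\cap C^1([0,T],D(A^{\alpha+1/4}))$; and the solution extends to a maximal interval $[0,T_{\max})$ where either $T_{\max}=+\infty$ or $\limsup_{t\to T_{\max}^-}(|A^{1/4}u'(t)|^2+|A^{3/4}u(t)|^2)=+\infty$. The life span is $\mathcal{LS}(u_0,u_1):=T_{\max}\in(0,+\infty]$. Known global theory (previous literature). Let $\varphi:[0,+\infty)\to[0,+\infty)$ be increasing and continuous with $\varphi(0)=0$ and $\int_1^{+\infty}\varphi(\sigma)\sigma^{-2}\,d\sigma=+\infty$ (both choices of $\varphi$ in the theorem qualify). Then for every $(u_0,u_1)\in\mathcal{G}_{\varphi,3/4}(A)\times\mathcal{G}_{\varphi,1/4}(A)$ the solution $u$ is global, i.e. $\mathcal{LS}(u_0,u_1)=+\infty$, and belongs to $C^0([0,+\infty),\mathcal{G}_{\varphi,3/4}(A))\cap C^1([0,+\infty),\mathcal{G}_{\varphi,1/4}(A))$.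 Moreover, set $F_\varphi(t):=\sum_{k=1}^\infty\max\{1,\lambda_k\}\,a_k(t)\exp(\varphi(\lambda_k))$ with $a_k(t):=\langle u'(t),e_k\rangle^2+m(|A^{1/2}u(t)|^2)\lambda_k^2\langle u(t),e_k\rangle^2$; if $|u_1|^2+|A^{1/2}u_0|^2>0$, there are real constants $c_0$ and $c_1>0$ with $F_\varphi(t)\ge c_1$ and $F_\varphi'(t)\le c_0F_\varphi(t)\{1+\varphi^{-1}(\log(F_\varphi(t)/c_1))\}$ for all $t\ge0$. *)

(* Defs.v *)
From HB Require Import structures.
From mathcomp Require Import all_boot all_order all_algebra.
From mathcomp Require Import all_classical all_reals all_analysis.

Set Implicit Arguments.
Unset Strict Implicit.
Unset Printing Implicit Defensive.

Import Order.TTheory GRing.Theory Num.Theory.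
Import numFieldNormedType.Exports.

Local Open Scope classical_set_scope.
Local Open Scope ring_scope.

Section Calculus.
Context {R : realType} {V : lmodType R}.

(* Continuity and differentiability of u on I with respect to an explicit norm
   N, so that V can carry several norms (here, the graph norms of D(A^alpha)).
   Limits are taken inside I, hence one-sided at its end points. *)
Definition continuous_wrt (N : V -> R) (I : set R) (u : R -> V) : Prop :=
  forall t, I t -> N (u s - u t) @[s --> within I (nbhs t)] --> 0.

Definition derivative_wrt (N : V -> R) (I : set R) (u u' : R -> V) : Prop :=
  forall t, I t ->
    N ((s - t)^-1 *: (u s - u t) - u' t) @[s --> within I t^'] --> 0.

End Calculus.

Section ScalarCalculus.
Context {R : realType}.

Definition real_derivative_on (I : set R) (f f' : R -> R) : Prop :=
  derivative_wrt (V := R^o) (fun x => `|x|) I f f'.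

Definition class_C1 (I : set R) (f : R -> R) : Prop :=
  exists f' : R -> R,
    real_derivative_on I f f' /\ {within I, continuous f'}.

End ScalarCalculus.

Section Operators.
Context {R : realType} {H : completeNormedModType R}.
Variable dot : {dot H for idfun}.

Definition inner_product_norm : Prop := forall z : H, dot z z = `|z| ^+ 2.

Definition orthonormal_basis (e : nat -> H) : Prop :=
  (forall j k, dot (e j) (e k) = (j == k)%:R) /\
  (forall z, series (fun k => dot z (e k) *: e k) @ \oo --> z).

(* An unbounded operator is a domain DA together with a map A whose values
   outside DA are irrelevant. *)
Definition linear_operator (DA : set H) (A : H -> H) : Prop :=
  DA 0 /\
  forall (a : R) (x y : H), DA x -> DA y ->
    DA (a *: x + y) /\ A (a *: x + y) = a *: A x + A y.

Definition adjoint_graph (DA : set H) (A : H -> H) (y w : H) : Prop :=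
  forall x, DA x -> dot (A x) y = dot x w.

Definition self_adjoint (DA : set H) (A : H -> H) : Prop :=
  [/\ linear_operator DA A,
      closure DA = setT &
      forall y w, adjoint_graph DA A y w <-> (DA y /\ w = A y)].

Definition eigenvector (DA : set H) (A : H -> H) (w : H) : Prop :=
  [/\ DA w, w != 0 & exists mu : R, A w = mu *: w].

Definition eigenvector_combination (DA : set H) (A : H -> H) (z : H) : Prop :=
  exists (n : nat) (c : 'I_n -> R) (w : 'I_n -> H),
    (forall i, eigenvector DA A (w i)) /\ z = \sum_(i < n) c i *: w i.

Variables (e : nat -> H) (lam : nat -> R).

(* The basis is indexed from 0, and A (e k) = lam k ^+ 2 *: e k. *)
Definition dom_pow (alpha : R) : set H :=
  [set z | (\sum_(0 <= k <oo)
              (lam k `^ (4 * alpha) * dot z (e k) ^+ 2)%:E < +oo)%E].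

Definition pow_op (alpha : R) (z : H) : H :=
  limn (series (fun k => (lam k `^ (2 * alpha) * dot z (e k)) *: e k)).

Definition graph_norm (alpha : R) (z : H) : R :=
  Num.sqrt (`|z| ^+ 2 + `|pow_op alpha z| ^+ 2).

Definition gevrey (phi : R -> R) (alpha : R) : set H :=
  [set z | (\sum_(0 <= k <oo)
              (lam k `^ (4 * alpha) * expR (phi (lam k))
                 * dot z (e k) ^+ 2)%:E < +oo)%E].

Definition C0_dom_pow (I : set R) (alpha : R) (u : R -> H) : Prop :=
  (forall t, I t -> dom_pow alpha (u t)) /\
  continuous_wrt (graph_norm alpha) I u.

Definition C1_dom_pow (I : set R) (alpha : R) (u u' : R -> H) : Prop :=
  [/\ C0_dom_pow I alpha u,
      C0_dom_pow I alpha u' &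
      derivative_wrt (graph_norm alpha) I u u'].

Variable m : R -> R.

(* u is a solution on [0, T] and u' is its derivative. *)
Definition kirchhoff_solution (T : R) (u u' : R -> H) : Prop :=
  [/\ C0_dom_pow `[0, T] (3 / 4) u,
      C1_dom_pow `[0, T] (1 / 4) u u' &
      forall k, real_derivative_on `[0, T]
        (fun t => dot (u' t) (e k))
        (fun t => - (m (`|pow_op (1 / 2) (u t)| ^+ 2)
                       * lam k ^+ 2 * dot (u t) (e k)))].

(* The end point T_max of the maximal existence interval [0, T_max), by local
   well-posedness the supremum of the T for which a solution on [0, T] exists. *)
Definition life_span (u0 u1 : H) : \bar R :=
  ereal_sup [set T%:E | T in [set T : R | 0 < T /\
    exists u u' : R -> H,
      [/\ kirchhoff_solution T u u', u 0 = u0 & u' 0 = u1]]].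

End Operators.

(* Main.v *)
Require Import Defs.
From HB Require Import structures.
From mathcomp Require Import all_boot all_order all_algebra.
From mathcomp Require Import all_classical all_reals all_analysis.
From mathcomp Require Import ring lra.

(* Once the coefficient [c(t) = m(|A^{1/2} u(t)|^2)] is known, the equation splits
   into scalar equations [f'' + c lam^2 f = 0], so a solution is a fixed point of
   the map [sig |-> sum_k lam_k^2 f_k^2], where the [f_k] are the modes with
   coefficient [m o sig]. On a set of uniformly Lipschitz functions [sig] this map
   is a contraction in a weighted sup norm, so existence on [0, T] only requires
   such a set that is closed and invariant.

   No solution with the unperturbed data is needed: the reference is the solution
   [rho] whose data are the first [N] modes of [(u0, u1)], for which the
   conservation of energy gives global existence. The set
   [|(sig - rho)(t) - (sig - rho)(s)| <= kap eps (e^{B t} - e^{B s})] is invariant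
   for the perturbed data as long as [kap B eps e^{B T} <= 1], where [B] is a
   constant times a bound [Q(T)], uniform in [N], of the sums [sum lam_k b_k(t)]
   and [sum lam_k^3 b_k(t)] of the mode energies [b_k] of the reference. Hence the
   life span is at least [T] as soon as [Q(T) (1 + T)] is at most a small multiple
   of [|log eps|].

   Finally [Q(T)] comes from the Gevrey energy [F = 1 + sum om_k b_k], which
   satisfies [F' <= C F sum lam_k b_k], while splitting the frequencies at the
   level [Lm] where [om_k >= (lam_k + lam_k^3) F] gives
   [sum lam_k b_k <= H0 Lm + 1]. This bounds [Q] by a constant, by [exp (C T)] and
   by [exp (C exp (C T))] in the three cases. *)

Set Implicit Arguments.
Unset Strict Implicit.
Unset Printing Implicit Defensive.

Import Order.TTheory GRing.Theory Num.Theory.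
Import numFieldNormedType.Exports.

Local Open Scope classical_set_scope.
Local Open Scope ring_scope.

(** * Dini derivatives and comparison *)

(** The coefficients are only Lipschitz in time, so the mode energies need not be differentiable and
    all growth estimates use upper right Dini derivatives. The growth rate of an energy is governed
    by the Lipschitz constant of the coefficient, not by the size of [sig]; this is why the
    invariant set bounds increments of [sig - rho] and not just its supremum. The derivative of
    [lam^2 f^2] exceeds an energy by one factor [lam]: hence the moment of order one, and the weight
    [lam] in the energy of the difference [f - r]. The source [(c - d) lam^2 r] of that difference
    then costs [lam^5 r^2]: hence the moment of order three.

    The number [N] of reference modes depends on [eps]: it makes the discarded tail comparable to
    the perturbation. This is what forces bounds uniform in [N].

    The function [m] is replaced by [m \o clamp S], bounded and globally Lipschitz. With finitely
    many modes this already gives existence on every interval; conservation of energy then keeps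
    [rho], and with it [sig], which stays within distance 1 of [rho], in the range where the
    truncation changes nothing. *)

Section RealCalculus.
Context {R : realType}.
Implicit Types (f g Y : R -> R) (s t T d : R).

Lemma is_derive1_continuous f t d : is_derive t 1 f d -> {for t, continuous f}.
Proof. by move=> [df _]; exact/differentiable_continuous/derivable1_diffP. Qed.

Lemma mean_value f f' a b : a <= b ->
  (forall t, a <= t <= b -> is_derive t 1 f (f' t)) ->
  exists2 c, a <= c <= b & f b - f a = f' c * (b - a).
Proof.
move=> ab df.
have [c cab ->] : exists2 c, c \in `[a, b]%R & f b - f a = f' c * (b - a).
  apply: MVT_segment => //.
    move=> x; rewrite in_itv/= => /andP[xa xb].
    by apply: df; rewrite !ltW.
  apply: derivable_within_continuous => x; rewrite in_itv/= => xab.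
  by have [] := df x xab.
by exists c => //; rewrite in_itv/= in cab.
Qed.

Lemma mono_of_derive f f' a b : a <= b ->
  (forall t, a <= t <= b -> is_derive t 1 f (f' t)) ->
  (forall t, a <= t <= b -> 0 <= f' t) -> f a <= f b.
Proof.
move=> ab df f'0; have [c cab E] := mean_value ab df.
by rewrite -subr_ge0 E mulr_ge0 ?subr_ge0 ?f'0.
Qed.

Lemma antiderivative f a b : continuous f -> a <= b ->
  exists F, forall t, a <= t <= b -> is_derive t 1 F (f t).
Proof.
move=> cf ab.
(* Starting the integral at [a - 1] makes every point of [[a, b]] interior, so the derivative is
   two-sided even at [a]. *)
pose F x : R := (\int[@lebesgue_measure R]_(t in `[a - 1, x]) f t)%R.
exists F => t /andP[at_ tb].
have := @continuous_FTC1_closed R f (a - 1) t (b + 1).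
case.
- by rewrite (le_lt_trans tb) // ltrDl.
- apply: continuous_compact_integrable; first exact: segment_compact.
  exact: continuous_subspaceT.
- by rewrite (lt_le_trans _ at_) // ltrBlDr ltrDl.
- exact: cf.
- by move=> dF <-; rewrite derive1E; exact/derivableP.
Qed.

(** This says that the upper right Dini derivative of [f] at [s] is at most [d]. The form with slack
    [eta] needs no limit to exist and is stable under sums and nonnegative multiples. *)
Definition dini_le f s d := forall eta, 0 < eta ->
  \forall t \near s^'+, f t - f s <= (d + eta) * (t - s).

Lemma dini_leW f s d d' : d <= d' -> dini_le f s d -> dini_le f s d'.
Proof.
move=> dd' H eta eta0; near=> t.
have st : s < t by near: t; exact: nbhs_right_gt.
have H' : f t - f s <= (d + eta) * (t - s) by near: t; exact: H.
by rewrite (le_trans H')// ler_wpM2r ?subr_ge0 ?(ltW st)// lerD2r.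
Unshelve. all: by end_near. Qed.

Lemma dini_leD f g s d d' : dini_le f s d -> dini_le g s d' ->
  dini_le (fun t => f t + g t) s (d + d').
Proof.
move=> Hf Hg eta eta0; have e2 : 0 < eta / 2 by rewrite divr_gt0.
near=> t.
have H1 : f t - f s <= (d + eta / 2) * (t - s) by near: t; exact: (Hf _ e2).
have H2 : g t - g s <= (d' + eta / 2) * (t - s) by near: t; exact: (Hg _ e2).
by lra.
Unshelve. all: by end_near. Qed.

Lemma dini_leZ f s d k : 0 <= k -> dini_le f s d ->
  dini_le (fun t => k * f t) s (k * d).
Proof.
rewrite le_eqVlt => /predU1P[<- _ eta eta0|k0 H eta eta0].
  near=> t; rewrite !mul0r subrr add0r mulr_ge0 ?ltW// subr_gt0.
  by near: t; exact: nbhs_right_gt.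
near=> t.
have : f t - f s <= (d + eta / k) * (t - s).
  by near: t; apply: H; rewrite divr_gt0.
rewrite -(ler_pM2l k0) mulrBr => /le_trans; apply.
rewrite mulrA (_ : k * (d + eta / k) = k * d + eta)//.
by rewrite mulrDr mulrCA divff ?mulr1// gt_eqF.
Unshelve. all: by end_near. Qed.

Lemma dini_le_cst k s : dini_le (fun=> k) s 0.
Proof.
move=> eta eta0; near=> t.
rewrite subrr add0r mulr_ge0 ?ltW// subr_gt0.
by near: t; exact: nbhs_right_gt.
Unshelve. all: by end_near. Qed.

Lemma dini_le_sum (F : nat -> R -> R) (D : nat -> R) s n :
  (forall k, (k < n)%N -> dini_le (F k) s (D k)) ->
  dini_le (fun t => \sum_(k < n) F k t) s (\sum_(k < n) D k).
Proof.
elim: n => [_|n IH H].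
  have := dini_le_cst 0 s; rewrite big_ord0.
  by rewrite (_ : (fun=> 0) = (fun t => \sum_(k < 0) F k t))//;
    apply/funext => t; rewrite big_ord0.
rewrite big_ord_recr/=.
rewrite (_ : (fun t => _) = (fun t => \sum_(k < n) F k t + F n t)); last first.
  by apply/funext => t; rewrite big_ord_recr.
apply: dini_leD; last exact: H.
by apply: IH => k kn; apply: H; exact: ltnW.
Qed.

Lemma is_derive1_quotient f t d : is_derive t 1 f d ->
  (s - t)^-1 * (f s - f t) @[s --> t^'] --> d.
Proof.
move=> [df Df]; have {df} : h^-1 *: ((f \o shift t) (h *: 1) - f t) @[h --> 0^'] --> d.
  by rewrite -Df; exact: df.
move=> /cvgrPdist_lt H; apply/cvgrPdist_lt => e e0.
have /nbhs_ballP [del /= del0 Hd] := H e e0.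
apply/nbhs_ballP; exists del => //= s; rewrite /ball/= => ts st.
have := Hd (s - t); rewrite /ball/= sub0r opprB subr_eq0.
by rewrite /shift/= /GRing.scale/= mulr1 subrK; apply.
Qed.

Lemma dini_le_quotient f s d :
  (t - s)^-1 * (f t - f s) @[t --> s^'+] --> d -> dini_le f s d.
Proof.
move=> /cvgrPdist_lt H eta eta0; near=> t.
have st : 0 < t - s by rewrite subr_gt0; near: t; exact: nbhs_right_gt.
have : `|d - (t - s)^-1 * (f t - f s)| < eta by near: t; exact: H.
rewrite ltr_norml => /andP[+ _]; rewrite ltrBrDr addrC ltrBlDr => /ltW.
by rewrite mulrC ler_pdivrMr.
Unshelve. all: by end_near. Qed.

Lemma is_derive1_dini f s d : is_derive s 1 f d -> dini_le f s d.
Proof.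
by move=> /is_derive1_quotient/cvg_dnbhs_at_right; exact: dini_le_quotient.
Qed.

Definition continuous_upto T f := forall t, 0 <= t <= T ->
  f s @[s --> within `[0, T] (nbhs t)] --> f t.

(** If [f] exceeded [Y] at [t1], consider the last time before [t1] with [f <= Y]. The two functions
    touch there, and the strict inequality of slopes pushes [f] below [Y] just afterwards. So the
    differential inequality is only needed at contact points. *)
Lemma barrier f Y Y' T : continuous_upto T f ->
  (forall t, 0 <= t <= T -> is_derive t 1 Y (Y' t)) -> f 0 <= Y 0 ->
  (forall s, 0 <= s < T -> f s = Y s -> exists2 d, dini_le f s d & d < Y' s) ->
  forall t, 0 <= t <= T -> f t <= Y t.
Proof.
move=> cf dY f0 H t1 /andP[t10 t1T]; rewrite leNgt; apply/negP => ft1.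
have clt s : 0 <= s <= t1 -> 0 <= s <= T.
  by move=> /andP[-> /= /le_trans]; exact.
have cg s : 0 <= s <= T ->
    f x - Y x @[x --> within `[0, T] (nbhs s)] --> f s - Y s.
  move=> s0T; apply: cvgB; first exact: cf.
  apply: cvg_within_filter; exact: (is_derive1_continuous (dY _ s0T)).
pose A := [set s | 0 <= s <= t1 /\ f s <= Y s].
have A0 : A 0 by split=> //; rewrite lexx.
have supA : has_sup A.
  by split; [exists 0|exists t1 => s [/andP[]]].
set s0 := sup A.
have s00 : 0 <= s0 by exact: ub_le_sup supA.2 _ A0.
have s0t1 : s0 <= t1 by apply: ge_sup => [|s [/andP[]]//]; exists 0.
have s0r : 0 <= s0 <= T by apply: clt; rewrite s00.
have after s : s0 < s -> s <= t1 -> Y s < f s.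
  move=> s0s st1; rewrite ltNge; apply/negP => fs.
  suff : s <= s0 by rewrite leNgt s0s.
  apply: (ub_le_sup supA.2).
  by split=> //; rewrite st1 andbT (le_trans s00)// ltW.
have fs0 : f s0 <= Y s0.
  rewrite leNgt; apply/negP => fs0.
  have : \forall x \near within `[0, T] (nbhs s0), 0 < f x - Y x.
    by apply: (cvgr_gt _ (cg _ s0r)); rewrite subr_gt0.
  move=> /nbhs_ballP[del /= del0 Hd].
  have [s As ds] := sup_adherent del0 supA.
  have ss0 : s <= s0 by exact: ub_le_sup supA.2 _ As.
  have dd : s0 - s < del by rewrite ltrBlDl -ltrBlDr.
  have := Hd s; rewrite /ball/= ger0_norm ?subr_ge0// in_itv/=.
  by move=> /(_ dd (clt _ As.1)); rewrite subr_gt0 ltNge As.2.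
have s0lt : s0 < t1.
  by rewrite lt_neqAle s0t1 andbT; apply: contraTneq ft1 => <-; rewrite -leNgt.
have Es0 : f s0 = Y s0.
  apply/eqP; rewrite eq_le fs0 leNgt; apply/negP => fs0'.
  have : \forall x \near within `[0, T] (nbhs s0), f x - Y x < 0.
    by apply: (cvgr_lt _ (cg _ s0r)); rewrite subr_lt0.
  move=> /nbhs_ballP[del /= del0 Hd].
  pose s := Num.min t1 (s0 + del / 2).
  have s0s : s0 < s by rewrite lt_min s0lt ltrDl divr_gt0.
  have st1 : s <= t1 by rewrite ge_min lexx.
  have sd : s <= s0 + del / 2 by rewrite ge_min lexx orbT.
  have dd : s - s0 < del by lra.
  have sr : 0 <= s <= T by apply: clt; rewrite st1 (le_trans s00)// ltW.
  have := Hd s; rewrite /ball/= ltr0_norm ?subr_lt0// in_itv/= opprB.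
  by move=> /(_ dd sr); rewrite ltNge (ltW (after _ s0s st1)).
have [d Hd dY'] : exists2 d, dini_le f s0 d & d < Y' s0.
  by apply: H => //; rewrite s00 (lt_le_trans s0lt).
have dNY : dini_le (fun x => - Y x) s0 (- Y' s0).
  by apply: is_derive1_dini; apply: is_deriveN; exact: dY.
(* Each of the two slopes may be off by [eta]; half of the gap survives. *)
pose eta := (Y' s0 - d) / 4.
have eta0 : 0 < eta by rewrite divr_gt0// subr_gt0.
suff /filter_ex[] : \forall x \near s0^'+, False by [].
near=> x.
have s0x : s0 < x by near: x; exact: nbhs_right_gt.
have xt1 : x <= t1 by near: x; exact: nbhs_right_le.
have fx : f x - f s0 <= (d + eta) * (x - s0) by near: x; exact: Hd.
have Yx : - Y x - - Y s0 <= (- Y' s0 + eta) * (x - s0) by near: x; exact: dNY.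
have := after _ s0x xt1; apply/negP; rewrite -leNgt.
have : 0 <= eta * (x - s0) by rewrite mulr_ge0 ?ltW// subr_gt0.
have E : Y' s0 = d + 4 * eta by rewrite /eta; lra.
by rewrite E in Yx; rewrite Es0 in fx; nra.
Unshelve. all: by end_near. Qed.

Lemma is_derive_expR_scale (a b t : R) :
  is_derive t 1 (fun s => a * expR (b * s)) (a * b * expR (b * t)).
Proof.
have db : is_derive t 1 (b \*: (@idfun R)) b.
  by apply: is_derive_eq; rewrite /GRing.scale/= mulr1.
have de : is_derive t 1 (expR \o (b \*: (@idfun R))) (expR (b * t) * b).
  exact: is_derive1_comp.
have dae : is_derive t 1 (a \*: (expR \o (b \*: (@idfun R))))
    (a *: (expR (b * t) * b)) by exact: is_deriveZ.
by apply: (is_derive_eq dae); rewrite /GRing.scale/=; ring.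
Qed.

(** As the source grows like [expR (A * s)] with [A] above the homogeneous rate [al], a multiple of
    this one exponential is a strict supersolution as soon as its factor exceeds [be / (A - al)]. *)
Lemma gronwall f T y0 al be A : continuous_upto T f -> 0 <= y0 -> 0 <= be ->
  al < A -> f 0 <= y0 ->
  (forall s, 0 <= s < T -> dini_le f s (al * f s + be * expR (A * s))) ->
  forall t, 0 <= t <= T -> f t <= (y0 + be / (A - al)) * expR (A * t).
Proof.
move=> cf y00 be0 alA f0 H t t0T; apply/ler_addgt0Pr => eta eta0.
have Aal : 0 < A - al by rewrite subr_gt0.
set K := y0 + be / (A - al).
(* The surplus provides strictness and costs exactly [eta] at the time [t] under consideration. *)
pose K' := K + eta / expR (A * t).
have KK' : K < K' by rewrite ltrDl divr_gt0 ?expR_gt0.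
rewrite (_ : _ + eta = K' * expR (A * t)); last first.
  by rewrite /K' [RHS]mulrDl divfK// gt_eqF ?expR_gt0.
pose Y s := K' * expR (A * s).
apply: (@barrier f Y (fun s => K' * A * expR (A * s)) T) => //.
- by move=> s _; exact: is_derive_expR_scale.
- rewrite /Y mulr0 expR0 mulr1 (le_trans f0)// (le_trans _ (ltW KK'))//.
  by rewrite lerDl divr_ge0// ltW.
- move=> s s0T fs; exists (al * f s + be * expR (A * s)); first exact: H.
  rewrite fs /Y mulrA -mulrDl ltr_pM2r ?expR_gt0//.
  have : be / (A - al) < K' by rewrite (le_lt_trans _ KK')// lerDr.
  by rewrite ltr_pdivrMr// mulrBr [al * _]mulrC ltrBrDl.
Qed.

End RealCalculus.

(** * Volterra fixed points and scalar modes *)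

Section Modes.
Context {R : realType}.
Implicit Types (c f g h : R -> R) (s t T l p q K B M D a b : R).

(** For [0 <= T] this is the projection onto [[0, T]]. Composing with it extends a function from
    [[0, T]] to the line without increasing Lipschitz constants; it serves both for time and for the
    argument of [m]. *)
Definition clamp T t := Num.max 0 (Num.min T t).

Lemma clamp_in T t : 0 <= T -> 0 <= clamp T t <= T.
Proof. by move=> T0; rewrite le_max lexx ge_max T0 ge_min lexx. Qed.

Lemma clamp_id T t : 0 <= t <= T -> clamp T t = t.
Proof. by move=> /andP[t0 tT]; rewrite /clamp min_r// max_r. Qed.

Lemma clamp_lipschitz T s t : 0 <= T -> `|clamp T t - clamp T s| <= `|t - s|.
Proof.
move=> T0; wlog st : s t / s <= t.
  by move=> H; case: (leP s t) => [/H//|/ltW/H]; rewrite distrC [leRHS]distrC.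
rewrite [leRHS]ger0_norm ?subr_ge0//; rewrite ler_norml /clamp.
by case: (leP T s); case: (leP T t); case: (leP 0 s); case: (leP 0 t);
  case: (leP 0 T) => *; rewrite /= ?maxEle ?minEle; do ?case: ifP => *; lra.
Qed.

Lemma continuous_clamp T f : 0 <= T -> continuous_upto T f ->
  continuous (f \o clamp T).
Proof.
move=> T0 cf t; apply/cvgrPdist_le => e e0.
have /cvgrPdist_le/(_ e e0)/nbhs_ballP[d /= d0 H] := cf _ (clamp_in t T0).
apply/nbhs_ballP; exists d => //= s; rewrite /ball/= => st.
apply: H; last by rewrite /= in_itv/= clamp_in.
by rewrite /ball/= (le_lt_trans _ st)// clamp_lipschitz.
Qed.

Lemma continuous_uptoW T f :
  (forall t, 0 <= t <= T -> {for t, continuous f}) -> continuous_upto T f.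
Proof. by move=> cf t t0T; apply: cvg_within_filter; exact: cf. Qed.

Lemma lipschitz_continuous_upto T f K :
  (forall s t, 0 <= s <= T -> 0 <= t <= T -> `|f t - f s| <= K * `|t - s|) ->
  continuous_upto T f.
Proof.
move=> H t t0T; apply/cvgrPdist_le => e e0; apply/nbhs_ballP.
have K0 : 0 < `|K| + 1 by rewrite ltr_wpDl.
exists (e / (`|K| + 1)); first by rewrite /= divr_gt0.
move=> s; rewrite /ball/= in_itv/= => st s0T.
rewrite (le_trans (H _ _ s0T t0T))//.
rewrite (@le_trans _ _ ((`|K| + 1) * `|t - s|))//.
  by rewrite ler_wpM2r// (le_trans (ler_norm K))// lerDl.
by rewrite mulrC -ler_pdivlMr// ltW.
Qed.

Lemma cvgn_le (u : nat -> R) (a b : R) N : u @ \oo --> a ->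
  (forall n, (N <= n)%N -> u n <= b) -> a <= b.
Proof.
by move=> ua ub; apply: (ler_cvg_to ua (cvg_cst b)); exists N.
Qed.

(* Picard iteration in the weighted sup norm [sup |f t| / expR (B * t)]. *)
Lemma volterra_fixpoint (X : set (R -> R)) (Phi : (R -> R) -> R -> R) T B D0 f0 :
  X f0 -> (forall f, X f -> X (Phi f)) ->
  (forall (u : nat -> R -> R) f, (forall n, X (u n)) ->
    (forall e, 0 < e -> exists n, forall t, 0 <= t <= T ->
      forall k, (n <= k)%N -> `|u k t - f t| <= e) -> X f) ->
  (forall t, 0 <= t <= T -> `|Phi f0 t - f0 t| <= D0 * expR (B * t)) ->
  0 <= D0 -> 0 <= B ->
  (forall f g D, X f -> X g -> 0 <= D ->
    (forall t, 0 <= t <= T -> `|f t - g t| <= D * expR (B * t)) ->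
    forall t, 0 <= t <= T -> `|Phi f t - Phi g t| <= D / 2 * expR (B * t)) ->
  exists2 f, X f & forall t, 0 <= t <= T -> Phi f t = f t.
Proof.
move=> Xf0 XPhi Xlim bd0 D00 B0 contr.
pose u n := iter n Phi f0.
have Xu n : X (u n) by elim: n => //= n; exact: XPhi.
have du n t : 0 <= t <= T -> `|u n.+1 t - u n t| <= D0 / 2 ^+ n * expR (B * t).
  elim: n t => [|n IH] t t0T; first by rewrite expr0 divr1; exact: bd0.
  rewrite exprSr invfM mulrA.
  apply: (contr (u n.+1) (u n) (D0 / 2 ^+ n)) => //.
  by rewrite divr_ge0// exprn_ge0.
(* The factor [2 - 2 / 2 ^+ k] is the geometric sum of the first [k] powers of one half. *)
have duk n k t : 0 <= t <= T ->
    `|u (n + k)%N t - u n t| <= D0 / 2 ^+ n * (2 - 2 / 2 ^+ k) * expR (B * t).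
  move=> t0T; elim: k => [|k IH].
    by rewrite addn0 subrr normr0 expr0 divr1 subrr mulr0 mul0r.
  rewrite addnS -(subrK (u (n + k)%N t) (u (n + k).+1 t)) -addrA.
  rewrite (le_trans (ler_normD _ _))//.
  rewrite (le_trans (lerD (du _ _ t0T) IH))// -mulrDl ler_wpM2r ?expR_ge0//.
  have p2 : 2 ^+ k != 0 :> R by rewrite expf_neq0.
  have p2' : 2 ^+ n != 0 :> R by rewrite expf_neq0.
  rewrite exprD exprS le_eqVlt; apply/orP; left; apply/eqP; field.
  by rewrite p2 p2'.
have E0 n t : 0 <= t <= T -> D0 / 2 ^+ n * expR (B * t) <= D0 * expR (B * T) / 2 ^+ n.
  move=> /andP[t0 tT]; rewrite mulrAC ler_wpM2r ?invr_ge0 ?exprn_ge0//.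
  by rewrite ler_wpM2l// ler_expR ler_wpM2l.
pose C := 2 * (D0 * expR (B * T)).
have duk' n k t : 0 <= t <= T -> `|u (n + k)%N t - u n t| <= C / 2 ^+ n.
  move=> t0T; rewrite (le_trans (duk n k t t0T))//.
  have h1 : 2 - 2 / 2 ^+ k <= 2 :> R by rewrite gerBl divr_ge0// exprn_ge0.
  rewrite -mulrA [(_ - _) * _]mulrC mulrA.
  have h2 := E0 n t t0T.
  have h3 : 0 <= D0 / 2 ^+ n * expR (B * t).
    by rewrite mulr_ge0 ?expR_ge0// divr_ge0// exprn_ge0.
  by rewrite (le_trans (ler_wpM2l h3 h1))// /C [leLHS]mulrC -[leRHS]mulrA ler_wpM2l.
have small e : 0 < e -> exists n, C / 2 ^+ n <= e.
  move=> e0.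
  have : C * 2^-1 ^+ n @[n --> \oo] --> C * 0.
    by apply: cvgM; [exact: cvg_cst|apply: cvg_expr; rewrite ger0_norm; lra].
  rewrite mulr0 => /cvgrPdist_le/(_ e e0)[n _ /(_ n (leqnn n))].
  rewrite /= sub0r normrN => h; exists n; rewrite -exprVn.
  exact: le_trans (ler_norm _) h.
have cvu t : 0 <= t <= T -> cvgn (u ^~ t).
  move=> t0T; apply/cauchy_cvgP/cauchy_exP => e e0.
  have [n hn] := small (e / 2) (divr_gt0 e0 (ltr0n _ 2)).
  exists (u n t), n => //= k /= nk; rewrite /ball/= distrC -(subnKC nk).
  by rewrite (le_lt_trans (duk' _ _ _ t0T))// (le_lt_trans hn)//; lra.
pose f t := limn (u ^~ t).
have ulim t : 0 <= t <= T -> u ^~ t @ \oo --> f t by move=> /cvu.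
have uf n t : 0 <= t <= T -> `|f t - u n t| <= 2 * (D0 / 2 ^+ n) * expR (B * t).
  move=> t0T; apply: (@cvgn_le (fun k => `|u k t - u n t|) _ _ n).
    by apply: cvg_norm; apply: cvgB; [exact: ulim|exact: cvg_cst].
  move=> k nk; rewrite -(subnKC nk) (le_trans (duk _ _ _ t0T))//.
  rewrite ler_wpM2r ?expR_ge0// mulrC ler_wpM2r ?divr_ge0 ?exprn_ge0//.
  by rewrite gerBl divr_ge0// exprn_ge0.
have uf' n t : 0 <= t <= T -> `|f t - u n t| <= C / 2 ^+ n.
  move=> t0T; rewrite (le_trans (uf _ _ t0T))// /C -!mulrA ler_wpM2l// mulrA.
  by rewrite (le_trans (E0 _ _ t0T))// mulrA.
have Xf : X f.
  apply: (Xlim u) => // e /small [n hn]; exists n => t t0T k nk.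
  rewrite distrC (le_trans (uf' _ _ t0T))// (le_trans _ hn)//.
  rewrite ler_wpM2l ?mulr_ge0 ?expR_ge0// lef_pV2 ?posrE ?exprn_gt0//.
  by rewrite ler_eXn2l// ltr1n.
exists f => // t t0T; apply/eqP; rewrite -subr_eq0 -normr_le0.
apply/ler_addgt0Pr => e e0; rewrite add0r.
have [n hn] := small (e / 2) (divr_gt0 e0 (ltr0n _ 2)).
have h1 : `|Phi f t - u n.+1 t| <= C / 2 ^+ n.
  rewrite (le_trans (contr f (u n) _ Xf (Xu n) _ (uf n) t t0T))//.
    by rewrite mulr_ge0// divr_ge0// exprn_ge0.
  have h2 := E0 n t t0T.
  have h3 : 0 <= D0 / 2 ^+ n * expR (B * t).
    by rewrite mulr_ge0 ?expR_ge0// divr_ge0// exprn_ge0.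
  rewrite /C; nra.
have h2 : `|f t - u n.+1 t| <= C / 2 ^+ n.
  rewrite (le_trans (uf' _ _ t0T))// ler_wpM2l ?mulr_ge0 ?expR_ge0//.
  by rewrite lef_pV2 ?posrE ?exprn_gt0// ler_eXn2l// ltr1n.
rewrite (_ : Phi f t - f t = Phi f t - u n.+1 t - (f t - u n.+1 t)); last by ring.
by rewrite (le_trans (ler_normB _ _))//; lra.
Qed.

(** Integration gains a factor [1 / B] in the norm weighted by [expR (B * t)]. Hence a large weight
    turns Volterra maps into contractions on intervals of any length. *)
Lemma primitive_bound f g T K B : 0 < B -> 0 <= K -> f 0 = 0 ->
  (forall t, 0 <= t <= T -> is_derive t 1 f (g t)) ->
  (forall t, 0 <= t <= T -> `|g t| <= K * expR (B * t)) ->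
  forall t, 0 <= t <= T -> `|f t| <= K / B * expR (B * t).
Proof.
move=> B0 K0 f0 df bg t /andP[t0 tT].
have le s : 0 <= s <= t -> 0 <= s <= T.
  by move=> /andP[-> /= /le_trans]; exact.
have dE s := is_derive_expR_scale (K / B) B s.
have KB : K / B * B = K by rewrite divfK ?gt_eqF.
have H1 : 0 <= K / B * expR (B * 0) by rewrite mulr_ge0 ?expR_ge0// divr_ge0// ltW.
have up : 0 + K / B * expR (B * 0) <= f t + K / B * expR (B * t).
  rewrite -{1}f0.
  refine (@mono_of_derive R (f + (fun s => K / B * expR (B * s)))
    (fun s => g s + K / B * B * expR (B * s)) 0 t t0 _ _) => s s0t.
    exact: (is_deriveD (df _ (le _ s0t)) (dE s)).
  by have := bg s (le _ s0t); rewrite KB ler_norml => /andP[+ _]; lra.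
have down : K / B * expR (B * 0) - 0 <= K / B * expR (B * t) - f t.
  rewrite -{2}f0.
  refine (@mono_of_derive R ((fun s => K / B * expR (B * s)) - f)
    (fun s => K / B * B * expR (B * s) - g s) 0 t t0 _ _) => s s0t.
    exact: (is_deriveB (dE s) (df _ (le _ s0t))).
  by have := bg s (le _ s0t); rewrite KB ler_norml => /andP[_ +]; lra.
by rewrite ler_norml; apply/andP; split; lra.
Qed.


(** The equation [f'' + c l^2 f = 0] as a first order system. Derivatives are two-sided at [0] and
    [T] too, since [f] and [g] live on the whole line. *)
Record mode_sol c l p q T f g : Prop := ModeSol {
  mode_init : f 0 = p ;
  mode_init' : g 0 = q ;
  mode_derive : forall t, 0 <= t <= T -> is_derive t 1 f (g t) ;
  mode_derive' : forall t, 0 <= t <= T ->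
    is_derive t 1 g (- (c t * l ^+ 2 * f t)) }.

Lemma second_primitive h p q T : 0 <= T -> continuous_upto T h ->
  exists fg : (R -> R) * (R -> R), [/\ fg.1 0 = p, fg.2 0 = q &
    forall t, 0 <= t <= T ->
      is_derive t 1 fg.1 (fg.2 t) /\ is_derive t 1 fg.2 (h t)].
Proof.
move=> T0 ch.
have prim (k : R -> R) a : continuous_upto T k ->
    exists2 F, F 0 = a & forall t, 0 <= t <= T -> is_derive t 1 F (k t).
  move=> ck; have [F dF] := antiderivative (continuous_clamp T0 ck) T0.
  exists (F + cst (a - F 0)); first by rewrite /= /GRing.add/= addrC subrK.
  move=> t t0T; rewrite -(addr0 (k t)) -{2}(clamp_id t0T).
  by apply: is_deriveD; exact: dF.
have [g g0 dg] := prim h q ch.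
have [|f f0 df] := prim g p.
  by apply: continuous_uptoW => t /dg; exact: is_derive1_continuous.
by exists (f, g); split => // t t0T; split; [exact: df|exact: dg].
Qed.

Lemma mode_sol_exists c l p q T M : 0 <= T -> continuous_upto T c ->
  (forall t, 0 <= t <= T -> `|c t| <= M) ->
  exists f g, mode_sol c l p q T f g.
Proof.
move=> T0 cc cM.
have M0 : 0 <= M by rewrite (le_trans _ (cM 0 _)) ?lexx.
pose src f t := - (c t * l ^+ 2 * f t).
have csrc f : continuous_upto T f -> continuous_upto T (src f).
  move=> cf t t0T; apply: cvgN; apply: cvgM; last exact: cf.
  by apply: cvgMl; exact: cc.
have /choice[P HP] : forall f, exists fg : (R -> R) * (R -> R),
    continuous_upto T f -> [/\ fg.1 0 = p, fg.2 0 = q &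
    forall t, 0 <= t <= T ->
      is_derive t 1 fg.1 (fg.2 t) /\ is_derive t 1 fg.2 (src f t)].
  move=> f; have [cf|ncf] := pselect (continuous_upto T f).
    by have [fg Hfg] := second_primitive p q T0 (csrc f cf); exists fg.
  by exists (f, f).
have cP f : continuous_upto T f -> continuous_upto T (P f).1.
  move=> /HP[_ _ H]; apply: continuous_uptoW => t /H[].
  by move=> /is_derive1_continuous.
(* Two integrations of the source give the factor [M * l ^+ 2 / B ^+ 2], at most one half for this
   weight. *)
pose B := 2 * M * l ^+ 2 + 1.
have Ml0 : 0 <= M * l ^+ 2 by rewrite mulr_ge0// sqr_ge0.
have B1 : 1 <= B by rewrite /B; lra.
have B0 : 0 < B by rewrite (lt_le_trans _ B1).
have contr f g D : continuous_upto T f -> continuous_upto T g -> 0 <= D ->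
    (forall t, 0 <= t <= T -> `|f t - g t| <= D * expR (B * t)) ->
    forall t, 0 <= t <= T -> `|(P f).1 t - (P g).1 t| <= D / 2 * expR (B * t).
  move=> cf cg D0 fg t t0T.
  have [f0 f'0 Hf] := HP f cf; have [g0 g'0 Hg] := HP g cg.
  have K0 : 0 <= M * l ^+ 2 * D by rewrite mulr_ge0.
  have b1 s : 0 <= s <= T ->
      `|(P f).2 s - (P g).2 s| <= M * l ^+ 2 * D / B * expR (B * s).
    apply: (@primitive_bound ((P f).2 - (P g).2) (src f - src g)) => //.
      by rewrite /GRing.add/= /GRing.opp/= f'0 g'0 subrr.
      by move=> r r0T; apply: is_deriveB; [have [] := Hf r r0T|have [] := Hg r r0T].
    move=> r r0T.
    have -> : (src f - src g) r = - (c r * l ^+ 2 * (f r - g r)).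
      by rewrite fctE /src mulrBr opprB addrC opprK.
    rewrite normrN; have := sqr_ge0 l; move: (l ^+ 2) => L2 L20.
    rewrite -!mulrA normrM; apply: ler_pM => //; first exact: cM.
    by rewrite normrM ger0_norm// ler_wpM2l//; exact: fg.
  have K1 : 0 <= M * l ^+ 2 * D / B by rewrite divr_ge0// ltW.
  have /le_trans -> // : `|(P f).1 t - (P g).1 t| <=
      M * l ^+ 2 * D / B / B * expR (B * t).
    apply: (@primitive_bound ((P f).1 - (P g).1) ((P f).2 - (P g).2) T) => //.
      by rewrite /GRing.add/= /GRing.opp/= f0 g0 subrr.
    by move=> r r0T; apply: is_deriveB; [have [] := Hf r r0T|have [] := Hg r r0T].
  rewrite ler_wpM2r ?expR_ge0// !ler_pdivrMr//.
  have : M * l ^+ 2 <= B * B / 2 by rewrite /B; nra.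
  by move=> /(ler_wpM2r D0); lra.
have bnd f : continuous_upto T f -> exists2 D, 0 <= D &
    forall t, 0 <= t <= T -> `|f t| <= D * expR (B * t).
  move=> cf.
  have cE : {within `[0, T], continuous ((fun x : R => `|x|) \o (f \o clamp T))}.
    apply: continuous_subspaceT => t; apply: continuous_comp.
      exact: continuous_clamp.
    exact: norm_continuous.
  have [x _ Hx] := EVT_max T0 cE.
  exists `|f (clamp T x)| => // t t0T.
  have := Hx t; rewrite in_itv/= clamp_id// => /(_ t0T) /le_trans; apply.
  rewrite ler_peMr// -expR0 ler_expR mulr_ge0 ?(ltW B0)//.
  by case/andP: t0T.
pose f0 : R -> R := cst 0.
have cf0 : continuous_upto T f0 by move=> t _; exact: cvg_cst.
have [D0 D00 HD0] := bnd _ (cP _ cf0).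
have [||f Xf Hf] := @volterra_fixpoint (continuous_upto T) (fun f => (P f).1)
    T B D0 f0 cf0 cP _ _ D00 (ltW B0) contr.
- move=> u f cu uf t t0T; apply/cvgrPdist_le => e e0.
  have e3 : 0 < e / 3 by rewrite divr_gt0.
  have [n hn] := uf _ e3.
  have /cvgrPdist_le/(_ _ e3) := cu n t t0T.
  move=> /nbhs_ballP[d /= d0 Hd]; apply/nbhs_ballP; exists d => //= s ts s0T.
  have h1 := Hd s ts s0T; have h2 := hn t t0T n (leqnn n).
  have := s0T; rewrite /= in_itv/= => s0T'.
  have h3 := hn s s0T' n (leqnn n).
  rewrite (_ : f t - f s = (u n t - u n s) - (u n t - f t) + (u n s - f s)); last by ring.
  rewrite (le_trans (ler_normD _ _))//.
  have := ler_normB (u n t - u n s) (u n t - f t).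
  by lra.
- by move=> t t0T; rewrite subr0; exact: HD0.
have [P0 P'0 HP'] := HP f Xf.
exists (P f).1, (P f).2; split => // t t0T; first by have [] := HP' t t0T.
by rewrite Hf//; have [] := HP' t t0T.
Qed.

End Modes.

(** * Mode energies *)

Section Energies.
Context {R : realType}.
Implicit Types (c d f g h r v w : R -> R) (s t T l p q K B M D nu kap phi : R).

Definition energy c l v w t := w t ^+ 2 + c t * l ^+ 2 * v t ^+ 2.

Lemma energy_dini c l v w s kap phi : 0 <= kap ->
  dini_le (fun t => `|c t - c s|) s kap ->
  is_derive s 1 v (w s) ->
  is_derive s 1 w (- (c s * l ^+ 2 * v s) + phi) ->
  dini_le (energy c l v w) s (kap * (l ^+ 2 * v s ^+ 2) + 2 * w s * phi).
Proof.
move=> kap0 dc dv dw eta eta0.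
set L2 := l ^+ 2; have L20 : 0 <= L2 by exact: sqr_ge0.
set V := L2 * v s ^+ 2; have V0 : 0 <= V by rewrite mulr_ge0// sqr_ge0.
pose F := w ^+ 2 + (c s * L2) \*: v ^+ 2.
have dF : is_derive s 1 F (2 * w s * phi).
  have H : is_derive s 1 F ((2%:R * w s ^+ 1) *: (- (c s * L2 * v s) + phi) +
      (c s * L2) *: ((2%:R * v s ^+ 1) *: w s)) by exact: is_deriveD.
  by apply: (is_derive_eq H); rewrite /GRing.scale/= !expr1; ring.
have cv : v t @[t --> s^'+] --> v s.
  apply: cvg_at_right_filter; exact: (is_derive1_continuous dv).
(* [eta1] and [eta2] are sized so that [(kap + eta1) * (V + eta2) <= kap * V + eta / 2]; the other
   half of [eta] goes to [F]. *)
pose eta2 := Num.min 1 (eta / (4 * (kap + 1))).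
have kap1 : 0 < kap + 1 by rewrite ltr_wpDl.
have eta20 : 0 < eta2 by rewrite lt_min ltr01 divr_gt0// mulr_gt0.
have eta21 : eta2 <= 1 by rewrite ge_min lexx.
have eta2k : kap * eta2 <= eta / 4.
  have : eta2 <= eta / (4 * (kap + 1)) by rewrite ge_min lexx orbT.
  rewrite ler_pdivlMr ?mulr_gt0// => H.
  by rewrite ler_pdivlMr//; nra.
pose eta1 := eta / (4 * (V + 1)).
have V1 : 0 < V + 1 by rewrite ltr_wpDl.
have eta10 : 0 < eta1 by rewrite divr_gt0// mulr_gt0.
have eta1V : eta1 * (V + 1) = eta / 4.
  by rewrite /eta1 invfM mulrA divfK// gt_eqF.
have eta22 : 0 < eta / 2 by rewrite divr_gt0.
have cvV : L2 * v t ^+ 2 @[t --> s^'+] --> V.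
  by apply: cvgMr; rewrite expr2; under eq_fun do rewrite expr2; exact: cvgM.
near=> t.
have st : 0 < t - s by rewrite subr_gt0; near: t; exact: nbhs_right_gt.
have H1 : F t - F s <= (2 * w s * phi + eta / 2) * (t - s).
  by near: t; exact: (is_derive1_dini dF).
have H2 : `|c t - c s| - `|c s - c s| <= (kap + eta1) * (t - s).
  by near: t; exact: dc.
have H3 : L2 * v t ^+ 2 <= V + eta2.
  by near: t; apply: cvgr_le cvV _ _; rewrite ltrDl.
rewrite subrr normr0 subr0 in H2.
have H4 : (c t - c s) * (L2 * v t ^+ 2) <= (kap + eta1) * (t - s) * (V + eta2).
  rewrite (le_trans (ler_wpM2r _ (ler_norm _)))//.
    by rewrite mulr_ge0// sqr_ge0.
  by apply: ler_pM => //; rewrite mulr_ge0// sqr_ge0.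
have H5 : (kap + eta1) * (V + eta2) <= kap * V + eta / 2.
  have : eta1 * eta2 <= eta1 by rewrite ler_piMr// ltW.
  by lra.
have -> : energy c l v w t - energy c l v w s =
    (F t - F s) + (c t - c s) * (L2 * v t ^+ 2).
  have FE x : F x = w x ^+ 2 + c s * L2 * v x ^+ 2 by rewrite /F !expr2.
  by rewrite !FE /energy -/L2; ring.
rewrite (le_trans (lerD H1 H4))//.
by have := ler_wpM2r (ltW st) H5; lra.
Unshelve. all: by end_near. Qed.

Lemma energy_ge0 c l v w t : 0 <= c t -> 0 <= energy c l v w t.
Proof.
by move=> c0; rewrite addr_ge0 ?sqr_ge0// mulr_ge0 ?sqr_ge0// mulr_ge0 ?sqr_ge0.
Qed.

Lemma energy_potential c l v w t nu : nu <= c t ->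
  nu * (l ^+ 2 * v t ^+ 2) <= energy c l v w t.
Proof.
move=> nuc; rewrite /energy -mulrA.
have := sqr_ge0 (w t); have : 0 <= l ^+ 2 * v t ^+ 2 by rewrite mulr_ge0 ?sqr_ge0.
by move=> H1 H2; have := ler_wpM2r H1 nuc; lra.
Qed.

Lemma energy_kinetic c l v w t : 0 <= c t -> w t ^+ 2 <= energy c l v w t.
Proof. by move=> c0; rewrite lerDl mulr_ge0 ?sqr_ge0// mulr_ge0 ?sqr_ge0. Qed.

Lemma energy_continuous c l v w T : continuous_upto T c ->
  (forall t, 0 <= t <= T -> {for t, continuous v}) ->
  (forall t, 0 <= t <= T -> {for t, continuous w}) ->
  continuous_upto T (energy c l v w).
Proof.
move=> cc /continuous_uptoW cv /continuous_uptoW cw t t0T.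
rewrite /energy; under eq_fun do rewrite !expr2.
have [c1 v1 w1] := And3 (cc t t0T) (cv t t0T) (cw t t0T).
by rewrite !expr2; apply: cvgD; apply: cvgM => //;
  [apply: cvgM => //; exact: cvg_cst|apply: cvgM].
Qed.

Lemma lipschitz_dini c s K : (forall t, `|c t - c s| <= K * `|t - s|) ->
  dini_le (fun t => `|c t - c s|) s K.
Proof.
move=> H eta eta0; near=> t.
have st : s < t by near: t; exact: nbhs_right_gt.
rewrite subrr normr0 subr0 (le_trans (H t))// ger0_norm ?subr_ge0 ?(ltW st)//.
by rewrite ler_wpM2r ?subr_ge0 ?(ltW st)// lerDl ltW.
Unshelve. all: by end_near. Qed.

(* The equation solved by the difference of two modes with coefficients [c] and
   [d] has source [- (c - d) l^2 r]; Young's inequality with weight [B]. *)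
Lemma energy_diff_dini c d l p q p' q' T f g r h K nu B s :
  0 < nu -> nu <= c s -> 0 <= K -> 0 < B -> 0 <= s <= T ->
  (forall t, `|c t - c s| <= K * `|t - s|) ->
  mode_sol c l p q T f g -> mode_sol d l p' q' T r h ->
  dini_le (energy c l (f - r) (g - h)) s
    ((K / nu + B) * energy c l (f - r) (g - h) s +
      ((c s - d s) * l ^+ 2 * r s) ^+ 2 / B).
Proof.
move=> nu0 nuc K0 B0 s0T lipc [_ _ df dg] [_ _ dr dh].
have c0 : 0 <= c s by rewrite (le_trans _ nuc)// ltW.
set phi := - ((c s - d s) * l ^+ 2 * r s).
have dv : is_derive s 1 (f - r) ((g - h) s).
  exact: (is_deriveB (df _ s0T) (dr _ s0T)).
have dw : is_derive s 1 (g - h) (- (c s * l ^+ 2 * (f - r) s) + phi).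
  apply: (is_derive_eq (is_deriveB (dg _ s0T) (dh _ s0T))).
  by rewrite /phi !fctE; ring.
apply: (dini_leW _ (energy_dini K0 (lipschitz_dini lipc) dv dw)).
set e := energy _ _ _ _ _.
have e1 : l ^+ 2 * (f - r) s ^+ 2 <= e / nu.
  by rewrite ler_pdivlMr// mulrC energy_potential.
have e2 : (g - h) s ^+ 2 <= e by exact: energy_kinetic.
have -> : ((c s - d s) * l ^+ 2 * r s) ^+ 2 = phi ^+ 2 by rewrite /phi sqrrN.
set x := (g - h) s in e2 *.
have young : 2 * x * phi <= B * x ^+ 2 + phi ^+ 2 / B.
  rewrite -subr_ge0.
  have -> : B * x ^+ 2 + phi ^+ 2 / B - 2 * x * phi = (B * x - phi) ^+ 2 / B.
    by field; rewrite gt_eqF.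
  by rewrite divr_ge0 ?sqr_ge0// ltW.
have := ler_wpM2l K0 e1; rewrite mulrA mulrAC => e1'.
have e2' := ler_wpM2l (ltW B0) e2.
by rewrite mulrDl; lra.
Qed.

Lemma mode_sol0 d l T : mode_sol d l 0 0 T (cst 0) (cst 0).
Proof.
split => // t _; first exact: is_derive_cst.
by rewrite /cst mulr0 oppr0; exact: is_derive_cst.
Qed.

(** Without forcing, the energy grows at rate [K / nu], because the potential part is at most the
    energy over [nu]. The extra [1] is the strict gap that [gronwall] asks for. *)
Lemma energy_growth c l p q T f g K nu :
  0 < nu -> (forall t, nu <= c t) -> 0 <= K ->
  (forall s t, `|c t - c s| <= K * `|t - s|) -> mode_sol c l p q T f g ->
  forall t, 0 <= t <= T ->
    energy c l f g t <= energy c l f g 0 * expR ((K / nu + 1) * t).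
Proof.
move=> nu0 nuc K0 lipc sol t t0T.
have cc : continuous_upto T c by apply: (@lipschitz_continuous_upto _ _ _ K).
have [_ _ df dg] := sol.
have e00 : 0 <= energy c l f g 0 by rewrite energy_ge0// (le_trans (ltW nu0)).
have := @gronwall R (energy c l f g) T (energy c l f g 0) (K / nu) 0 (K / nu + 1).
rewrite (mul0r (_^-1)) addr0; apply => //.
- by apply: energy_continuous => // s /[dup] s0T;
    [move=> /df|move=> /dg]; exact: is_derive1_continuous.
- by rewrite ltrDl.
- move=> s /andP[s0 sT]; rewrite mul0r addr0.
  have s0T : 0 <= s <= T by rewrite s0 ltW.
  apply: (dini_leW _ (energy_dini (phi := 0) K0 (lipschitz_dini (lipc s)) (df _ s0T) _)).
    rewrite mulr0 addr0 -[leRHS]mulrA ler_wpM2l// ler_pdivlMl//.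
    exact: energy_potential.
  by rewrite addr0; exact: dg.
Qed.

End Energies.

(** * The fixed point for infinitely many modes *)

Section Series.
Context {R : realType}.
Implicit Types (a b : R) (u v : nat -> R).

Lemma bounded_series_cvg u b : (forall k, 0 <= u k) ->
  (forall n, \sum_(0 <= k < n) u k <= b) -> cvgn (series u).
Proof.
move=> u0 ub; apply: nondecreasing_is_cvgn.
  by apply/nondecreasing_seqP => n; rewrite /series/= big_nat_recr//= lerDl.
by exists b => _ [n _ <-]; exact: ub.
Qed.

Lemma series_le_lim u a n : (forall k, 0 <= u k) -> series u @ \oo --> a ->
  \sum_(0 <= k < n) u k <= a.
Proof.
move=> u0 ua.
have : - a <= - \sum_(0 <= k < n) u k.
  apply: (@cvgn_le _ (fun m => - series u m) _ _ n); first exact: cvgN.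
  move=> m nm; rewrite lerN2 /series/= [leRHS](@big_cat_nat _ _ _ n)//= lerDl.
  by rewrite sumr_ge0.
by rewrite lerN2.
Qed.

Lemma norm_le_sqr a b : 0 <= b -> a ^+ 2 <= b ^+ 2 -> `|a| <= b.
Proof. by move=> b0; rewrite -(real_normK (num_real a)) ler_sqr ?nnegrE. Qed.

Lemma sqr_le_norm a b : `|a| <= b -> a ^+ 2 <= b ^+ 2.
Proof.
by move=> ab; rewrite -(real_normK (num_real a)) ler_sqr ?nnegrE// (le_trans _ ab).
Qed.

End Series.

Section Kirchhoff.
Context {R : realType}.
Implicit Types (sig rho : R -> R) (p q : nat -> R) (f g r h : nat -> R -> R).
Implicit Types (s t T K B D E : R).

(** [mh] stands for a truncation of [m], so that the bounds can be global. The normalisation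
    [nu <= 1 <= M, L] lets products of constants be compared factor by factor. *)
Record coef_bounds (mh : R -> R) (nu M L : R) : Prop := CoefBounds {
  coef_nu_gt0 : 0 < nu ;
  coef_nu_le1 : nu <= 1 ;
  coef_M_ge1 : 1 <= M ;
  coef_L_ge1 : 1 <= L ;
  coef_ge : forall x, nu <= mh x ;
  coef_le : forall x, mh x <= M ;
  coef_lip : forall x y, `|mh x - mh y| <= L * `|x - y| }.

Variables (mh : R -> R) (nu M L : R) (hm : coef_bounds mh nu M L).
Variables (lam : nat -> R) (lam0 : forall k, 0 <= lam k).

Let nu0 := coef_nu_gt0 hm.
Let nu1 := coef_nu_le1 hm.
Let M1 := coef_M_ge1 hm.
Let L1 := coef_L_ge1 hm.
Let M0 : 0 < M. Proof. exact: lt_le_trans ltr01 M1. Qed.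
Let L0 : 0 < L. Proof. exact: lt_le_trans ltr01 L1. Qed.

Definition lipschitz_upto T K sig := forall s t, 0 <= s <= T -> 0 <= t <= T ->
  `|sig t - sig s| <= K * `|t - s|.

Definition coef T sig t := mh (sig (clamp T t)).

Definition modes T sig p q f g := forall k,
  mode_sol (coef T sig) (lam k) (p k) (q k) T (f k) (g k).

Definition data_energy p q k := q k ^+ 2 + lam k ^+ 2 * p k ^+ 2.

Lemma data_energy_ge0 p q k : 0 <= data_energy p q k.
Proof. by rewrite addr_ge0 ?sqr_ge0// mulr_ge0 ?sqr_ge0. Qed.

Lemma coef_lipschitz T K sig : 0 <= T -> 0 <= K -> lipschitz_upto T K sig ->
  forall s t, `|coef T sig t - coef T sig s| <= L * K * `|t - s|.
Proof.
move=> T0 K0 lip s t; rewrite (le_trans (coef_lip hm _ _))// -mulrA.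
rewrite ler_wpM2l ?(ltW L0)// (le_trans (lip _ _ _ _)) ?clamp_in//.
by rewrite ler_wpM2l// clamp_lipschitz.
Qed.

Lemma coef_continuous T K sig : 0 <= T -> 0 <= K -> lipschitz_upto T K sig ->
  continuous_upto T (coef T sig).
Proof.
move=> T0 K0 /(coef_lipschitz T0 K0) lip.
by apply: (@lipschitz_continuous_upto _ _ _ (L * K)) => s t _ _; exact: lip.
Qed.

Lemma modes_exist T K sig p q : 0 <= T -> 0 <= K -> lipschitz_upto T K sig ->
  exists fg : (nat -> R -> R) * (nat -> R -> R), modes T sig p q fg.1 fg.2.
Proof.
move=> T0 K0 /(coef_continuous T0 K0) cc.
have /choice[fg Hfg] : forall k, exists fg : (R -> R) * (R -> R),
    mode_sol (coef T sig) (lam k) (p k) (q k) T fg.1 fg.2.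
  move=> k; have [|f [g fg]] :=
    @mode_sol_exists _ (coef T sig) (lam k) (p k) (q k) T M T0 cc.
    by move=> t _; rewrite ger0_norm ?(coef_le hm)// (le_trans _ (coef_ge hm _))// ltW.
  by exists (f, g).
by exists (fun k => (fg k).1, fun k => (fg k).2).
Qed.

(** The rate involves the Lipschitz constant of the coefficient but no frequency, so one factor
    serves all modes. [M] compares the energy at time 0 with [data_energy]. *)
Definition growth T K := M * expR ((L * K / nu + 1) * T).

Lemma modes_energy T K sig p q f g : 0 <= T -> 0 <= K ->
  lipschitz_upto T K sig -> modes T sig p q f g -> forall k t, 0 <= t <= T ->
  energy (coef T sig) (lam k) (f k) (g k) t <= growth T K * data_energy p q k.
Proof.
move=> T0 K0 lip fg k t t0T.
have LK0 : 0 <= L * K by rewrite mulr_ge0// ltW.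
have := energy_growth nu0 (fun _ => coef_ge hm _) LK0
  (coef_lipschitz T0 K0 lip) (fg k) t0T.
move=> /le_trans; apply; rewrite /growth [leRHS]mulrAC; apply: ler_pM.
- by rewrite energy_ge0// (le_trans (ltW nu0))//; exact: (coef_ge hm).
- by rewrite expR_ge0.
- rewrite /energy (mode_init (fg k)) (mode_init' (fg k)) /data_energy mulrDr.
  have lp0 : 0 <= lam k ^+ 2 * p k ^+ 2 by rewrite mulr_ge0 ?sqr_ge0.
  rewrite lerD// ?ler_peMl ?sqr_ge0// -mulrA ler_wpM2r//.
  exact: (coef_le hm).
- rewrite ler_expR ler_wpM2l//; last by case/andP: t0T.
  by rewrite addr_ge0// divr_ge0// ltW.
Qed.

Lemma modes_potential T K sig p q f g : 0 <= T -> 0 <= K ->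
  lipschitz_upto T K sig -> modes T sig p q f g -> forall k t, 0 <= t <= T ->
  lam k ^+ 2 * f k t ^+ 2 <= growth T K / nu * data_energy p q k.
Proof.
move=> T0 K0 lip fg k t t0T; rewrite [leRHS]mulrAC ler_pdivlMr// mulrC.
apply: le_trans (modes_energy T0 K0 lip fg k t0T).
by apply: energy_potential; exact: (coef_ge hm).
Qed.

Lemma growth_ge0 T K : 0 <= growth T K.
Proof. by rewrite mulr_ge0 ?expR_ge0// ltW. Qed.

Lemma modes_potential_cvg T K E sig p q f g : 0 <= T -> 0 <= K ->
  lipschitz_upto T K sig -> modes T sig p q f g ->
  (forall n, \sum_(0 <= k < n) (1 + lam k) * data_energy p q k <= E) ->
  forall t, 0 <= t <= T ->
  let u k := lam k ^+ 2 * f k t ^+ 2 in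
  cvgn (series u) /\ 0 <= limn (series u) <= growth T K / nu * E.
Proof.
move=> T0 K0 lip fg bE t t0T u.
have u0 k : 0 <= u k by rewrite mulr_ge0 ?sqr_ge0.
have ub n : \sum_(0 <= k < n) u k <= growth T K / nu * E.
  have G0 : 0 <= growth T K / nu by rewrite divr_ge0 ?growth_ge0// ltW.
  rewrite (le_trans _ (ler_wpM2l G0 (bE n)))// mulr_sumr ler_sum// => k _.
  rewrite (le_trans (modes_potential T0 K0 lip fg k t0T))// ler_wpM2l//.
  by rewrite ler_peMl ?data_energy_ge0// lerDl.
have cu := bounded_series_cvg u0 ub; split => //; apply/andP; split.
  by have := series_le_lim 0%N u0 cu; rewrite big_geq.
by apply: (cvgn_le (N := 0%N) cu) => n _; exact: ub.
Qed.

(** The difference of two modes starts from zero with source [(c - d) l^2 r], so its energy carries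
    a factor [l^2] more than the data energy. Writing [l^2 (f^2 - r^2)] as the product of
    [l (f - r)] and [l (f + r)] leaves one factor [l] in all, which the weight [1 + lam k] in the
    assumed bound on the data absorbs. *)
Lemma modes_contraction T K E D sig tau p q f g r h : 0 <= T -> 0 <= K ->
  lipschitz_upto T K sig -> lipschitz_upto T K tau ->
  modes T sig p q f g -> modes T tau p q r h ->
  (forall n, \sum_(0 <= k < n) (1 + lam k) * data_energy p q k <= E) ->
  0 <= D -> forall B, 1 <= B -> 2 * (L * K / nu) <= B ->
  6 * L * (growth T K / nu) / nu * E <= B ->
  (forall t, 0 <= t <= T -> `|sig t - tau t| <= D * expR (B * t)) ->
  forall t, 0 <= t <= T ->
  `|limn (series (fun k => lam k ^+ 2 * f k t ^+ 2)) -
    limn (series (fun k => lam k ^+ 2 * r k t ^+ 2))| <= D / 2 * expR (B * t).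
Proof.
move=> T0 K0 lips lipt fg rh bE D0 B B1 BK BE dst t t0T.
have LK0 : 0 <= L * K by rewrite mulr_ge0// ltW.
have B0 : 0 < B by rewrite (lt_le_trans _ B1).
have t0 : 0 <= t by case/andP: t0T.
set c := coef T sig; set d := coef T tau; set G := growth T K / nu.
have G0 : 0 <= G by rewrite divr_ge0 ?growth_ge0// ltW.
have cd s : 0 <= s <= T -> `|c s - d s| <= L * (D * expR (B * s)).
  move=> s0T; rewrite (le_trans (coef_lip hm _ _))// ler_wpM2l ?(ltW L0)//.
  by rewrite clamp_id//; exact: dst.
set eB := expR (B * t).
have eB0 : 0 < eB by exact: expR_gt0.
have diff k : `|lam k ^+ 2 * f k t ^+ 2 - lam k ^+ 2 * r k t ^+ 2| <=
    3 * L * D * G / (nu * B) * eB * (lam k * data_energy p q k).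
  set A := data_energy p q k; set l := lam k.
  have A0 : 0 <= A by exact: data_energy_ge0.
  have l0 : 0 <= l by exact: lam0.
  have [_ _ df dg] := fg k; have [_ _ dr dh] := rh k.
  have Z0 : 0 <= G * A by rewrite mulr_ge0.
  set be := (L * D * l) ^+ 2 * (G * A) / B.
  have be0 : 0 <= be by rewrite divr_ge0 ?(ltW B0)// mulr_ge0 ?sqr_ge0.
  set e := energy c l (f k - r k) (g k - h k).
  (* Rate [2 B] for the source against [L * K / nu + B] for the energy: the gap is at least
     [B / 2]. *)
  have := @gronwall R e T 0 (L * K / nu + B) be (B + B).
  rewrite add0r => /(_ _ (lexx 0) be0) Hgr.
  have {Hgr} et : e t <= be / (B + B - (L * K / nu + B)) * expR ((B + B) * t).
    apply: Hgr => //.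
    - apply: energy_continuous; first exact: coef_continuous lips.
        move=> s s0T; apply: (is_derive1_continuous (is_deriveB (df s s0T) (dr s s0T))).
      by move=> s s0T; apply: (is_derive1_continuous (is_deriveB (dg s s0T) (dh s s0T))).
    - by rewrite ltrD2r; lra.
    - rewrite /e /energy !fctE (mode_init (fg k)) (mode_init (rh k)).
      by rewrite (mode_init' (fg k)) (mode_init' (rh k)) !subrr expr0n/= mulr0 addr0.
    - move=> s /andP[s0 sT]; have s0T : 0 <= s <= T by rewrite s0 ltW.
      apply: (dini_leW _ (energy_diff_dini nu0 (coef_ge hm _) LK0 B0 s0T
        (coef_lipschitz T0 K0 lips s) (fg k) (rh k))).
      rewrite lerD2l /be [leRHS]mulrAC ler_wpM2r ?invr_ge0 ?(ltW B0)//.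
      rewrite [(B + B) * s]mulrDl expRD -expr2.
      have := modes_potential T0 K0 lipt rh k s0T.
      have := sqr_le_norm (cd s s0T); rewrite -/l -/G -/A.
      move: (c s - d s) (expR (B * s)) (r k s) (sqr_ge0 (c s - d s)) => X Y z X0 h2 h1.
      rewrite (_ : _ ^+ 2 = X ^+ 2 * (l ^+ 2 * (l ^+ 2 * z ^+ 2))); last by ring.
      rewrite [leRHS](_ : _ = (L * (D * Y)) ^+ 2 * (l ^+ 2 * (G * A))); last by ring.
      apply: ler_pM => //; last by rewrite ler_wpM2l ?sqr_ge0.
      by rewrite mulr_ge0 ?sqr_ge0// mulr_ge0 ?sqr_ge0.
  have {}et : e t <= 2 * (L * D * l) ^+ 2 * (G * A) / B ^+ 2 * eB ^+ 2.
    rewrite (le_trans et)// [(B + B) * t]mulrDl expRD -expr2 -/eB.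
    rewrite ler_wpM2r ?sqr_ge0//.
    have B2 : B / 2 <= B + B - (L * K / nu + B) by lra.
    have B20 : 0 < B / 2 by rewrite divr_gt0.
    rewrite (@le_trans _ _ (be / (B / 2)))//.
      by rewrite ler_wpM2l// lef_pV2// posrE// (lt_le_trans B20).
    rewrite le_eqVlt; apply/orP; left; apply/eqP; rewrite /be; field.
    by rewrite gt_eqF.
  have h1 := modes_potential T0 K0 lips fg k t0T.
  have h2 := modes_potential T0 K0 lipt rh k t0T.
  have h3 : l ^+ 2 * (f k t - r k t) ^+ 2 <= e t / nu.
    rewrite ler_pdivlMr// mulrC.
    exact: (energy_potential l (f k - r k) (g k - h k) (coef_ge hm _)).
  have h4 : l ^+ 2 * (f k t + r k t) ^+ 2 <= 4 * (G * A).
    have : 0 <= l ^+ 2 * (f k t - r k t) ^+ 2 by rewrite mulr_ge0 ?sqr_ge0.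
    by move: h1 h2; rewrite -/l -/G -/A; lra.
  apply: norm_le_sqr.
    apply: mulr_ge0; last exact: mulr_ge0.
    apply: mulr_ge0; last exact: ltW.
    by apply: divr_ge0; [do 3 rewrite mulr_ge0//; rewrite ltW|rewrite mulr_ge0// ltW].
  rewrite -mulrBr subr_sqr.
  rewrite (_ : _ ^+ 2 = (l ^+ 2 * (f k t - r k t) ^+ 2) *
    (l ^+ 2 * (f k t + r k t) ^+ 2)); last by ring.
  apply: (@le_trans _ _ (e t / nu * (4 * (G * A)))).
    by apply: ler_pM => //; rewrite mulr_ge0 ?sqr_ge0.
  apply: (@le_trans _ _ (2 * (L * D * l) ^+ 2 * (G * A) / B ^+ 2 * eB ^+ 2 / nu *
    (4 * (G * A)))).
    apply: ler_wpM2r; first exact: mulr_ge0.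
    by apply: ler_wpM2r => //; rewrite invr_ge0 ltW.
  (* The claim reduces to [8 * nu <= 9], which explains the factor 3 in [diff]. *)
  set Q := (L * D * G / B * eB * (l * A)) ^+ 2.
  have Q0 : 0 <= Q by exact: sqr_ge0.
  rewrite [leLHS](_ : _ = 8 * nu * (Q / nu ^+ 2)); last first.
    by rewrite /Q; field; rewrite !gt_eqF.
  rewrite [leRHS](_ : _ = 9 * (Q / nu ^+ 2)); last first.
    by rewrite /Q; field; rewrite !gt_eqF.
  by rewrite ler_wpM2r ?divr_ge0 ?sqr_ge0//; have := nu1; lra.
have [cf _] := modes_potential_cvg T0 K0 lips fg bE t0T.
have [cr _] := modes_potential_cvg T0 K0 lipt rh bE t0T.
apply: (@cvgn_le _ (fun n => `|series (fun k => lam k ^+ 2 * f k t ^+ 2) n -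
    series (fun k => lam k ^+ 2 * r k t ^+ 2) n|) _ _ 0%N).
  exact: (cvg_norm (cvgB cf cr)).
move=> n _; rewrite /series/= -sumrB (le_trans (ler_norm_sum _ _ _))//.
set C := 3 * L * D * G / (nu * B) * eB.
have C0 : 0 <= C.
  apply: mulr_ge0; last exact: ltW.
  by apply: divr_ge0; [do 3 rewrite mulr_ge0//; rewrite ltW|rewrite mulr_ge0// ltW].
apply: (@le_trans _ _ (C * E)).
  rewrite (le_trans _ (ler_wpM2l C0 (bE n)))// mulr_sumr ler_sum// => k _.
  rewrite (le_trans (diff k))// ler_wpM2l// ler_wpM2r ?data_energy_ge0//.
  by rewrite lerDr.
rewrite /C mulrAC ler_wpM2r ?(ltW eB0)//.
rewrite [leLHS](_ : _ = D * (6 * L * G / nu * E) / B / 2); last first.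
  by field; rewrite !gt_eqF.
by rewrite ler_wpM2r// ler_pdivrMr// ler_wpM2l.
Qed.

(** On uniformly Lipschitz functions the weight can be taken so large that the map contracts by one
    half, whatever [T] is. Existence on all of [[0, T]] is thus reduced to a closed invariant set,
    with no continuation argument. *)
Lemma kirchhoff_fixpoint T K E p q (X : set (R -> R)) sig0 :
  0 <= T -> 0 <= K ->
  (forall n, \sum_(0 <= k < n) (1 + lam k) * data_energy p q k <= E) ->
  X sig0 -> (forall sig, X sig -> lipschitz_upto T K sig) ->
  (forall (u : nat -> R -> R) sig, (forall n, X (u n)) ->
    (forall t, 0 <= t <= T -> u ^~ t @ \oo --> sig t) -> X sig) ->
  (forall sig tau f g, X sig -> modes T sig p q f g ->
    (forall t, 0 <= t <= T ->
      series (fun k => lam k ^+ 2 * f k t ^+ 2) @ \oo --> tau t) -> X tau) ->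
  exists sig f g, [/\ X sig, modes T sig p q f g & forall t, 0 <= t <= T ->
    series (fun k => lam k ^+ 2 * f k t ^+ 2) @ \oo --> sig t].
Proof.
move=> T0 K0 bE X0 Xlip Xlim Xinv.
have /choice[P HP] : forall sig, exists fg : (nat -> R -> R) * (nat -> R -> R),
    X sig -> modes T sig p q fg.1 fg.2.
  move=> sig; have [Xs|nXs] := pselect (X sig).
    by have [fg] := modes_exist p q T0 K0 (Xlip _ Xs); exists fg.
  by exists (fun=> id, fun=> id).
pose Phi sig t := limn (series (fun k => lam k ^+ 2 * (P sig).1 k t ^+ 2)).
have Pcvg sig t : X sig -> 0 <= t <= T ->
    series (fun k => lam k ^+ 2 * (P sig).1 k t ^+ 2) @ \oo --> Phi sig t.
  by move=> Xs t0T; have [] := modes_potential_cvg T0 K0 (Xlip _ Xs) (HP _ Xs) bE t0T.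
have XPhi sig : X sig -> X (Phi sig).
  by move=> Xs; apply: (Xinv sig _ _ _ Xs (HP _ Xs)) => t; exact: Pcvg.
have E0 : 0 <= E by have := bE 0%N; rewrite big_geq.
have G0 : 0 <= growth T K / nu by rewrite divr_ge0 ?growth_ge0// ltW.
pose B := 1 + 2 * (L * K / nu) + 6 * L * (growth T K / nu) / nu * E.
have b1 : 0 <= L * K / nu by rewrite !mulr_ge0 ?invr_ge0 ?(ltW nu0) ?(ltW L0).
have b2 : 0 <= 6 * L * (growth T K / nu) / nu * E.
  apply: mulr_ge0 => //; apply: divr_ge0; last exact: ltW.
  by apply: mulr_ge0 => //; rewrite mulr_ge0// ltW.
have B1 : 1 <= B by rewrite /B; lra.
pose D0 := growth T K / nu * E + (`|sig0 0| + K * T).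
have [||||sig Xs fixs] :=
  @volterra_fixpoint _ X Phi T B D0 sig0 X0 XPhi _ _ _ (le_trans ler01 B1).
- move=> u sig Xu uc; apply: (Xlim u) => // t t0T.
  apply/cvgrPdist_le => e /uc [n hn]; exists n => //= k nk.
  by rewrite distrC hn.
- move=> t t0T.
  have [_ /andP[h1 h2]] := modes_potential_cvg T0 K0 (Xlip _ X0) (HP _ X0) bE t0T.
  have h3 : `|sig0 t| <= `|sig0 0| + K * T.
    have T0T : 0 <= (0 : R) <= T by rewrite lexx.
    have := Xlip _ X0 _ _ T0T t0T; rewrite subr0 => h4.
    rewrite -[sig0 t](subrK (sig0 0)) (le_trans (ler_normD _ _))// addrC lerD2l.
    rewrite (le_trans h4)// ler_wpM2l// ger0_norm; by case/andP: t0T.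
  have h4 : `|Phi sig0 t - sig0 t| <= D0.
    by rewrite (le_trans (ler_normB _ _))// lerD// ger0_norm.
  have D00 : 0 <= D0 by rewrite (le_trans _ h4).
  rewrite (le_trans h4)// ler_peMr// -expR0 ler_expR mulr_ge0//.
    exact: le_trans ler01 B1.
  by case/andP: t0T.
- by apply: addr_ge0; [exact: mulr_ge0|rewrite addr_ge0// mulr_ge0].
- move=> f g D Xf Xg D0' fg t t0T.
  apply: (modes_contraction T0 K0 (Xlip _ Xf) (Xlip _ Xg) (HP _ Xf) (HP _ Xg) bE D0' B1) => //.
    by rewrite /B; lra.
  by rewrite /B; lra.
exists sig, (P sig).1, (P sig).2; split => //; first exact: HP.
by move=> t t0T; rewrite -fixs//; exact: Pcvg.
Qed.

End Kirchhoff.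

(** * Reference solutions with finitely many modes *)

Section FiniteSums.
Context {R : realType}.
Implicit Types (s t T K : R) (f : R -> R) (u : nat -> R).

Lemma is_derive1_sum (F : nat -> R -> R) (F' : nat -> R) t n :
  (forall k, is_derive t 1 (F k) (F' k)) ->
  is_derive t 1 (fun s => \sum_(0 <= k < n) F k s) (\sum_(0 <= k < n) F' k).
Proof.
move=> dF; elim: n => [|n IH].
  under eq_fun do rewrite big_geq//.
  by rewrite big_geq//; exact: is_derive_cst.
rewrite (_ : (fun s => _) = (fun s => \sum_(0 <= k < n) F k s) + F n).
  by rewrite big_nat_recr//=; exact: is_deriveD.
by apply/funext => s; rewrite big_nat_recr.
Qed.

Lemma dini_le_sum_nat (F : nat -> R -> R) (D : nat -> R) s n :
  (forall k, dini_le (F k) s (D k)) ->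
  dini_le (fun t => \sum_(0 <= k < n) F k t) s (\sum_(0 <= k < n) D k).
Proof.
move=> H; rewrite big_mkord; under eq_fun do rewrite big_mkord.
by apply: dini_le_sum => k _; exact: H.
Qed.

Lemma lipschitz_of_derive f f' T K :
  (forall t, 0 <= t <= T -> is_derive t 1 f (f' t)) ->
  (forall t, 0 <= t <= T -> `|f' t| <= K) -> lipschitz_upto T K f.
Proof.
move=> df bf; suff H s t : 0 <= s -> s <= t -> t <= T -> `|f t - f s| <= K * `|t - s|.
  move=> s t /andP[s0 sT] /andP[t0 tT]; have [st|/ltW ts] := leP s t; first exact: H.
  by rewrite distrC [`|t - s|]distrC; exact: H.
move=> s0 st tT.
have [x /andP[sx xt] ->] : exists2 x, s <= x <= t & f t - f s = f' x * (t - s).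
  apply: mean_value => // x /andP[sx xt]; apply: df.
  by rewrite (le_trans s0)//= (le_trans xt).
rewrite normrM ler_wpM2r// bf//.
by rewrite (le_trans s0)//= (le_trans xt).
Qed.

Lemma finite_series_cvg u n : (forall k, (n <= k)%N -> u k = 0) ->
  series u @ \oo --> \sum_(0 <= k < n) u k.
Proof.
move=> u0; apply/cvgrPdist_le => e e0; exists n => //= m /= nm.
rewrite /series/= [X in _ - X](@big_cat_nat _ _ _ n)//= opprD addrA subrr sub0r.
by rewrite big_nat_cond big1 ?oppr0 ?normr0 ?(ltW e0)// => k /andP[/andP[/u0]].
Qed.

Lemma is_derive1_sqrM f (f' t l : R) : is_derive t 1 f f' ->
  is_derive t 1 (fun s => l ^+ 2 * f s ^+ 2) (2 * l ^+ 2 * (f t * f')).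
Proof.
move=> df; have H : is_derive t 1 ((l ^+ 2) \*: f ^+ 2)
    ((l ^+ 2) *: ((2%:R * f t ^+ 1) *: f')) by exact: is_deriveZ.
by apply: (is_derive_eq H); rewrite /GRing.scale/= expr1; ring.
Qed.

End FiniteSums.

Section Reference.
Context {R : realType}.
Implicit Types (sig rho : R -> R) (p q : nat -> R) (f g r h : nat -> R -> R).
Implicit Types (s t T K B D E : R).
Variables (mh : R -> R) (nu M L : R) (hm : coef_bounds mh nu M L).
Variables (lam : nat -> R) (lam0 : forall k, 0 <= lam k).

Let nu0 : 0 < nu := coef_nu_gt0 hm.
Let nu1 : nu <= 1 := coef_nu_le1 hm.
Let M1 : 1 <= M := coef_M_ge1 hm.
Let M0 : 0 < M. Proof. exact: lt_le_trans ltr01 M1. Qed.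
Let L0 : 0 < L. Proof. exact: lt_le_trans ltr01 (coef_L_ge1 hm). Qed.

(** Compare with coefficient 1: the cross term [(1 - c) l^2 f g] is at most [M l] times the energy.
    The rate depends on the frequency but, unlike in [energy_growth], not on the regularity of
    [c]. *)
Lemma mode_crude_growth (c : R -> R) (l a b : R) T (f g : R -> R) : 0 <= l ->
  (forall t, 0 <= c t <= M) -> mode_sol c l a b T f g ->
  forall t, 0 <= t <= T ->
  g t ^+ 2 + l ^+ 2 * f t ^+ 2 <= (b ^+ 2 + l ^+ 2 * a ^+ 2) * expR ((M * l + 1) * t).
Proof.
move=> l0 cM sol t t0T; have [f0 g0 df dg] := sol.
pose e := energy (cst 1) l f g.
have eE s : e s = g s ^+ 2 + l ^+ 2 * f s ^+ 2 by rewrite /e /energy mul1r.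
have e0 : e 0 = b ^+ 2 + l ^+ 2 * a ^+ 2 by rewrite eE f0 g0.
rewrite -eE -e0.
have e00 s : 0 <= e s by apply: energy_ge0; rewrite /cst ler01.
have := @gronwall R e T (e 0) (M * l) 0 (M * l + 1).
rewrite (mul0r (_^-1)) addr0; apply => //.
- apply: energy_continuous => [s _|s /df|s /dg]; [exact: cvg_cst| |];
    exact: is_derive1_continuous.
- by rewrite ltrDl.
- move=> s /andP[s0 sT]; have s0T : 0 <= s <= T by rewrite s0 ltW.
  rewrite mul0r addr0.
  have lip1 x : `|cst 1 x - cst 1 s| <= 0 * `|x - s| :> R.
    by rewrite subrr normr0 mul0r.
  have dg' : is_derive s 1 g (- (cst 1 s * l ^+ 2 * f s) + (1 - c s) * l ^+ 2 * f s).
    by apply: (is_derive_eq (dg _ s0T)); rewrite /cst; ring.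
  apply: (dini_leW _ (energy_dini (lexx 0) (lipschitz_dini lip1) (df _ s0T) dg')).
  rewrite mul0r add0r.
  have cs : `|1 - c s| <= M.
    by have /andP[c0 c1] := cM s; rewrite ler_norml; have := M1; lra.
  rewrite (le_trans (ler_norm _))//.
  rewrite (_ : 2 * g s * _ = (1 - c s) * (l * (2 * g s * (l * f s)))); last by ring.
  rewrite normrM -[leRHS]mulrA; apply: ler_pM => //.
  rewrite normrM ger0_norm// ler_wpM2l// eE ler_norml; apply/andP; split.
    have := sqr_ge0 (g s + l * f s); rewrite sqrrD exprMn; lra.
  have := sqr_ge0 (g s - l * f s); rewrite sqrrB exprMn; lra.
Qed.

Record reference N T p q rho r h : Prop := Reference {
  ref_lip : exists2 K, 0 <= K & lipschitz_upto T K rho ;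
  ref_modes : modes mh lam T rho p q r h ;
  ref_rho : forall t, 0 <= t <= T ->
    rho t = \sum_(0 <= k < N) lam k ^+ 2 * r k t ^+ 2 ;
  ref_r0 : forall k, (N <= k)%N -> r k = cst 0 ;
  ref_h0 : forall k, (N <= k)%N -> h k = cst 0 }.

(** The crude growth bound involves no Lipschitz constant of [sig]. With frequencies bounded by
    [Lam] it therefore fixes in advance a [K] for which the [K]-Lipschitz functions form an
    invariant set, for any [T]. *)
Lemma reference_exists N T p q : 0 <= T ->
  (forall k, (N <= k)%N -> p k = 0) -> (forall k, (N <= k)%N -> q k = 0) ->
  exists rho r h, reference N T p q rho r h.
Proof.
move=> T0 p0 q0.
pose A := data_energy lam p q.
have A0 k : 0 <= A k by exact: data_energy_ge0.
have AN k : (N <= k)%N -> A k = 0.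
  by move=> Nk; rewrite /A /data_energy p0// q0// expr0n/= mulr0 addr0.
pose Lam := \sum_(0 <= k < N) lam k.
have lamL k : (k < N)%N -> lam k <= Lam.
  move=> kN; rewrite /Lam big_mkord (bigD1 (Ordinal kN))//= lerDl.
  by rewrite sumr_ge0.
pose ex := expR ((M * Lam + 1) * T).
pose K := \sum_(0 <= k < N) lam k * (A k * ex).
have Lam0 : 0 <= Lam by rewrite sumr_ge0.
have K0 : 0 <= K.
  by rewrite sumr_ge0// => k _; rewrite mulr_ge0// mulr_ge0// expR_ge0.
have crude c k (f g : R -> R) : (forall t, 0 <= c t <= M) ->
    mode_sol c (lam k) (p k) (q k) T f g -> forall t, 0 <= t <= T ->
    g t ^+ 2 + lam k ^+ 2 * f t ^+ 2 <= A k * ex.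
  move=> cM sol t /andP[t0 tT].
  have t0T : 0 <= t <= T by rewrite t0.
  rewrite (le_trans (mode_crude_growth (lam0 k) cM sol t0T))//.
  have [kN|Nk] := ltnP k N; last by rewrite -/(data_energy lam p q k) -/(A k) AN// !mul0r.
  rewrite ler_wpM2l//; first exact: A0.
  rewrite ler_expR; apply: ler_pM => //.
    by rewrite addr_ge0// mulr_ge0// ltW.
  by rewrite lerD2r ler_wpM2l ?(ltW M0)// lamL.
have cM sig t : 0 <= coef mh T sig t <= M.
  by rewrite (coef_le hm) andbT (le_trans (ltW nu0))// (coef_ge hm).
have pot0 c k (f g : R -> R) : (forall t, 0 <= c t <= M) -> (N <= k)%N ->
    mode_sol c (lam k) (p k) (q k) T f g -> forall t, 0 <= t <= T ->
    lam k ^+ 2 * f t ^+ 2 = 0.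
  move=> c01 Nk sol t t0T; have := crude _ _ _ _ c01 sol t t0T.
  rewrite AN// mul0r; have := sqr_ge0 (g t).
  have : 0 <= lam k ^+ 2 * f t ^+ 2 by rewrite mulr_ge0 ?sqr_ge0.
  by move=> h1 h2 h3; apply/eqP; rewrite eq_le h1 andbT; lra.
pose X := [set sig : R -> R | lipschitz_upto T K sig].
have bE n : \sum_(0 <= k < n) (1 + lam k) * data_energy lam p q k <=
    \sum_(0 <= k < N) (1 + lam k) * data_energy lam p q k.
  apply: series_le_lim => [k|].
    by rewrite mulr_ge0 ?data_energy_ge0// addr_ge0.
  by apply: finite_series_cvg => k Nk; rewrite -/(A k) AN// mulr0.
have [||||rho [f [g [Xrho fg rhoE]]]] := @kirchhoff_fixpoint R mh nu M L hm lam lam0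
    T K _ p q X (cst 0) T0 K0 bE.
- by move=> s t _ _; rewrite subrr normr0 mulr_ge0.
- by [].
- move=> u sig Xu usig s t s0T t0T.
  apply: (@cvgn_le _ (fun n => `|u n t - u n s|) _ _ 0%N).
    by apply: cvg_norm; apply: cvgB; exact: usig.
  by move=> n _; exact: Xu.
- move=> sig tau f g _ fg tauE.
  have tE t : 0 <= t <= T -> tau t = \sum_(0 <= k < N) lam k ^+ 2 * f k t ^+ 2.
    move=> t0T; apply: (cvg_unique _ (tauE t t0T)) => //.
    apply: finite_series_cvg => k Nk; exact: (pot0 _ _ _ _ (cM sig) Nk (fg k)).
  have lipS : lipschitz_upto T K (fun t => \sum_(0 <= k < N) lam k ^+ 2 * f k t ^+ 2).
    apply: (@lipschitz_of_derive _ _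
      (fun t => \sum_(0 <= k < N) 2 * lam k ^+ 2 * (f k t * g k t))).
      move=> t t0T; apply: is_derive1_sum => k; apply: is_derive1_sqrM.
      exact: (mode_derive (fg k)).
    move=> t t0T; rewrite (le_trans (ler_norm_sum _ _ _))// ler_sum// => k _.
    rewrite (_ : _ * _ = lam k * (2 * (lam k * f k t) * g k t)); last by ring.
    rewrite normrM ger0_norm// ler_wpM2l//.
    rewrite (le_trans _ (crude _ _ _ _ (cM sig) (fg k) t t0T))//.
    rewrite ler_norml; apply/andP; split.
      have := sqr_ge0 (g k t + lam k * f k t); rewrite sqrrD exprMn; lra.
    have := sqr_ge0 (g k t - lam k * f k t); rewrite sqrrB exprMn; lra.
  by move=> s t s0T t0T; rewrite !tE//; exact: lipS.
(* By [pot0] the modes from [N] on contribute nothing to the sum; replacing them by the zero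
   solution makes every later sum finite. *)
pose r k := if (k < N)%N then f k else cst 0.
pose h k := if (k < N)%N then g k else cst 0.
exists rho, r, h; split.
- by exists K.
- move=> k; rewrite /r /h; case: ltnP => Nk; first exact: fg.
  by rewrite p0// q0//; exact: mode_sol0.
- move=> t t0T.
  have -> : rho t = \sum_(0 <= k < N) lam k ^+ 2 * f k t ^+ 2.
    apply: (cvg_unique _ (rhoE t t0T)) => //.
    apply: finite_series_cvg => k Nk; exact: (pot0 _ _ _ _ (cM rho) Nk (fg k)).
  rewrite big_nat [RHS]big_nat.
  by apply: eq_bigr => k /andP[_ kN]; rewrite /r kN.
- by move=> k Nk; rewrite /r ltnNge Nk.
- by move=> k Nk; rewrite /h ltnNge Nk.
Qed.

End Reference.

(** * Energy conservation and moment bounds for the reference, uniform in the number of modes *)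

Section ReferenceBounds.
Context {R : realType}.
Implicit Types (s t K B D E : R).
Variables (mh : R -> R) (nu M L : R) (hm : coef_bounds mh nu M L).
Variables (lam : nat -> R) (lam0 : forall k, 0 <= lam k).
Variables (N : nat) (T : R) (p q : nat -> R) (rho : R -> R) (r h : nat -> R -> R).
Hypotheses (T0 : 0 <= T) (ref : reference mh lam N T p q rho r h).

Let nu0 : 0 < nu := coef_nu_gt0 hm.
Let nu1 : nu <= 1 := coef_nu_le1 hm.
Let M1 : 1 <= M := coef_M_ge1 hm.
Let M0 : 0 < M. Proof. exact: lt_le_trans ltr01 M1. Qed.
Let L0 : 0 < L. Proof. exact: lt_le_trans ltr01 (coef_L_ge1 hm). Qed.

Let c := coef mh T rho.
Let b k := energy c (lam k) (r k) (h k).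
Let srho t := \sum_(0 <= k < N) lam k ^+ 2 * r k t ^+ 2.

Definition moment (w : nat -> R) t := \sum_(0 <= k < N) w k * b k t.

Let c_ge s : nu <= c s. Proof. exact: (coef_ge hm). Qed.
Let c_le s : c s <= M. Proof. exact: (coef_le hm). Qed.
Let c0 s : 0 <= c s. Proof. by rewrite (le_trans (ltW nu0)). Qed.
Let b0 k s : 0 <= b k s. Proof. exact: energy_ge0. Qed.

Lemma moment_ge0 w t : (forall k, 0 <= w k) -> 0 <= moment w t.
Proof. by move=> w0; rewrite sumr_ge0// => k _; rewrite mulr_ge0. Qed.

(** Each term of the derivative is [lam k] times [2 (lam r) h], and the latter is at most a mode
    energy over [nu]: one power of the frequency is lost. *)
Lemma reference_rho_derive t : 0 <= t <= T -> exists2 d,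
  is_derive t 1 srho d & `|d| <= moment lam t / nu.
Proof.
move=> t0T; exists (\sum_(0 <= k < N) 2 * lam k ^+ 2 * (r k t * h k t)).
  apply: is_derive1_sum => k; apply: is_derive1_sqrM.
  exact: (mode_derive (ref_modes ref k)).
rewrite (le_trans (ler_norm_sum _ _ _))// /moment mulr_suml ler_sum// => k _.
rewrite (_ : _ * _ * _ = lam k * (2 * (lam k * r k t) * h k t)); last by ring.
rewrite normrM ger0_norm// -[leRHS]mulrA ler_wpM2l// ler_pdivlMr//.
have h1 := energy_potential (lam k) (r k) (h k) (c_ge t).
have h2 : nu * (lam k ^+ 2 * r k t ^+ 2) + h k t ^+ 2 <= b k t.
  rewrite addrC lerD2l /energy -mulrA ler_wpM2r// mulr_ge0 ?sqr_ge0//.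
apply: le_trans h2.
have : `|2 * (lam k * r k t) * h k t| <= lam k ^+ 2 * r k t ^+ 2 + h k t ^+ 2.
  rewrite ler_norml; apply/andP; split.
    have := sqr_ge0 (h k t + lam k * r k t); rewrite sqrrD exprMn; lra.
  have := sqr_ge0 (h k t - lam k * r k t); rewrite sqrrB exprMn; lra.
move=> /(ler_wpM2l (ltW nu0)); rewrite mulrC => /le_trans; apply.
by rewrite mulrDr lerD2l ler_piMl ?sqr_ge0.
Qed.

Lemma reference_rho_lipschitz K : (forall t, 0 <= t <= T -> moment lam t / nu <= K) ->
  lipschitz_upto T K rho.
Proof.
move=> EK.
have /choice[d' Hd] : forall t, exists d, 0 <= t <= T -> is_derive t 1 srho d /\
    `|d| <= moment lam t / nu.
  move=> t; have [t0T|] := boolP (0 <= t <= T); last by exists 0.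
  by have [d ? ?] := reference_rho_derive t0T; exists d.
have : lipschitz_upto T K srho.
  apply: (lipschitz_of_derive (f' := d')) => t t0T; first by have [] := Hd t t0T.
  by have [_ /le_trans->//] := Hd t t0T; exact: EK.
by move=> H s t s0T t0T; rewrite !(ref_rho ref)//; exact: H.
Qed.

(** [mh] is merely Lipschitz, so the coefficient has a Dini bound and no derivative. What matters is
    that the bound involves the moment at the time [s] itself, not its supremum over [[0, T]]. *)
Lemma reference_coef_dini s : 0 <= s < T ->
  dini_le (fun t => `|c t - c s|) s (L * (moment lam s / nu)).
Proof.
move=> /andP[s0 sT]; have s0T : 0 <= s <= T by rewrite s0 ltW.
have [d dd bd] := reference_rho_derive s0T.
move=> eta eta0; have etaL : 0 < eta / L by rewrite divr_gt0.
have dd' : is_derive s 1 (fun t => - srho t) (- d) by exact: is_deriveN.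
near=> t.
have st : s < t by near: t; exact: nbhs_right_gt.
have tT : t <= T by near: t; exact: nbhs_right_le.
have H1 : srho t - srho s <= (d + eta / L) * (t - s).
  by near: t; exact: (is_derive1_dini dd).
have H2 : - srho t - - srho s <= (- d + eta / L) * (t - s).
  by near: t; exact: (is_derive1_dini dd').
rewrite subrr normr0 subr0 (le_trans (coef_lip hm _ _))//.
have t0T : 0 <= t <= T by rewrite tT (le_trans s0)// ltW.
rewrite !clamp_id// !(ref_rho ref)// -/(srho t) -/(srho s).
have ts0 : 0 <= t - s by rewrite subr_ge0 ltW.
have h1 := ler_wpM2r ts0 bd; have h2 := ler_wpM2r ts0 (ler_norm d).
have := ler_wpM2r ts0 (ler_norm (- d)); rewrite normrN => h3.
have : `|srho t - srho s| <= (moment lam s / nu + eta / L) * (t - s).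
  by rewrite ler_norml; apply/andP; split; lra.
move=> /(ler_wpM2l (ltW L0))/le_trans; apply.
rewrite [leLHS]mulrA ler_wpM2r// mulrDr lerD2l mulrCA divff ?mulr1//.
by rewrite gt_eqF.
Unshelve. all: by end_near. Qed.

(** All modes share one coefficient, so every weighted sum of energies obeys the same relative
    growth rate. One [nu] comes from the derivative of [rho], the other from bounding the potential
    part by the energy. *)
Lemma reference_moment_dini w s : (forall k, 0 <= w k) -> 0 <= s < T ->
  dini_le (moment w) s (L / nu ^+ 2 * moment lam s * moment w s).
Proof.
move=> w0 s0T; have s0T' : 0 <= s <= T by case/andP: s0T => -> /= /ltW.
have E0 : 0 <= moment lam s by exact: moment_ge0.
have kap0 : 0 <= L * (moment lam s / nu).
  by rewrite mulr_ge0 ?(ltW L0)// divr_ge0// ltW.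
have bd k : dini_le (fun t => w k * b k t) s
    (w k * (L / nu ^+ 2 * moment lam s * b k s)).
  apply: dini_leZ => //.
  have [_ _ dr dh] := ref_modes ref k.
  apply: (dini_leW _ (energy_dini (phi := 0) kap0 (reference_coef_dini s0T) (dr _ s0T') _)).
    rewrite mulr0 addr0.
    have := energy_potential (lam k) (r k) (h k) (c_ge s).
    rewrite mulrC -ler_pdivlMr// => /(ler_wpM2l kap0)/le_trans; apply.
    rewrite le_eqVlt; apply/orP; left; apply/eqP; rewrite /b; field.
    by rewrite gt_eqF.
  by rewrite addr0; exact: dh.
rewrite (_ : _ * moment w s =
  \sum_(0 <= k < N) w k * (L / nu ^+ 2 * moment lam s * b k s)).
  exact: (dini_le_sum_nat N bd).
move: (L / nu ^+ 2 * moment lam s) => C.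
by rewrite /moment mulr_sumr; apply: eq_bigr => k _; ring.
Qed.

Lemma moment_continuous w : continuous_upto T (moment w).
Proof.
have cc : continuous_upto T c.
  by have [K K0 lip] := ref_lip ref; exact: (coef_continuous hm T0 K0 lip).
move=> t t0T; rewrite /moment; elim: N => [|n IH].
  rewrite big_geq//; under eq_fun do rewrite big_geq//; exact: cvg_cst.
rewrite big_nat_recr//=; under eq_fun do rewrite big_nat_recr//=.
apply: cvgD => //; apply: cvgMr.
have [_ _ dr dh] := ref_modes ref n.
by apply: (energy_continuous cc _ _ t0T) => [s /dr|s /dh]; exact: is_derive1_continuous.
Qed.

(** The conserved quantity is the kinetic part plus [P (rho t)], with [P] a primitive of [mh]. [MS]
    bounds [mh] only on the range [[0, S0]] of the initial value, so the bound on [rho] is free of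
    [M] and the truncation level can be chosen after it without circularity. *)
Lemma reference_hamiltonian S0 MS Q0 : (forall x, 0 <= x <= S0 -> mh x <= MS) ->
  \sum_(0 <= k < N) lam k ^+ 2 * p k ^+ 2 <= S0 ->
  \sum_(0 <= k < N) q k ^+ 2 <= Q0 -> forall t, 0 <= t <= T ->
  rho t <= (Q0 + MS * S0) / nu /\
  moment (fun=> 1) t <= (Q0 + MS * S0) * (1 + M / nu).
Proof.
move=> mS pS qQ t t0T.
have srho0 s : 0 <= srho s by rewrite sumr_ge0// => k _; rewrite mulr_ge0 ?sqr_ge0.
have r0E : srho 0 = \sum_(0 <= k < N) lam k ^+ 2 * p k ^+ 2.
  by apply: eq_bigr => k _; rewrite (mode_init (ref_modes ref k)).
have [K K0 lip] := ref_lip ref.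
have zT : 0 <= (0 : R) <= T by rewrite lexx.
(* A provisional bound on [rho], needed only to have a primitive on its whole range; it does not
   enter the conclusion. *)
pose X := S0 + K * T.
have rhoX s : 0 <= s <= T -> srho s <= X.
  move=> s0T; have := lip _ _ zT s0T; rewrite !(ref_rho ref)// -/(srho s) -/(srho 0).
  rewrite subr0 => /(le_trans (ler_norm _)); rewrite lerBlDl => /le_trans; apply.
  rewrite /X lerD// ?r0E// ler_wpM2l// ger0_norm; by case/andP: s0T.
have S00 : 0 <= S0 by rewrite (le_trans _ pS)// -r0E.
have X0 : 0 <= X by rewrite addr_ge0// mulr_ge0.
have cmh : continuous mh.
  move=> x; apply/cvgrPdist_le => e e0; apply/nbhs_ballP.
  exists (e / L); first by rewrite /= divr_gt0.
  move=> y; rewrite /ball/= => xy; rewrite (le_trans (coef_lip hm _ _))//.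
  by rewrite mulrC -ler_pdivlMr// ltW.
have [P dP] := antiderivative cmh X0.
have Pge x : 0 <= x <= X -> nu * x <= P x - P 0.
  move=> /andP[x0 xX]; have [y /andP[y0 yx] ->] : exists2 y, 0 <= y <= x &
      P x - P 0 = mh y * (x - 0).
    by apply: mean_value => // y /andP[y0 yx]; apply: dP; rewrite y0 (le_trans yx).
  by rewrite subr0 ler_wpM2r// (coef_ge hm).
have Ple : P (srho 0) - P 0 <= MS * S0.
  have xX : srho 0 <= X by exact: rhoX.
  have [y /andP[y0 yx] ->] : exists2 y, 0 <= y <= srho 0 &
      P (srho 0) - P 0 = mh y * (srho 0 - 0).
    by apply: mean_value => // y /andP[y0 yx]; apply: dP; rewrite y0 (le_trans yx).
  have mSy : mh y <= MS by apply: mS; rewrite y0 (le_trans yx)// r0E.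
  rewrite subr0; apply: ler_pM => //; last by rewrite r0E.
  by rewrite (le_trans (ltW nu0))// (coef_ge hm).
pose kin s := \sum_(0 <= k < N) h k s ^+ 2.
have dH s : 0 <= s <= T -> is_derive s 1 (kin + (P \o srho)) 0.
  move=> s0T.
  have dk : is_derive s 1 kin (\sum_(0 <= k < N) 2 * h k s * (- (c s * lam k ^+ 2 * r k s))).
    apply: is_derive1_sum => k; have [_ _ _ dh] := ref_modes ref k.
    have H : is_derive s 1 (h k ^+ 2) ((2%:R * h k s ^+ 1) *: (- (c s * lam k ^+ 2 * r k s))).
      by have := dh s s0T => ?; exact: is_deriveX.
    by apply: (is_derive_eq H); rewrite expr1.
  have dr : is_derive s 1 srho (\sum_(0 <= k < N) 2 * lam k ^+ 2 * (r k s * h k s)).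
    apply: is_derive1_sum => k; apply: is_derive1_sqrM.
    exact: (mode_derive (ref_modes ref k)).
  have dPs : is_derive (srho s) 1 P (mh (srho s)) by apply: dP; rewrite srho0 rhoX.
  apply: (is_derive_eq (is_deriveD dk (is_derive1_comp dPs dr))).
  rewrite /c /coef clamp_id// (ref_rho ref)// -/(srho s) mulr_sumr -big_split/=.
  by rewrite big1// => k _; ring.
have /andP[t0 tT] := t0T.
have cons : kin t + P (srho t) = kin 0 + P (srho 0).
  have [y _] : exists2 y, 0 <= y <= t &
      (kin + (P \o srho)) t - (kin + (P \o srho)) 0 = 0 * (t - 0).
    apply: (@mean_value _ _ (fun=> 0)) => // s /andP[s0 st].
    by apply: dH; rewrite s0 (le_trans st).
  by rewrite mul0r => /eqP; rewrite subr_eq0 => /eqP.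
have kin0 : kin 0 <= Q0.
  rewrite (le_trans _ qQ)// le_eqVlt; apply/orP; left; apply/eqP; apply: eq_bigr => k _.
  by rewrite (mode_init' (ref_modes ref k)).
have Pt := Pge (srho t); rewrite srho0 rhoX// in Pt; have {}Pt := Pt isT.
have kt0 : 0 <= kin t by rewrite sumr_ge0// => k _; rewrite sqr_ge0.
have rt : srho t <= (Q0 + MS * S0) / nu by rewrite ler_pdivlMr//; lra.
split; first by rewrite (ref_rho ref).
have kt : kin t <= Q0 + MS * S0 by have := mulr_ge0 (ltW nu0) (srho0 t); lra.
have -> : moment (fun=> 1) t = kin t + c t * srho t.
  rewrite /moment /kin /srho mulr_sumr -big_split/=.
  by apply: eq_bigr => k _; rewrite mul1r /b /energy mulrA.
by rewrite mulrDr mulr1 lerD// [leRHS]mulrCA; apply: ler_pM.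
Qed.

(** Frequencies up to [Lm] cost [wm] times the total energy; above [Lm] the weight [w] is at most
    [om / expR y], so the remaining sum is at most 1. *)
Lemma moment_split (w om : nat -> R) s H0 (Lm wm y : R) : (forall k, 0 <= om k) ->
  moment (fun=> 1) s <= H0 -> 0 <= wm ->
  (forall k, lam k <= Lm -> w k <= wm) ->
  (forall k, Lm < lam k -> w k * expR y <= om k) ->
  moment om s <= expR y -> moment w s <= wm * H0 + 1.
Proof.
move=> om0 mH wm0 wlow whigh mom.
have ey : 0 < expR y by exact: expR_gt0.
apply: (@le_trans _ _ (wm * moment (fun=> 1) s + moment om s / expR y)); last first.
  by rewrite lerD ?ler_wpM2l// ler_pdivrMr// mul1r.
move: mom mH => _ _; rewrite /moment mulr_sumr mulr_suml -big_split/=.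
apply: ler_sum => k _; rewrite mul1r.
have h1 : 0 <= wm * b k s by rewrite mulr_ge0.
have h2 : 0 <= om k * b k s / expR y by rewrite divr_ge0 ?mulr_ge0// ltW.
have [kL|Lk] := leP (lam k) Lm.
  by have := ler_wpM2r (b0 k s) (wlow k kL); lra.
have : w k * b k s <= om k * b k s / expR y.
  by rewrite ler_pdivlMr// mulrAC ler_wpM2r// whigh.
by lra.
Qed.

(* [y] dominates the logarithm of the weighted energy [1 + moment om], whose
   growth rate is the lower order moment [moment lam]; splitting the frequencies
   at [Lm (y s)] bounds that moment in terms of [y] itself. *)
Lemma reference_gevrey (om : nat -> R) H0 (Lm : R -> R) (y y' : R -> R) :
  (forall k, 0 <= om k) ->
  (forall t, 0 <= t <= T -> moment (fun=> 1) t <= H0) -> 0 <= H0 ->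
  (forall t, 0 <= t <= T -> is_derive t 1 y (y' t)) ->
  (forall t, 0 <= t <= T -> 0 <= Lm (y t)) ->
  (forall t, 0 <= t <= T -> L / nu ^+ 2 * (Lm (y t) * H0 + 1) < y' t) ->
  (forall k t, 0 <= t <= T -> Lm (y t) < lam k ->
    (lam k + lam k ^+ 3) * expR (y t) <= om k) ->
  1 + moment om 0 <= expR (y 0) ->
  forall t, 0 <= t <= T -> moment lam t <= Lm (y t) * H0 + 1 /\
    moment (fun k => lam k ^+ 3) t <= Lm (y t) ^+ 3 * H0 + 1.
Proof.
move=> om0 mH H00 dy Lm0 y'gt omge init.
have om_le k t : 0 <= t <= T -> Lm (y t) < lam k ->
    lam k * expR (y t) <= om k /\ lam k ^+ 3 * expR (y t) <= om k.
  move=> t0T /(omge _ _ t0T); rewrite mulrDl.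
  have := mulr_ge0 (lam0 k) (expR_ge0 (y t)).
  have := mulr_ge0 (exprn_ge0 3 (lam0 k)) (expR_ge0 (y t)).
  by move=> h1 h2 h3; split; lra.
have Fle t : 0 <= t <= T -> 1 + moment om t <= expR (y t).
  apply: (@barrier _ (fun t => 1 + moment om t) (expR \o y)
    (fun t => expR (y t) * y' t)) => //.
  - by move=> s s0T; apply: cvgD; [exact: cvg_cst|exact: moment_continuous].
  - by move=> s s0T; have := dy s s0T => ?; exact: is_derive1_comp.
  (* At a contact point the energy equals [expR (y s)], which is what the splitting requires. The
     summand 1 in the energy keeps the inequality strict even if [moment om s] vanishes. *)
  move=> s s0T' Fs; have s0T : 0 <= s <= T by case/andP: s0T' => -> /ltW.
  exists (0 + L / nu ^+ 2 * moment lam s * moment om s).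
    by apply: dini_leD; [exact: dini_le_cst|exact: reference_moment_dini].
  rewrite /= in Fs *; rewrite add0r -Fs.
  have mo0 : 0 <= moment om s by exact: moment_ge0.
  have ml0 : 0 <= moment lam s by exact: moment_ge0.
  have C0 : 0 <= L / nu ^+ 2 by rewrite divr_ge0 ?sqr_ge0// ltW.
  have mlam : moment lam s <= Lm (y s) * H0 + 1.
    apply: (@moment_split lam om s H0 (Lm (y s)) (Lm (y s)) (y s)) => //.
    - exact: mH.
    - exact: Lm0.
    - by move=> k /(om_le _ _ s0T)[].
    - by rewrite -Fs lerDr.
  have y's : L / nu ^+ 2 * moment lam s < y' s.
    by rewrite (le_lt_trans _ (y'gt s s0T))// ler_wpM2l.
  have := ler_wpM2r mo0 (ltW y's); have := mulr_ge0 C0 ml0; lra.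
move=> t t0T; have mom : moment om t <= expR (y t).
  by rewrite (le_trans _ (Fle t t0T))// lerDr.
split.
  apply: (@moment_split lam om t H0 (Lm (y t)) _ (y t)) => //.
  - exact: mH.
  - exact: Lm0.
  - by move=> k /(om_le _ _ t0T)[].
apply: (@moment_split _ om t H0 (Lm (y t)) _ (y t)) => //.
- exact: mH.
- by rewrite exprn_ge0// Lm0.
- by move=> k lk; rewrite lerXn2r ?nnegrE// Lm0.
- by move=> k /(om_le _ _ t0T)[].
Qed.

Lemma moment_init (w : nat -> R) : (forall k, 0 <= w k) ->
  moment w 0 <= M * \sum_(0 <= k < N) w k * data_energy lam p q k.
Proof.
move=> w0; rewrite mulr_sumr; apply: ler_sum => k _.
rewrite [leRHS]mulrCA ler_wpM2l// /b /energy.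
rewrite (mode_init (ref_modes ref k)) (mode_init' (ref_modes ref k)).
rewrite /data_energy mulrDr lerD// ?ler_peMl ?sqr_ge0// -mulrA ler_wpM2r//.
by rewrite mulr_ge0 ?sqr_ge0.
Qed.

End ReferenceBounds.

(** * Perturbation of a reference solution *)

Section Perturbation.
Context {R : realType}.

Lemma young_weighted (th x y : R) : 0 < th -> `|2 * x * y| <= x ^+ 2 / th + th * y ^+ 2.
Proof.
move=> th0; have E (z : R) : x ^+ 2 / th + th * z ^+ 2 - 2 * x * z = (x - th * z) ^+ 2 / th.
  by field; rewrite gt_eqF.
have P z : 0 <= x ^+ 2 / th + th * z ^+ 2 - 2 * x * z.
  by rewrite E divr_ge0 ?sqr_ge0// ltW.
by rewrite ler_norml; have := P y; have := P (- y); rewrite sqrrN; lra.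
Qed.

(** Here [a] and [w] stand for [lam (f - r)] and [g - h], and [rr], [h] for [lam r] and its
    velocity. Difference energies will be of order [th^2] and reference energies of order 1, so
    Young's inequality with weight [th] makes every cross term of order [th]. *)
Lemma mode_increment_bound (nu th a w h rr e b : R) :
  0 < nu -> nu <= 1 -> 0 < th -> th <= 1 ->
  nu * a ^+ 2 <= e -> w ^+ 2 <= e -> h ^+ 2 <= b -> nu * rr ^+ 2 <= b ->
  `|2 * a * w + 2 * a * h + 2 * rr * w| <= 4 * (e / (nu * th)) + 2 * (th * b / nu).
Proof.
move=> nu0 nu1 th0 th1 ae we hb rb.
set Y := e / (nu * th); set Z := th * b / nu.
have e0 : 0 <= e by rewrite (le_trans _ we)// sqr_ge0.
have b0 : 0 <= b by rewrite (le_trans _ hb)// sqr_ge0.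
have Y0 : 0 <= Y by rewrite divr_ge0// mulr_ge0// ltW.
have Z0 : 0 <= Z by rewrite divr_ge0 ?mulr_ge0// ltW.
have eY : e = nu * th * Y by rewrite /Y [RHS]mulrC divfK// mulf_neq0// gt_eqF.
have bZ : th * b = nu * Z by rewrite /Z [RHS]mulrC divfK// gt_eqF.
have aY : a ^+ 2 <= th * Y.
  by rewrite -(ler_pM2l nu0) [leRHS]mulrA -eY.
have wY : w ^+ 2 <= th * Y.
  by rewrite (le_trans we)// eY -mulrA ler_piMl// mulr_ge0// ltW.
have hZ : th * h ^+ 2 <= Z.
  by rewrite (le_trans (ler_wpM2l (ltW th0) hb))// bZ ler_piMl.
have rZ : th * rr ^+ 2 <= Z.
  by rewrite -(ler_pM2l nu0) [leLHS]mulrCA -bZ ler_wpM2l// ltW.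
have thY : th * Y <= Y by rewrite ler_piMl.
have a1 : `|2 * a * w| <= a ^+ 2 / 1 + 1 * w ^+ 2 by exact: young_weighted.
have a2 := young_weighted a h th0.
have a3 := young_weighted w rr th0.
have aY' : a ^+ 2 / th <= Y by rewrite ler_pdivrMr// mulrC.
have wY' : w ^+ 2 / th <= Y by rewrite ler_pdivrMr// mulrC.
have a3' : `|2 * rr * w| <= w ^+ 2 / th + th * rr ^+ 2.
  by rewrite (_ : 2 * rr * w = 2 * w * rr)//; ring.
rewrite (le_trans (ler_normD _ _))//.
have := ler_normD (2 * a * w) (2 * a * h).
by rewrite divr1 mul1r in a1; lra.
Qed.

Lemma finite_sum_le (u : nat -> R) N n : (forall k, 0 <= u k) ->
  (forall k, (N <= k)%N -> u k = 0) ->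
  \sum_(0 <= k < n) u k <= \sum_(0 <= k < N) u k.
Proof. by move=> u0 /finite_series_cvg; exact: series_le_lim. Qed.

Lemma increment_of_derive (f f' g g' : R -> R) (T : R) :
  (forall t, 0 <= t <= T -> is_derive t 1 f (f' t)) ->
  (forall t, 0 <= t <= T -> is_derive t 1 g (g' t)) ->
  (forall t, 0 <= t <= T -> `|f' t| <= g' t) ->
  forall s t, 0 <= s -> s <= t -> t <= T -> `|f t - f s| <= g t - g s.
Proof.
move=> df dg fg s t s0 st tT.
have sub x : s <= x <= t -> 0 <= x <= T.
  by move=> /andP[sx xt]; rewrite (le_trans s0)//= (le_trans xt).
have h1 : (g - f) s <= (g - f) t.
  apply: (@mono_of_derive _ _ (g' - f')) => // x /sub x0T.
    exact: (is_deriveB (dg _ x0T) (df _ x0T)).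
  by have := fg _ x0T; rewrite ler_norml => /andP[_]; rewrite -subr_ge0.
have h2 : (g + f) s <= (g + f) t.
  apply: (@mono_of_derive _ _ (g' + f')) => // x /sub x0T.
    exact: (is_deriveD (dg _ x0T) (df _ x0T)).
  by have := fg _ x0T; rewrite ler_norml => /andP[+ _]; rewrite lerNl -subr_ge0 opprK.
by move: h1 h2; rewrite !fctE ler_norml => h1 h2; apply/andP; split; lra.
Qed.

Variables (mh : R -> R) (nu M L : R) (hm : coef_bounds mh nu M L).
Variables (lam : nat -> R) (lam0 : forall k, 0 <= lam k).

Let nu0 : 0 < nu := coef_nu_gt0 hm.
Let nu1 : nu <= 1 := coef_nu_le1 hm.
Let M1 : 1 <= M := coef_M_ge1 hm.
Let M0 : 0 < M. Proof. exact: lt_le_trans ltr01 M1. Qed.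
Let L0 : 0 < L. Proof. exact: lt_le_trans ltr01 (coef_L_ge1 hm). Qed.

Variables (N : nat) (T : R) (p q : nat -> R) (rho : R -> R) (r h : nat -> R -> R).
Hypotheses (T0 : 0 <= T) (ref : reference mh lam N T p q rho r h).
Variable Q : R.
Hypothesis Q1 : 1 <= Q.
Hypothesis momQ : forall t, 0 <= t <= T -> moment mh lam N T rho r h lam t <= Q.
Hypothesis mom3Q : forall t, 0 <= t <= T ->
  moment mh lam N T rho r h (fun k => lam k ^+ 3) t <= Q.
Variables (p' q' : nat -> R) (kap eps B sig0 E : R).
Hypotheses (kap1 : 1 <= kap) (eps0 : 0 < eps) (B1 : 1 <= B).
Hypothesis BK : 2 * (L * (Q / nu + 1) / nu) <= B.
Hypothesis BB : 2 * L ^+ 2 * kap ^+ 2 * Q / nu <= B ^+ 2.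
Hypothesis BQ : (20 * M + 2 * Q) / nu <= B.
Hypothesis smallT : kap * B * eps * expR (B * T) <= 1.
Hypothesis dist_data : forall n, \sum_(0 <= k < n)
  lam k * data_energy lam (fun k => p' k - p k) (fun k => q' k - q k) k <= 4 * eps ^+ 2.
Hypothesis bE : forall n, \sum_(0 <= k < n) (1 + lam k) * data_energy lam p' q' k <= E.
Hypothesis sig0E : series (fun k => lam k ^+ 2 * p' k ^+ 2) @ \oo --> sig0.
Hypothesis sig0rho : `|sig0 - rho 0| <= kap * eps.

Let B0 : 0 < B. Proof. exact: lt_le_trans ltr01 B1. Qed.
Let kap0 : 0 < kap. Proof. exact: lt_le_trans ltr01 kap1. Qed.
Let Q0 : 0 < Q. Proof. exact: lt_le_trans ltr01 Q1. Qed.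
Let ex0 t : 0 < expR t :> R. Proof. exact: expR_gt0. Qed.

(** Increments of [sig - rho] are compared with those of [kap eps e^{B t}]. This controls at once
    the distance to [rho] and the Lipschitz constant of [sig], hence the growth rate of the
    energies. *)
Let X : set (R -> R) := [set sig | sig 0 = sig0 /\
  forall s t, 0 <= s -> s <= t -> t <= T ->
  `|(sig t - rho t) - (sig s - rho s)| <= kap * eps * (expR (B * t) - expR (B * s))].

Let theta_le t : 0 <= t <= T -> kap * B * (eps * expR (B * t)) <= 1.
Proof.
move=> /andP[t0 tT]; apply: le_trans smallT; rewrite mulrA ler_wpM2l//.
  by rewrite !mulr_ge0// ltW.
by rewrite ler_expR ler_wpM2l// ltW.
Qed.

Let theta1 t : 0 <= t <= T -> eps * expR (B * t) <= 1.
Proof.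
move=> t0T; apply: le_trans (theta_le t0T); rewrite ler_peMl//.
  by rewrite mulr_ge0// ltW.
by rewrite mulr_ege1.
Qed.

Let X_dist sig t : X sig -> 0 <= t <= T ->
  `|sig t - rho t| <= kap * (eps * expR (B * t)).
Proof.
move=> [s0E H] /andP[t0 tT]; have := H 0 t (lexx _) t0 tT.
rewrite mulr0 expR0 s0E mulrBr mulr1 => h1.
rewrite -(subrK (sig0 - rho 0) (sig t - rho t)) (le_trans (ler_normD _ _))//.
by rewrite mulrA; have := sig0rho; lra.
Qed.

Let rho_lip : lipschitz_upto T (Q / nu) rho.
Proof.
apply: (reference_rho_lipschitz hm lam0 ref) => t t0T.
by rewrite ler_wpM2r ?invr_ge0 ?(ltW nu0)// momQ.
Qed.

Let K := Q / nu + 1.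
Let K0 : 0 <= K. Proof. by rewrite addr_ge0// divr_ge0// ltW. Qed.

(** The comparison function has slope [kap * B * eps * expR (B * t)], at most 1 by [smallT]: this is
    the summand 1 in [K]. *)
Let X_lip sig : X sig -> lipschitz_upto T K sig.
Proof.
move=> [_ H] s t; wlog st : s t / s <= t.
  move=> W s0T t0T; have [st|/ltW ts] := leP s t; first exact: W.
  by rewrite distrC [`|t - s|]distrC; exact: W.
move=> /[dup] s0T /andP[s0 sT] /[dup] t0T /andP[t0 tT].
have h1 := H s t s0 st tT; have h2 := rho_lip s0T t0T.
rewrite (_ : sig t - sig s = (sig t - rho t - (sig s - rho s)) + (rho t - rho s));
  last by ring.
rewrite (le_trans (ler_normD _ _))// /K mulrDl mul1r addrC lerD//.
rewrite (le_trans h1)//.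
have [x /andP[sx xt] ->] : exists2 x, s <= x <= t &
    expR (B * t) - expR (B * s) = B * expR (B * x) * (t - s).
  have [x xst] := @mean_value _ (fun s => 1 * expR (B * s)) (fun x => 1 * B * expR (B * x))
    s t st (fun x _ => is_derive_expR_scale 1 B x).
  by rewrite !mul1r; exists x.
rewrite [`|t - s|]ger0_norm ?subr_ge0// mulrA ler_piMl ?subr_ge0//.
have := @theta_le x; rewrite (le_trans s0)//= (le_trans xt)// => /(_ isT).
by apply: le_trans; rewrite le_eqVlt; apply/orP; left; apply/eqP; ring.
Qed.

Section Invariance.
Variables (sig tau : R -> R) (f g : nat -> R -> R).
Hypotheses (Xs : X sig) (fg : modes mh lam T sig p' q' f g).
Hypothesis tauE : forall t, 0 <= t <= T ->
  series (fun k => lam k ^+ 2 * f k t ^+ 2) @ \oo --> tau t.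

Let c := coef mh T sig.
Let d := coef mh T rho.
Let e k := energy c (lam k) (f k - r k) (g k - h k).
Let b k := energy d (lam k) (r k) (h k).
Let c_ge s : nu <= c s. Proof. exact: (coef_ge hm). Qed.
Let d_ge s : nu <= d s. Proof. exact: (coef_ge hm). Qed.
Let c_ge0 s : 0 <= c s. Proof. exact: le_trans (ltW nu0) _. Qed.
Let d_ge0 s : 0 <= d s. Proof. exact: le_trans (ltW nu0) _. Qed.

Let sum_b (w : nat -> R) n t : (forall k, 0 <= w k) ->
  \sum_(0 <= k < n) w k * b k t <= moment mh lam N T rho r h w t.
Proof.
move=> w0; apply: finite_sum_le => [k|k Nk]; first by rewrite mulr_ge0// energy_ge0.
by rewrite /b /energy (ref_r0 ref Nk) (ref_h0 ref Nk) /cst expr0n/= !mulr0 addr0 mulr0.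
Qed.

Let G n t := \sum_(0 <= k < n) lam k * e k t.

Let G_init n : G n 0 <= M * (4 * eps ^+ 2).
Proof.
rewrite (le_trans _ (ler_wpM2l (ltW M0) (dist_data n)))// mulr_sumr.
apply: ler_sum => k _; rewrite [leRHS]mulrCA ler_wpM2l//.
rewrite /e /energy !fctE (mode_init (fg k)) (mode_init' (fg k)).
rewrite (mode_init (ref_modes ref k)) (mode_init' (ref_modes ref k)).
rewrite /data_energy mulrDr lerD// ?ler_peMl ?sqr_ge0// -mulrA ler_wpM2r//.
  by rewrite mulr_ge0 ?sqr_ge0.
exact: (coef_le hm).
Qed.

(** The source, weighted by [lam], contributes [lam^3] times the potential energy of the reference,
    which [mom3Q] bounds. [BK] leaves a gap [B / 2] between the rates and [BB] makes the source
    contribute at most [eps ^+ 2]; with the initial [4 * M * eps ^+ 2] this gives [5 * M]. *)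
Let G_bound n t : 0 <= t <= T -> G n t <= 5 * M * (eps * expR (B * t)) ^+ 2.
Proof.
move=> t0T; have LK0 : 0 <= L * K by rewrite mulr_ge0// ltW.
pose be := (L * (kap * eps)) ^+ 2 * (Q / nu) / B.
have be0 : 0 <= be.
  by rewrite divr_ge0 ?(ltW B0)// mulr_ge0 ?sqr_ge0// divr_ge0// ltW.
have BK' : L * K / nu <= B / 2 by have := BK; rewrite -/K; lra.
have LK0' : 0 <= L * K / nu by rewrite divr_ge0// ltW.
have := @gronwall R (G n) T (M * (4 * eps ^+ 2)) (L * K / nu + B) be (B + B).
move=> H; have {H} : G n t <= (M * (4 * eps ^+ 2) + be / (B + B - (L * K / nu + B)))
    * expR ((B + B) * t).
  apply: H => //.
  - move=> s s0T; rewrite /G; elim: n => [|n IH].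
      rewrite big_geq//; under eq_fun do rewrite big_geq//; exact: cvg_cst.
    rewrite big_nat_recr//=; under eq_fun do rewrite big_nat_recr//=.
    apply: cvgD => //; apply: cvgMr.
    have [_ _ df dg] := fg n; have [_ _ dr dh] := ref_modes ref n.
    apply: (energy_continuous _ _ _ s0T) => [|x x0T|x x0T].
    + exact: (coef_continuous hm T0 K0 (X_lip Xs)).
    + exact: (is_derive1_continuous (is_deriveB (df x x0T) (dr x x0T))).
    + exact: (is_derive1_continuous (is_deriveB (dg x x0T) (dh x x0T))).
  - by rewrite !mulr_ge0// ?sqr_ge0// ltW.
  - by rewrite ltrD2r; have := B0; lra.
  - move=> s /andP[s0 sT]; have s0T : 0 <= s <= T by rewrite s0 ltW.
    have de k : dini_le (fun t => lam k * e k t) s (lam k *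
        ((L * K / nu + B) * e k s + ((c s - d s) * lam k ^+ 2 * r k s) ^+ 2 / B)).
      apply: dini_leZ => //; apply: (energy_diff_dini nu0 (c_ge s) LK0 B0 s0T
        _ (fg k) (ref_modes ref k)) => x.
      exact: (coef_lipschitz hm T0 K0 (X_lip Xs)).
    apply: (dini_leW _ (dini_le_sum_nat n de)).
    rewrite (_ : \sum_(0 <= k < n) _ = (L * K / nu + B) * G n s +
      (c s - d s) ^+ 2 / B * \sum_(0 <= k < n) lam k ^+ 3 * (lam k ^+ 2 * r k s ^+ 2));
      last first.
      rewrite /G !mulr_sumr -big_split/=; apply: eq_bigr => k _; ring.
    rewrite lerD2l.
    have sumr5 : \sum_(0 <= k < n) lam k ^+ 3 * (lam k ^+ 2 * r k s ^+ 2) <= Q / nu.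
      rewrite ler_pdivlMr// (le_trans _ (mom3Q s0T))//.
      rewrite (le_trans _ (sum_b n s _)) => [//||k]; last by rewrite exprn_ge0.
      rewrite mulr_suml ler_sum// => k _; rewrite -mulrA ler_wpM2l ?exprn_ge0//.
      by rewrite mulrC; exact: energy_potential.
    have cd : (c s - d s) ^+ 2 <= (L * (kap * eps)) ^+ 2 * expR ((B + B) * s).
      rewrite [leRHS](_ : _ = (L * (kap * (eps * expR (B * s)))) ^+ 2); last first.
        by rewrite mulrDl expRD; ring.
      apply: sqr_le_norm; rewrite (le_trans (coef_lip hm _ _))// ler_wpM2l ?(ltW L0)//.
      by rewrite clamp_id//; exact: X_dist.
    rewrite [leRHS](_ : _ = (L * (kap * eps)) ^+ 2 * expR ((B + B) * s) / B * (Q / nu));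
      last first.
      by rewrite /be; ring.
    apply: ler_pM => //.
    + by rewrite divr_ge0 ?sqr_ge0// ltW.
    + by rewrite sumr_ge0// => k _; rewrite mulr_ge0 ?exprn_ge0// mulr_ge0 ?sqr_ge0.
    + by rewrite ler_wpM2r// invr_ge0 ltW.
move=> /le_trans; apply.
rewrite [leRHS](_ : _ = 5 * M * eps ^+ 2 * expR ((B + B) * t)); last first.
  by rewrite [(B + B) * t]mulrDl expRD; ring.
rewrite ler_wpM2r ?(ltW (ex0 _))//.
have B2 : 0 < B / 2 by rewrite divr_gt0.
have : be / (B + B - (L * K / nu + B)) <= eps ^+ 2.
  apply: (@le_trans _ _ (be / (B / 2))).
    rewrite ler_wpM2l// lef_pV2 ?posrE//; first by lra.
    by rewrite (lt_le_trans B2)//; lra.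
  rewrite ler_pdivrMr// /be ler_pdivrMr//.
  rewrite [leLHS](_ : _ = eps ^+ 2 / 2 * (2 * L ^+ 2 * kap ^+ 2 * Q / nu)); last first.
    by field; rewrite gt_eqF.
  rewrite [leRHS](_ : _ = eps ^+ 2 / 2 * B ^+ 2); last by field.
  by rewrite ler_wpM2l// divr_ge0 ?sqr_ge0.
have : eps ^+ 2 <= M * eps ^+ 2 by rewrite ler_peMl ?sqr_ge0.
by lra.
Qed.

(** Termwise differentiation and [mode_increment_bound] with weight [th = eps e^{B t}]. [G_bound]
    yields [20 M / nu] and [momQ] yields [2 Q / nu], so [BQ] bounds the derivative by [B * th],
    below the slope [kap * B * th] allowed in [X]. *)
Let partial_increment n s t : 0 <= s -> s <= t -> t <= T ->
  `|\sum_(0 <= k < n) (lam k ^+ 2 * f k t ^+ 2 - lam k ^+ 2 * r k t ^+ 2) -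
    \sum_(0 <= k < n) (lam k ^+ 2 * f k s ^+ 2 - lam k ^+ 2 * r k s ^+ 2)| <=
  kap * eps * (expR (B * t) - expR (B * s)).
Proof.
rewrite mulrBr; apply: (increment_of_derive
  (f := fun t => \sum_(0 <= k < n) (lam k ^+ 2 * f k t ^+ 2 - lam k ^+ 2 * r k t ^+ 2))
  (f' := fun t => \sum_(0 <= k < n) (2 * lam k ^+ 2 * (f k t * g k t) -
                                     2 * lam k ^+ 2 * (r k t * h k t)))
  (g := fun t => kap * eps * expR (B * t))
  (g' := fun t => kap * eps * B * expR (B * t))) => {s t} t t0T.
- apply: is_derive1_sum => k.
  have d1 := is_derive1_sqrM (lam k) (mode_derive (fg k) t0T).
  have d2 := is_derive1_sqrM (lam k) (mode_derive (ref_modes ref k) t0T).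
  exact: (is_deriveB d1 d2).
- exact: is_derive_expR_scale.
set th := eps * expR (B * t).
have th0 : 0 < th by rewrite mulr_gt0.
have th1 : th <= 1 by exact: theta1.
rewrite (le_trans (ler_norm_sum _ _ _))//.
apply: (@le_trans _ _ (\sum_(0 <= k < n)
    lam k * (4 * (e k t / (nu * th)) + 2 * (th * b k t / nu)))).
  apply: ler_sum => k _.
  rewrite (_ : 2 * _ * _ - _ = lam k * (2 * (lam k * (f k - r k) t) * (g k - h k) t +
    2 * (lam k * (f k - r k) t) * h k t + 2 * (lam k * r k t) * (g k - h k) t)); last first.
    by rewrite !fctE; ring.
  rewrite normrM ger0_norm// ler_wpM2l//.
  apply: mode_increment_bound => //.
  - by rewrite exprMn; exact: energy_potential.
  - exact: energy_kinetic.
  - exact: energy_kinetic.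
  - by rewrite exprMn; exact: energy_potential.
rewrite (_ : \sum_(0 <= k < n) _ = 4 / (nu * th) * G n t +
  2 * th / nu * \sum_(0 <= k < n) lam k * b k t); last first.
  by rewrite /G !mulr_sumr -big_split/=; apply: eq_bigr => k _; ring.
have h1 : 4 / (nu * th) * G n t <= 20 * M / nu * th.
  apply: (@le_trans _ _ (4 / (nu * th) * (5 * M * th ^+ 2))).
    rewrite ler_wpM2l ?G_bound// divr_ge0// mulr_ge0// ltW//.
  by rewrite le_eqVlt; apply/orP; left; apply/eqP; field; rewrite !gt_eqF.
have h2 : 2 * th / nu * \sum_(0 <= k < n) lam k * b k t <= 2 * Q / nu * th.
  rewrite [leRHS](_ : _ = 2 * th / nu * Q); last by ring.
  apply: ler_wpM2l; first by apply: divr_ge0; [apply: mulr_ge0|]; rewrite ?ltW.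
  by apply: (le_trans _ (momQ t0T)); exact: sum_b.
rewrite (le_trans (lerD h1 h2))//.
rewrite [leLHS](_ : _ = (20 * M + 2 * Q) / nu * th); last by ring.
rewrite [leRHS](_ : _ = kap * B * th); last by rewrite /th; ring.
by rewrite ler_wpM2r ?(ltW th0)// (le_trans BQ)// ler_peMl// ltW.
Qed.

Lemma perturbation_invariant : X tau.
Proof.
split.
  have z0T : 0 <= (0 : R) <= T by rewrite lexx.
  apply: (cvg_unique _ (tauE z0T)) => //.
  rewrite (_ : (fun k => lam k ^+ 2 * f k 0 ^+ 2) = (fun k => lam k ^+ 2 * p' k ^+ 2))//.
  by apply/funext => k; rewrite (mode_init (fg k)).
move=> s t s0 st tT.
have s0T : 0 <= s <= T by rewrite s0 (le_trans st).
have t0T : 0 <= t <= T by rewrite tT (le_trans s0).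
have lim x : 0 <= x <= T ->
    (fun n => \sum_(0 <= k < n) (lam k ^+ 2 * f k x ^+ 2 - lam k ^+ 2 * r k x ^+ 2))
    @ \oo --> tau x - rho x.
  move=> x0T; under eq_fun do rewrite sumrB.
  apply: cvgB; first exact: tauE.
  rewrite (ref_rho ref x0T); apply: finite_series_cvg => k Nk.
  by rewrite (ref_r0 ref Nk) /cst expr0n/= mulr0.
apply: (cvgn_le (N := 0%N) (cvg_norm (cvgB (lim t t0T) (lim s s0T)))) => n _.
exact: partial_increment.
Qed.

End Invariance.

(** The last clause will keep [sig] below the level where [mh] and [m] part. *)
Lemma perturbation : exists sig f g,
  [/\ lipschitz_upto T K sig, modes mh lam T sig p' q' f g,
    forall t, 0 <= t <= T ->
      series (fun k => lam k ^+ 2 * f k t ^+ 2) @ \oo --> sig t &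
    forall t, 0 <= t <= T -> `|sig t - rho t| <= 1].
Proof.
(* The iteration starts at a translate of [rho]: correct initial value, zero increments. *)
pose init t := rho t + (sig0 - rho 0).
have X0 : X init.
  split; first by rewrite /init addrC subrK.
  move=> s t s0 st tT.
  rewrite (_ : init t - _ - _ = 0); last by rewrite /init; ring.
  rewrite normr0 mulr_ge0 ?mulr_ge0 ?(ltW kap0) ?(ltW eps0)// subr_ge0 ler_expR.
  by rewrite ler_wpM2l// ltW.
have [|||sig [f [g [Xs fg sigE]]]] := @kirchhoff_fixpoint R mh nu M L hm lam lam0
    T K E p' q' X init T0 K0 bE X0.
- exact: X_lip.
- move=> u sig Xu usig; split.
    have z0T : 0 <= (0 : R) <= T by rewrite lexx.
    have := usig 0 z0T; rewrite (_ : u ^~ 0 = cst sig0); last first.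
      by apply/funext => n; have [] := Xu n.
    by move=> /(cvg_unique _ (cvg_cst sig0)) => ->.
  move=> s t s0 st tT.
  have s0T : 0 <= s <= T by rewrite s0 (le_trans st).
  have t0T : 0 <= t <= T by rewrite tT (le_trans s0).
  apply: (@cvgn_le _ (fun n => `|u n t - rho t - (u n s - rho s)|) _ _ 0%N).
    by apply: cvg_norm; apply: cvgB; apply: cvgB;
      [exact: usig|exact: cvg_cst|exact: usig|exact: cvg_cst].
  by move=> n _; have [_] := Xu n; exact.
- by move=> sig tau f g; exact: perturbation_invariant.
exists sig, f, g; split => //; first exact: X_lip.
move=> t t0T; rewrite (le_trans (X_dist Xs t0T))// (le_trans _ (theta_le t0T))//.
rewrite ler_wpM2r ?ler_peMr ?(ltW kap0)//.
by rewrite mulr_ge0// ltW.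
Qed.

End Perturbation.

(** * Series and graph norms in the Hilbert space *)

Section NonnegSeries.
Context {R : realType}.

Lemma nneseries_ltyP (u : nat -> R) : (forall k, 0 <= u k) ->
  (\sum_(0 <= k <oo) (u k)%:E < +oo)%E <->
  exists b, forall n, \sum_(0 <= k < n) u k <= b.
Proof.
move=> u0; have u0' k : xpredT k -> (0 <= (u k)%:E)%E by rewrite lee_fin.
split=> [uoo|[b ub]].
  exists (fine (\sum_(0 <= k <oo) (u k)%:E)%E) => n.
  have ufin : (\sum_(0 <= k <oo) (u k)%:E)%E \is a fin_num.
    by rewrite ge0_fin_numE// nneseries_ge0// => k _; exact: u0'.
  rewrite -lee_fin fineK// -sumEFin.
  by apply: nneseries_lim_ge => k _; exact: u0'.
apply: (@le_lt_trans _ _ b%:E); last exact: ltry.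
apply: lime_le; first by apply: is_cvg_nneseries => k _ _; exact: u0'.
by apply: nearW => n; rewrite sumEFin lee_fin.
Qed.

End NonnegSeries.

Section Hilbert.
Context {R : realType} {H : completeNormedModType R}.
Variables (dot : {dot H for idfun}) (e : nat -> H).
Hypotheses (dotN : inner_product_norm dot) (eB : orthonormal_basis dot e).

Let e1 : forall j k, dot (e j) (e k) = (j == k)%:R := eB.1.
Let e2 : forall z, series (fun k => dot z (e k) *: e k) @ \oo --> z := eB.2.

Let e11 k : dot (e k) (e k) = 1. Proof. by rewrite e1 eqxx. Qed.

Lemma dotBl x y z : dot (x - y) z = dot x z - dot y z.
Proof. exact: linearBl. Qed.

Lemma dotDl x y z : dot (x + y) z = dot x z + dot y z.
Proof. exact: linearDl. Qed.

Lemma dotZl a x z : dot (a *: x) z = a * dot x z.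
Proof. exact: linearZl_LR. Qed.

Lemma dotC x y : dot x y = dot y x.
Proof. by rewrite (hermC dot)/= expr0 mul1r. Qed.

Lemma dotZr a x z : dot x (a *: z) = a * dot x z.
Proof. by rewrite dotC dotZl dotC. Qed.

Lemma norm_sqrD x y : `|x + y| ^+ 2 = `|x| ^+ 2 + 2 * dot x y + `|y| ^+ 2.
Proof.
rewrite -!dotN dotDl (dotC x (x + y)) (dotC y (x + y)) !dotDl (dotC y x).
by ring.
Qed.

Lemma dot_sum_basis (a : nat -> R) j m n : dot (\sum_(m <= k < n) a k *: e k) (e j) =
  if (m <= j < n)%N then a j else 0.
Proof.
have [mn|nm] := leqP m n; last first.
  rewrite big_geq ?(ltnW nm)//; case: ifP => [/andP[mj jn]|_].
    by have := leq_ltn_trans mj jn; rewrite ltnNge (ltnW nm).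
  by rewrite -[0](subrr (0 : H)) dotBl subrr.
elim: n mn => [|n IH] mn.
  rewrite big_geq// ltn0 andbF.
  by rewrite -[0](subrr (0 : H)) dotBl subrr.
move: mn; rewrite leq_eqVlt => /predU1P[<-|mn].
  rewrite big_geq// -[0](subrr (0 : H)) dotBl subrr.
  by case: ifP => // /andP[mj jm]; have := leq_ltn_trans mj jm; rewrite ltnn.
rewrite big_nat_recr//= dotDl IH// dotZl ltnS.
have [<-|nj] := eqVneq n j; first by rewrite e11 ltnn andbF add0r mulr1 leqnn andbT -ltnS mn.
by rewrite e1 (negbTE nj) mulr0 addr0 (leq_eqVlt j n) (eq_sym j) (negbTE nj).
Qed.

Lemma norm_sum_basis (a : nat -> R) m n :
  `|\sum_(m <= k < n) a k *: e k| ^+ 2 = \sum_(m <= k < n) a k ^+ 2.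
Proof.
have [mn|nm] := leqP m n; last by rewrite !big_geq ?(ltnW nm)// normr0 expr0n.
elim: n mn => [|n IH] mn; first by rewrite !big_geq// normr0 expr0n.
move: mn; rewrite leq_eqVlt => /predU1P[<-|mn].
  by rewrite !big_geq// normr0 expr0n.
rewrite !big_nat_recr//= norm_sqrD IH// dotZr dot_sum_basis ltnn andbF.
 by rewrite -[`|_ *: _| ^+ 2]dotN dotZl dotZr e11; ring.
Qed.

Lemma dot_basis_le z k : `|dot z (e k)| <= `|z|.
Proof.
apply: norm_le_sqr => //.
have := sqr_ge0 `|z - dot z (e k) *: e k|.
rewrite norm_sqrD -scaleNr dotZr.
by rewrite -[`|_ *: _| ^+ 2]dotN dotZl dotZr e11; lra.
Qed.

Lemma riesz_fischer (a : nat -> R) b : (forall n, \sum_(0 <= k < n) a k ^+ 2 <= b) ->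
  let z := limn (series (fun k => a k *: e k)) in
  (forall k, dot z (e k) = a k) /\
  series (fun k => a k ^+ 2) @ \oo --> `|z| ^+ 2.
Proof.
move=> ab z.
have a0 k : 0 <= a k ^+ 2 by exact: sqr_ge0.
have ca := bounded_series_cvg a0 ab.
have cz : series (fun k => a k *: e k) @ \oo --> z.
  apply/cauchy_cvgP/cauchy_exP => eps eps0.
  have /cvgrPdist_lt/(_ _ (exprn_gt0 2 eps0))[n _ Hn] := ca.
  exists (series (fun k => a k *: e k) n), n => //= m /= nm.
  rewrite -ball_normE /= distrC /series/= [X in X - _](@big_cat_nat _ _ _ n)//=.
  rewrite addrAC subrr add0r.
  rewrite -(@ltr_pXn2r _ 2%N) ?nnegrE ?(ltW eps0)// norm_sum_basis.
  have := Hn n (leqnn n); have := series_le_lim m a0 ca.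
  rewrite [X in X <= _](@big_cat_nat _ _ _ n)//= => h1.
  by move=> /(le_lt_trans (ler_norm _)); rewrite /series/=; lra.
split=> [k|].
  apply: (@cvg_unique _ (@norm_hausdorff _ R)
    (fmap (fun n => dot (series (fun k => a k *: e k) n) (e k)) \oo)).
    apply/cvgrPdist_lt => eps eps0; have /cvgrPdist_lt/(_ _ eps0) := cz.
    by apply: filterS => n; rewrite -dotBl; apply: le_lt_trans; exact: dot_basis_le.
  apply/cvgrPdist_lt => eps eps0; exists k.+1 => //= n /= kn.
  by rewrite /series/= dot_sum_basis/= kn subrr normr0.
have cn : (fun n => `|series (fun k => a k *: e k) n|) @ \oo --> `|z|.
  exact: cvg_norm.
rewrite (_ : series (fun k => a k ^+ 2) =
    (fun n => `|series (fun k => a k *: e k) n| * `|series (fun k => a k *: e k) n|)).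
  by rewrite expr2; exact: cvgM.
by apply/funext => n; rewrite /series/= -norm_sum_basis expr2.
Qed.

Lemma parseval z : series (fun k => dot z (e k) ^+ 2) @ \oo --> `|z| ^+ 2.
Proof.
have cn : (fun n => `|series (fun k => dot z (e k) *: e k) n|) @ \oo --> `|z|.
  by apply: cvg_norm; exact: e2.
rewrite (_ : series (fun k => dot z (e k) ^+ 2) =
    (fun n => `|series (fun k => dot z (e k) *: e k) n| *
      `|series (fun k => dot z (e k) *: e k) n|)).
  by rewrite expr2; exact: cvgM.
by apply/funext => n; rewrite /series/= -norm_sum_basis expr2.
Qed.

Lemma basis_expansion z : z = limn (series (fun k => dot z (e k) *: e k)).
Proof. by apply/esym/cvg_lim; [exact: norm_hausdorff|exact: e2]. Qed.

Variable lam : nat -> R.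
Hypothesis lam0 : forall k, 0 <= lam k.

Lemma powR_dup (x a : R) : 0 <= x -> (x `^ (2 * a)) ^+ 2 = x `^ (4 * a).
Proof.
move=> x0; rewrite -powR_mulrn ?powR_ge0// -powRrM; congr (_ `^ _); ring.
Qed.

Lemma powR_34 x : 0 <= x -> x `^ (4 * (3 / 4)) = x ^+ 3 :> R.
Proof. by move=> x0; rewrite (_ : 4 * (3 / 4) = 3%:R) ?powR_mulrn//; field. Qed.

Lemma powR_14 x : 0 <= x -> x `^ (4 * (1 / 4)) = x :> R.
Proof. by move=> x0; rewrite (_ : 4 * (1 / 4) = 1) ?powRr1//; field. Qed.

Lemma powR_12 x : 0 <= x -> x `^ (4 * (1 / 2)) = x ^+ 2 :> R.
Proof. by move=> x0; rewrite (_ : 4 * (1 / 2) = 2%:R) ?powR_mulrn//; field. Qed.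

Lemma dom_powP a z : dom_pow dot e lam a z <->
  exists b, forall n, \sum_(0 <= k < n) lam k `^ (4 * a) * dot z (e k) ^+ 2 <= b.
Proof. by apply: nneseries_ltyP => k; rewrite mulr_ge0 ?powR_ge0 ?sqr_ge0. Qed.

Lemma gevreyP phi a z : gevrey dot e lam phi a z <->
  exists b, forall n, \sum_(0 <= k < n)
    lam k `^ (4 * a) * expR (phi (lam k)) * dot z (e k) ^+ 2 <= b.
Proof.
apply: nneseries_ltyP => k; rewrite mulr_ge0 ?sqr_ge0//.
by rewrite mulr_ge0 ?powR_ge0 ?expR_ge0.
Qed.

Lemma pow_op_norm a z : dom_pow dot e lam a z ->
  series (fun k => lam k `^ (4 * a) * dot z (e k) ^+ 2) @ \oo -->
  `|pow_op dot e lam a z| ^+ 2.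
Proof.
move=> /dom_powP[b bz].
have E : (fun k => lam k `^ (4 * a) * dot z (e k) ^+ 2) =
    (fun k => (lam k `^ (2 * a) * dot z (e k)) ^+ 2).
  by apply/funext => k; rewrite exprMn powR_dup.
rewrite E; have [|_] := @riesz_fischer (fun k => lam k `^ (2 * a) * dot z (e k)) b => //.
by move=> n; have := bz n; move: E => /(congr1 (fun v => \sum_(0 <= k < n) v k)) ->.
Qed.

Lemma pow_op_norm_ge a z n : dom_pow dot e lam a z ->
  \sum_(0 <= k < n) lam k `^ (4 * a) * dot z (e k) ^+ 2 <= `|pow_op dot e lam a z| ^+ 2.
Proof.
move=> /pow_op_norm; apply: series_le_lim => k.
by rewrite mulr_ge0 ?powR_ge0 ?sqr_ge0.
Qed.

Lemma dom_powB a x y : dom_pow dot e lam a x -> dom_pow dot e lam a y ->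
  dom_pow dot e lam a (x - y).
Proof.
move=> /dom_powP[b bx] /dom_powP[c cy]; apply/dom_powP.
exists (2 * b + 2 * c) => n.
apply: (le_trans _ (lerD (ler_wpM2l (ler0n _ 2) (bx n)) (ler_wpM2l (ler0n _ 2) (cy n)))).
rewrite !mulr_sumr -big_split/=; apply: ler_sum => k _; rewrite dotBl.
rewrite !(mulrCA 2) -mulrDr ler_wpM2l ?powR_ge0//.
by have := sqr_ge0 (dot x (e k) + dot y (e k)); lra.
Qed.

Lemma dom_pow_half z : dom_pow dot e lam (3 / 4) z -> dom_pow dot e lam (1 / 2) z.
Proof.
move=> /dom_powP[b bz]; apply/dom_powP; exists (`|z| ^+ 2 + b) => n.
have z0 k : 0 <= dot z (e k) ^+ 2 by exact: sqr_ge0.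
have nz : \sum_(0 <= k < n) dot z (e k) ^+ 2 <= `|z| ^+ 2.
  by apply: series_le_lim => //; exact: parseval.
apply: le_trans (lerD nz (bz n)).
rewrite -big_split/=; apply: ler_sum => k _.
rewrite powR_34// powR_12// -[X in _ <= X + _]mul1r -mulrDl ler_wpM2r//.
have := lam0 k; move: (lam k) => l l0.
have [l1|/ltW l1] := leP 1 l.
  have : l ^+ 2 <= l ^+ 3 by rewrite [leRHS]exprS ler_peMl ?sqr_ge0.
  by lra.
have : l ^+ 2 <= 1 by rewrite expr_le1.
by have := exprn_ge0 3 l0; lra.
Qed.

Lemma graph_norm_le a z b : 0 <= b ->
  (forall n, \sum_(0 <= k < n) (1 + lam k `^ (4 * a)) * dot z (e k) ^+ 2 <= b) ->
  graph_norm dot e lam a z <= Num.sqrt b.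
Proof.
move=> b0 bz; have dz : dom_pow dot e lam a z.
  apply/dom_powP; exists b => n; apply: le_trans (bz n); apply: ler_sum => k _.
  by rewrite ler_wpM2r ?sqr_ge0// lerDr.
have cv : (fun n => series (fun k => dot z (e k) ^+ 2) n +
    series (fun k => lam k `^ (4 * a) * dot z (e k) ^+ 2) n) @ \oo -->
    `|z| ^+ 2 + `|pow_op dot e lam a z| ^+ 2.
  by apply: cvgD; [exact: parseval|exact: pow_op_norm].
rewrite ler_wsqrtr//; apply: (cvgn_le (N := 0%N) cv).
move=> n _; apply: le_trans (bz n); rewrite /series/= -big_split/=.
by apply: ler_sum => k _; rewrite [leRHS]mulrDl mul1r lexx.
Qed.

(** Dominated convergence: finitely many coefficients converge, and the tail of the majorant [W],
    which does not depend on [s], bounds the rest. *)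
Lemma graph_norm_cvg0 (F : set_system R) {FF : Filter F} a (z : R -> H) (W : nat -> R) E :
  (forall k, 0 <= W k) -> (forall n, \sum_(0 <= k < n) W k <= E) ->
  (\forall s \near F, forall k, (1 + lam k `^ (4 * a)) * dot (z s) (e k) ^+ 2 <= W k) ->
  (forall k, dot (z s) (e k) @[s --> F] --> 0) ->
  graph_norm dot e lam a (z s) @[s --> F] --> 0.
Proof.
move=> W0 WE dom lim; apply/cvgrPdist_le => eps eps0.
have cW := bounded_series_cvg W0 WE.
set l := limn (series W) in cW.
have eps2 : 0 < eps ^+ 2 / 2 by rewrite divr_gt0// exprn_gt0.
have /cvgrPdist_le/(_ _ eps2)[n _ /(_ n (leqnn n)) Hn] := cW.
have fin i : \sum_(0 <= k < i) (1 + lam k `^ (4 * a)) * dot (z s) (e k) ^+ 2 @[s --> F] --> 0.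
  elim: i => [|i IH].
    under eq_fun do rewrite big_geq//; exact: cvg_cst.
  have ti : (1 + lam i `^ (4 * a)) * dot (z s) (e i) ^+ 2 @[s --> F] -->
      (1 + lam i `^ (4 * a)) * (0 * 0).
    by apply: cvgMr; under eq_fun do rewrite expr2; exact: cvgM.
  rewrite !mulr0 in ti; under eq_fun do rewrite big_nat_recr//=.
  by have := cvgD IH ti; rewrite addr0; apply.
near=> s.
have sdom : forall k, (1 + lam k `^ (4 * a)) * dot (z s) (e k) ^+ 2 <= W k.
  by near: s.
have sfin : \sum_(0 <= k < n) (1 + lam k `^ (4 * a)) * dot (z s) (e k) ^+ 2 <= eps ^+ 2 / 2.
  by near: s; exact: (cvgr_le _ (fin n)).
rewrite sub0r normrN ger0_norm ?sqrtr_ge0//.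
rewrite -[leRHS]ger0_norm ?(ltW eps0)// -sqrtr_sqr; apply: graph_norm_le.
  exact: sqr_ge0.
have t0 k : 0 <= (1 + lam k `^ (4 * a)) * dot (z s) (e k) ^+ 2.
  by rewrite mulr_ge0 ?sqr_ge0// addr_ge0// powR_ge0.
move=> m; apply: (@le_trans _ _ (\sum_(0 <= k < maxn n m)
    (1 + lam k `^ (4 * a)) * dot (z s) (e k) ^+ 2)).
  rewrite [leRHS](@big_cat_nat _ _ _ m) ?leq_maxr//= lerDl.
  by rewrite sumr_ge0.
rewrite (@big_cat_nat _ _ _ n) ?leq_maxl//=.
have : \sum_(n <= k < maxn n m) (1 + lam k `^ (4 * a)) * dot (z s) (e k) ^+ 2 <=
    \sum_(n <= k < maxn n m) W k by exact: ler_sum.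
have := series_le_lim (maxn n m) W0 cW.
rewrite [X in X <= _](@big_cat_nat _ _ _ n) ?leq_maxl//=.
have := le_trans (ler_norm _) Hn; rewrite /series/= -/l.
by lra.
Unshelve. all: by end_near. Qed.

End Hilbert.

(** * From a family of modes to a solution in the Hilbert space *)

Section Assembly.
Context {R : realType} {H : completeNormedModType R}.
Variables (dot : {dot H for idfun}) (e : nat -> H).
Hypotheses (dotN : inner_product_norm dot) (eB : orthonormal_basis dot e).
Variables (mh : R -> R) (nu M L : R) (hm : coef_bounds mh nu M L).
Variables (lam : nat -> R) (lam0 : forall k, 0 <= lam k).
Variables (m : R -> R) (u0 u1 : H) (T K E : R) (sig : R -> R) (f g : nat -> R -> R).

Let p k := dot u0 (e k).
Let q k := dot u1 (e k).
Let A := data_energy lam p q.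

Hypotheses (T0 : 0 < T) (K0 : 0 <= K) (lip : lipschitz_upto T K sig).
Hypothesis fg : modes mh lam T sig p q f g.
Hypothesis bE : forall n, \sum_(0 <= k < n) (1 + lam k) * A k <= E.
Hypothesis sigE : forall t, 0 <= t <= T ->
  series (fun k => lam k ^+ 2 * f k t ^+ 2) @ \oo --> sig t.
Hypothesis mhE : forall t, 0 <= t <= T -> mh (sig t) = m (sig t).

Let nu0 : 0 < nu := coef_nu_gt0 hm.
Let nu1 : nu <= 1 := coef_nu_le1 hm.
Let TW : 0 <= T := ltW T0.
Let C := growth nu M L T K / nu.
Let C0 : 0 <= C. Proof. by rewrite divr_ge0 ?(growth_ge0 hm)// ltW. Qed.
Let A0 k : 0 <= A k. Proof. exact: data_energy_ge0. Qed.
(** A multiple of [W] dominates every series below. The term [p k ^+ 2] is there because energies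
    say nothing about [f k] itself where [lam k] is small or zero. *)
Let W k := p k ^+ 2 + (1 + lam k) * A k.
Let lA0 k : 0 <= (1 + lam k) * A k. Proof. by rewrite mulr_ge0// addr_ge0. Qed.
Let W0 k : 0 <= W k. Proof. by rewrite addr_ge0 ?sqr_ge0. Qed.
Let C1 := 2 + 2 * T ^+ 2 * C + C.
Let TC0 : 0 <= T ^+ 2 * C. Proof. by rewrite mulr_ge0 ?sqr_ge0. Qed.
Let C10 : 0 <= C1. Proof. by have := TC0; have := C0; rewrite /C1; lra. Qed.

Let W_sum n : \sum_(0 <= k < n) W k <= `|u0| ^+ 2 + E.
Proof.
rewrite big_split/= lerD//.
by apply: series_le_lim; [move=> k; exact: sqr_ge0|exact: parseval].
Qed.

Let g_bound k t : 0 <= t <= T -> g k t ^+ 2 <= C * A k.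
Proof.
move=> t0T; have c0 : 0 <= coef mh T sig t.
  by rewrite (le_trans (ltW nu0))// (coef_ge hm).
rewrite (le_trans (energy_kinetic (lam k) (f k) (g k) c0))//.
rewrite (le_trans (modes_energy hm TW K0 lip fg k t0T))// ler_wpM2r//.
by rewrite ler_pdivlMr// ler_piMr// (growth_ge0 hm).
Qed.

Let lf_bound k t : 0 <= t <= T -> lam k ^+ 2 * f k t ^+ 2 <= C * A k.
Proof. by move=> t0T; exact: (modes_potential hm TW K0 lip fg). Qed.

(** By the mean value theorem a difference quotient is a velocity at an intermediate time, so it has
    the same majorant; this dominates the quotients in the derivative of [u] and recovers [f k] from
    [p k]. *)
Let quotient_bound k s t : 0 <= s <= T -> 0 <= t <= T ->
  ((s - t)^-1 * (f k s - f k t)) ^+ 2 <= C * A k.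
Proof.
wlog st : s t / t <= s.
  move=> Hw s0T t0T; have [ts|/ltW st] := leP t s; first exact: Hw.
  rewrite -(opprB t s) -(opprB (f k t)) invrN mulrNN; exact: Hw.
move=> /andP[s0 sT] /andP[t0 tT].
have [->|st'] := eqVneq s t; first by rewrite !subrr mulr0 expr0n mulr_ge0.
have [x /andP[x1 x2] ->] : exists2 x, t <= x <= s & f k s - f k t = g k x * (s - t).
  apply: mean_value => // x /andP[x1 x2]; apply: (mode_derive (fg k)).
  by rewrite (le_trans t0)//= (le_trans x2).
rewrite mulrCA mulVf ?subr_eq0// mulr1; apply: g_bound.
by rewrite (le_trans t0)//= (le_trans x2).
Qed.

Let f_bound k t : 0 <= t <= T -> f k t ^+ 2 <= 2 * p k ^+ 2 + 2 * T ^+ 2 * C * A k.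
Proof.
move=> /[dup] t0T /andP[t0 tT]; have z0T : 0 <= (0 : R) <= T by rewrite lexx.
have [t_eq0|tn0] := eqVneq t 0.
  rewrite t_eq0 (mode_init (fg k)) (le_trans (_ : _ <= 2 * p k ^+ 2))//.
    by rewrite ler_peMl ?sqr_ge0// ler1n.
  by rewrite lerDl; have := mulr_ge0 TC0 (A0 k); lra.
have := quotient_bound k t0T z0T; rewrite subr0 (mode_init (fg k)).
set x := _ * _ => xC.
have -> : f k t = t * x + p k by rewrite /x mulrA divff// mul1r subrK.
have h1 : (t * x) ^+ 2 <= T ^+ 2 * (C * A k).
  rewrite exprMn; apply: ler_pM; rewrite ?sqr_ge0//.
  by rewrite ler_sqr ?nnegrE.
by have := sqr_ge0 (t * x - p k); lra.
Qed.

Let f_dom k t : 0 <= t <= T -> (1 + lam k ^+ 3) * f k t ^+ 2 <= C1 * W k.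
Proof.
move=> t0T; have h1 := f_bound k t0T; have h2 := ler_wpM2l (lam0 k) (lf_bound k t0T).
have h3 := ler_wpM2r (A0 k) TC0; have h4 := ler_wpM2r (A0 k) C0.
have h5 := mulr_ge0 (lam0 k) (A0 k); rewrite !mul0r in h3 h4.
have h6 := mulr_ge0 TC0 h5; have h7 := mulr_ge0 C0 h5.
have h8 : 0 <= p k ^+ 2 by exact: sqr_ge0.
have h9 := mulr_ge0 TC0 h8; have h10 := mulr_ge0 C0 h8.
have -> : lam k ^+ 3 = lam k * lam k ^+ 2 by rewrite exprS.
rewrite /C1 /W; move: h1 h2 h3 h4 h5 h6 h7 h8 h9 h10; have := A0 k.
move: (f k t ^+ 2) (p k ^+ 2) (T ^+ 2) => X Y Z.
by move: (lam k) (A k) => l a; lra.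
Qed.

Let g_dom k t : 0 <= t <= T -> (1 + lam k) * g k t ^+ 2 <= C1 * W k.
Proof.
move=> t0T; have l1 : 0 <= 1 + lam k by rewrite addr_ge0.
rewrite (le_trans (ler_wpM2l l1 (g_bound k t0T)))// mulrCA.
rewrite (@le_trans _ _ (C1 * ((1 + lam k) * A k)))//.
  by rewrite ler_wpM2r// /C1; have := TC0; lra.
by rewrite ler_wpM2l// lerDr sqr_ge0.
Qed.

Let lam_cube k : 1 + lam k <= 2 * (1 + lam k ^+ 3).
Proof.
have := lam0 k; move: (lam k) => l l0; have l30 := exprn_ge0 3 l0.
have [l1|/ltW l1] := leP 1 l; last by lra.
have : l * 1 <= l * l ^+ 2 by rewrite ler_wpM2l// exprn_ege1.
by rewrite mulr1 -exprS; lra.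
Qed.

Let f_dom1 k t : 0 <= t <= T -> (1 + lam k) * f k t ^+ 2 <= 2 * C1 * W k.
Proof.
move=> t0T; rewrite (le_trans (ler_wpM2r (sqr_ge0 _) (lam_cube k)))//.
by rewrite -!mulrA ler_wpM2l// f_dom.
Qed.

Let u t := limn (series (fun k => f k t *: e k)).
Let u' t := limn (series (fun k => g k t *: e k)).

Let u_coef k t : 0 <= t <= T -> dot (u t) (e k) = f k t.
Proof.
move=> t0T; have [|+ _] := riesz_fischer dotN eB (a := fun k => f k t)
    (b := C1 * (`|u0| ^+ 2 + E)); last by apply.
move=> n; rewrite (le_trans _ (ler_wpM2l C10 (W_sum n)))// mulr_sumr.
apply: ler_sum => j _; rewrite (le_trans _ (f_dom j t0T))//.
by rewrite ler_peMl ?sqr_ge0// lerDl exprn_ge0.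
Qed.

Let u'_coef k t : 0 <= t <= T -> dot (u' t) (e k) = g k t.
Proof.
move=> t0T; have [|+ _] := riesz_fischer dotN eB (a := fun k => g k t)
    (b := C1 * (`|u0| ^+ 2 + E)); last by apply.
move=> n; rewrite (le_trans _ (ler_wpM2l C10 (W_sum n)))// mulr_sumr.
apply: ler_sum => j _; rewrite (le_trans _ (g_dom j t0T))//.
by rewrite ler_peMl ?sqr_ge0// lerDl.
Qed.

Let near_in (t : R) : \forall s \near within `[0, T] (nbhs t), 0 <= s <= T.
Proof. by near=> s; near: s; exact: near_withinT. Unshelve. all: by end_near. Qed.

Let near_in' (t : R) : \forall s \near within `[0, T] t^', 0 <= s <= T.
Proof. by near=> s; near: s; exact: near_withinT. Unshelve. all: by end_near. Qed.

Let cvg_near_eq (F : set_system R) {FF : Filter F} (a b : R -> R) (l : R) :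
  (\forall s \near F, a s = b s) -> b s @[s --> F] --> l -> a s @[s --> F] --> l.
Proof.
move=> ab; apply: cvg_trans; apply: near_eq_cvg.
by apply: filterS ab.
Qed.

Let sqr_diff (w x y b : R) : 0 <= w -> w * x ^+ 2 <= b -> w * y ^+ 2 <= b ->
  w * (x - y) ^+ 2 <= 4 * b.
Proof.
move=> w0 wx wy; have := mulr_ge0 w0 (sqr_ge0 (x + y)).
by rewrite sqrrD sqrrB; lra.
Qed.

Let C0_of_coef a (w : nat -> R) (v : R -> H) (fv : nat -> R -> R) D : 0 <= D ->
  (forall k, lam k `^ (4 * a) = w k) ->
  (forall k t, 0 <= t <= T -> dot (v t) (e k) = fv k t) ->
  (forall k t, 0 <= t <= T -> {for t, continuous (fv k)}) ->
  (forall k t, 0 <= t <= T -> (1 + w k) * fv k t ^+ 2 <= D * W k) ->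
  C0_dom_pow dot e lam `[0, T] a v.
Proof.
move=> D0 wE vE cfv dom.
have w0 k : 0 <= w k by rewrite -wE powR_ge0.
have WE n b : 0 <= b -> \sum_(0 <= k < n) b * W k <= b * (`|u0| ^+ 2 + E).
  by move=> b0; rewrite -mulr_sumr ler_wpM2l.
split=> t; rewrite /= in_itv/= => t0T.
  apply/(dom_powP dot e lam); exists (D * (`|u0| ^+ 2 + E)) => n.
  apply: le_trans (WE n D D0); apply: ler_sum => k _.
  rewrite wE vE// (le_trans _ (dom k t t0T))// ler_wpM2r ?sqr_ge0//.
  by rewrite lerDr.
apply: (graph_norm_cvg0 dotN eB lam0 (W := fun k => 4 * D * W k)
   (E := 4 * D * (`|u0| ^+ 2 + E))).
- by move=> k; rewrite !mulr_ge0.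
- by move=> n; apply: WE; rewrite mulr_ge0.
- apply: filterS (near_in t) => s s0T k.
  rewrite dotBl !vE// wE -mulrA; apply: sqr_diff; rewrite ?dom//.
  by rewrite addr_ge0.
- move=> k; apply: (cvg_near_eq (b := fun s => fv k s - fv k t)).
    by apply: filterS (near_in t) => s s0T; rewrite dotBl !vE.
  rewrite -(subrr (fv k t)); apply: cvgB; last exact: cvg_cst.
  by apply: cvg_within_filter; exact: cfv.
Qed.

Lemma kirchhoff_of_modes : exists u u' : R -> H,
  [/\ kirchhoff_solution dot e lam m T u u', u 0 = u0 & u' 0 = u1].
Proof.
have z0T : 0 <= (0 : R) <= T by rewrite lexx.
have df k t (t0T : 0 <= t <= T) := mode_derive (fg k) t0T.
have dg k t (t0T : 0 <= t <= T) := mode_derive' (fg k) t0T.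
have D2 : 0 <= 2 * C1 by rewrite mulr_ge0.
have cf k t : 0 <= t <= T -> {for t, continuous (f k)}.
  by move=> t0T; exact: is_derive1_continuous (df k t t0T).
have cg k t : 0 <= t <= T -> {for t, continuous (g k)}.
  by move=> t0T; exact: is_derive1_continuous (dg k t t0T).
(* This closes the loop: the nonlocal quantity of the assembled function is the [sig] that defined
   the coefficient. *)
have powE t : 0 <= t <= T -> `|pow_op dot e lam (1 / 2) (u t)| ^+ 2 = sig t.
  move=> t0T.
  have du : dom_pow dot e lam (3 / 4) (u t).
    have [dom _] : C0_dom_pow dot e lam `[0, T] (3 / 4) u.
      apply: (@C0_of_coef _ (fun k => lam k ^+ 3) u f C1) => //.
      by move=> k; rewrite powR_34.
    by apply: dom; rewrite /= in_itv.
  have := pow_op_norm dotN eB lam0 (dom_pow_half dotN eB lam0 du).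
  move=> H1; apply: (cvg_unique _ H1) => //.
  rewrite (_ : (fun k => _) = (fun k => lam k ^+ 2 * f k t ^+ 2)).
    exact: sigE.
  by apply/funext => k; rewrite powR_12// u_coef.
exists u, u'; split.
- split.
  + apply: (@C0_of_coef _ (fun k => lam k ^+ 3) u f C1) => //.
    by move=> k; rewrite powR_34.
  + split.
    * apply: (@C0_of_coef _ lam u f (2 * C1)) => //.
      by move=> k; rewrite powR_14.
    * apply: (@C0_of_coef _ lam u' g C1) => //.
      by move=> k; rewrite powR_14.
    * move=> t; rewrite /= in_itv/= => t0T.
      apply: (graph_norm_cvg0 dotN eB lam0 (W := fun k => 4 * C1 * W k)
        (E := 4 * C1 * (`|u0| ^+ 2 + E))).
      - by move=> k; rewrite !mulr_ge0.
      - by move=> n; rewrite -mulr_sumr ler_wpM2l// mulr_ge0.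
      - apply: filterS (near_in' t) => s s0T k.
        rewrite dotBl dotZl dotBl !u_coef// u'_coef// powR_14// -mulrA.
        apply: sqr_diff; rewrite ?g_dom//; first by rewrite addr_ge0.
        have l1 : 0 <= 1 + lam k by rewrite addr_ge0.
        rewrite (le_trans (ler_wpM2l l1 (quotient_bound k s0T t0T)))// mulrCA.
        rewrite (@le_trans _ _ (C1 * ((1 + lam k) * A k)))//.
          by rewrite ler_wpM2r// /C1; have := TC0; lra.
        by rewrite ler_wpM2l// lerDr sqr_ge0.
      - move=> k; apply: (cvg_near_eq
          (b := fun s => (s - t)^-1 * (f k s - f k t) - g k t)).
          apply: filterS (near_in' t) => s s0T.
          by rewrite dotBl dotZl dotBl !u_coef// u'_coef.
        rewrite -(subrr (g k t)); apply: cvgB; last exact: cvg_cst.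
        by apply: cvg_within_filter; exact: (is_derive1_quotient (df k t t0T)).
  + move=> k t; rewrite /= in_itv/= => t0T.
    set d := - (_ * _ * _).
    have dE : d = - (coef mh T sig t * lam k ^+ 2 * f k t).
      by rewrite /d powE// u_coef// /coef clamp_id// mhE.
    apply: (cvg_near_eq (b := fun s => `|(s - t)^-1 * (g k s - g k t) - d|)).
      by apply: filterS (near_in' t) => s s0T; rewrite !u'_coef.
    rewrite -(normr0 R) -(subrr d); apply: cvg_norm; apply: cvgB; last exact: cvg_cst.
    rewrite dE; apply: cvg_within_filter.
    exact: (is_derive1_quotient (dg k t t0T)).
- rewrite [RHS](basis_expansion eB); congr (limn (series _)).
  by apply/funext => k; rewrite (mode_init (fg k)).
- rewrite [RHS](basis_expansion eB); congr (limn (series _)).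
  by apply/funext => k; rewrite (mode_init' (fg k)).
Qed.

End Assembly.

(** * Lower bounds for the life span *)

Section Nonlinearity.
Context {R : realType}.
Implicit Types (m : R -> R) (x y a b K S nu : R).

Lemma real_derivative_expansion m m' x : real_derivative_on `[0, +oo[ m m' ->
  0 <= x -> forall eta, 0 < eta -> exists2 del, 0 < del & forall y, 0 <= y ->
  `|x - y| < del -> `|m y - m x - m' x * (y - x)| <= eta * `|y - x|.
Proof.
move=> dm x0 eta eta0.
have x0' : `[0, +oo[%classic x by rewrite /= in_itv/= x0.
have /cvgrPdist_le/(_ _ eta0)/nbhs_ballP[del /= del0 Hd] := dm x x0'.
exists del => // y y0 xy.
have [->|yx] := eqVneq y x; first by rewrite !subrr mulr0 subrr normr0 mulr0.
have := Hd y xy yx; rewrite /= in_itv/= y0 => /(_ isT).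
rewrite sub0r normrN normr_id /GRing.scale/= => h.
have yx0 : y - x != 0 by rewrite subr_eq0.
rewrite -[m y - m x](mulVKf yx0) [m' x * _]mulrC -mulrBr normrM mulrC.
by rewrite ler_wpM2r.
Qed.

(** At 0 the derivative of [m] is one-sided, so [m] is compared through [barrier] with a line whose
    slope [K + 1] strictly exceeds the bound on [m']. *)
Lemma C1_increment m m' S K a b : real_derivative_on `[0, +oo[ m m' ->
  (forall x, 0 <= x <= S -> m' x <= K) -> 0 <= a -> a <= b -> b <= S ->
  m b - m a <= (K + 1) * (b - a).
Proof.
move=> dm mK a0 ab bS.
have dY t : 0 <= t <= b - a ->
    is_derive t 1 (cst (m a) + (K + 1) \*: (@idfun R)) (K + 1).
  move=> _; have H : is_derive t 1 (cst (m a) + (K + 1) \*: (@idfun R))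
    (0 + (K + 1) *: 1) by apply: is_deriveD.
  by apply: (is_derive_eq H); rewrite add0r /GRing.scale/= mulr1.
have YE t : (cst (m a) + (K + 1) \*: (@idfun R)) t = m a + (K + 1) * t by [].
have expand t := real_derivative_expansion dm (x := a + t).
suff /(_ (b - a)) : forall t, 0 <= t <= b - a ->
    m (a + t) <= (cst (m a) + (K + 1) \*: (@idfun R)) t.
  rewrite lexx subr_ge0 ab => /(_ isT).
  by rewrite YE addrCA subrr addr0 lerBlDl.
apply: (@barrier _ _ _ (fun=> K + 1)) => //.
- move=> t /andP[t0 tba]; have at0 : 0 <= a + t by exact: addr_ge0.
  have [del del0 Hd] := expand t at0 1 ltr01.
  set c := `|m' (a + t)| + 1; have c0 : 0 < c by rewrite ltr_wpDl.
  apply/cvgrPdist_le => e e0; apply/nbhs_ballP.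
  exists (Num.min del (e / c)); first by rewrite /= lt_min del0 divr_gt0.
  move=> s; rewrite /ball/= in_itv/= lt_min => /andP[ts1 ts2] /andP[s0 sba].
  have as0 : 0 <= a + s by exact: addr_ge0.
  have E1 : a + t - (a + s) = t - s by ring.
  have := Hd (a + s) as0; rewrite E1 => /(_ ts1).
  rewrite (_ : a + s - (a + t) = s - t); last by ring.
  rewrite mul1r => h; rewrite distrC in ts2; rewrite distrC.
  have -> : m (a + s) - m (a + t) = (m (a + s) - m (a + t) - m' (a + t) * (s - t)) +
    m' (a + t) * (s - t) by ring.
  rewrite (le_trans (ler_normD _ _))// normrM.
  move: ts2; rewrite ltr_pdivlMr// => ts2.
  by rewrite (le_trans _ (ltW ts2))// /c; lra.
- by rewrite YE addr0 mulr0 addr0.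
move=> s /andP[s0 sba] _; exists K; last by rewrite ltrDl.
have as0 : 0 <= a + s by exact: addr_ge0.
move=> eta eta0; have [del del0 Hd] := expand s as0 eta eta0.
have m'K : m' (a + s) <= K by apply: mK; rewrite as0 -lerBrDl (le_trans (ltW sba))// lerD2r.
near=> t.
have st : s < t by near: t; exact: nbhs_right_gt.
have tsd : t < s + del by near: t; apply: nbhs_right_lt; rewrite ltrDl.
have at0 : 0 <= a + t by rewrite addr_ge0// (le_trans s0)// ltW.
have ts0 : 0 < t - s by rewrite subr_gt0.
have := Hd (a + t) at0.
rewrite (_ : a + s - (a + t) = s - t); last by ring.
rewrite (_ : a + t - (a + s) = t - s); last by ring.
rewrite distrC gtr0_norm// ltrBlDl => /(_ tsd).
move=> /(le_trans (ler_norm _)).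
by have := ler_wpM2r (ltW ts0) m'K; lra.
Unshelve. all: by end_near. Qed.

(** [m'] is bounded on the compact [[0, S]], hence [m] is Lipschitz there. The lower bound
    [Num.min nu 1] does not depend on [S], so [S] may later be chosen in terms of it. *)
Lemma coef_of_class_C1 m nu : class_C1 `[0, +oo[ m -> 0 < nu ->
  (forall s, 0 <= s -> nu <= m s) -> forall S, 0 <= S -> exists M L,
  coef_bounds (m \o clamp S) (Num.min nu 1) M L.
Proof.
move=> [m' [dm cm']] nu0 num S S0.
have cS : {within `[0, S], continuous m'}.
  apply: continuous_subspaceW cm' => x; rewrite /= !in_itv/= => /andP[-> _]//.
have [c1 _ max1] := EVT_max S0 cS.
have [c2 _ min2] := EVT_min S0 cS.
pose K := `|m' c1| + `|m' c2|.
have m'K x : 0 <= x <= S -> m' x <= K.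
  move=> xS; rewrite (le_trans (max1 x _)) ?in_itv//.
  by rewrite (le_trans (ler_norm _))// lerDl.
have m'KN x : 0 <= x <= S -> - m' x <= K.
  move=> xS; have : - m' x <= - m' c2 by rewrite lerN2 min2// in_itv.
  by have := ler_norm (- m' c2); rewrite normrN /K; have := normr_ge0 (m' c1); lra.
have dmN : real_derivative_on `[0, +oo[ (fun x => - m x) (fun x => - m' x).
  move=> t t0; have := dm t t0; apply: cvg_trans; apply: near_eq_cvg.
  apply: nearW => s; rewrite -[RHS]normrN; congr `|_|.
  by rewrite /GRing.scale/=; ring.
have K0 : 0 <= K by rewrite addr_ge0.
have lip x y : 0 <= x <= S -> 0 <= y <= S -> `|m x - m y| <= (K + 1) * `|x - y|.
  wlog xy : x y / y <= x.
    move=> W xS yS; have [yx|/ltW xy] := leP y x; first exact: W.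
    by rewrite distrC [`|x - y|]distrC; exact: W.
  move=> /andP[x0 xS] /andP[y0 yS]; rewrite [`|x - y|]ger0_norm ?subr_ge0//.
  have h1 := C1_increment dm m'K y0 xy xS.
  have h2 := C1_increment dmN m'KN y0 xy xS.
  by rewrite ler_norml; apply/andP; split; lra.
have z0S : 0 <= (0 : R) <= S by rewrite lexx.
exists (Num.max 1 (m 0 + (K + 1) * S)), (K + 1); split.
- by rewrite lt_min nu0 ltr01.
- by rewrite ge_min lexx orbT.
- by rewrite le_max lexx.
- by rewrite lerDr.
- move=> x /=; rewrite ge_min num//.
  by have /andP[] := clamp_in x S0.
- move=> x /=; rewrite le_max; apply/orP; right.
  have := lip _ _ (clamp_in x S0) z0S => /(le_trans (ler_norm _)).
  rewrite lerBlDl => /le_trans; apply; rewrite lerD2l ler_wpM2l ?addr_ge0//.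
  by have /andP[c0 cS'] := clamp_in x S0; rewrite subr0 ger0_norm.
- move=> x y /=; rewrite (le_trans (lip _ _ _ _)) ?clamp_in//.
  by rewrite ler_wpM2l ?addr_ge0// clamp_lipschitz.
Qed.

End Nonlinearity.

Section LifeSpan.
Context {R : realType} {H : completeNormedModType R}.
Variables (dot : {dot H for idfun}) (e : nat -> H) (lam : nat -> R).
Hypotheses (dotN : inner_product_norm dot) (eB : orthonormal_basis dot e).
Hypothesis lam0 : forall k, 0 <= lam k.

Definition truncate (n : nat) (a : nat -> R) k := if (k < n)%N then a k else 0.

(** Uniformity in [N] is the point: the truncation will depend on [eps], while [Q] must not. *)
Definition reference_bound mh p q (T Q : R) := forall N rho r h,
  reference mh lam N T (truncate N p) (truncate N q) rho r h ->
  forall t, 0 <= t <= T -> moment mh lam N T rho r h lam t <= Q /\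
    moment mh lam N T rho r h (fun k => lam k ^+ 3) t <= Q.

Variables (m mh : R -> R) (nu M L : R) (hm : coef_bounds mh nu M L).
Variables (u0 u1 : H) (MS Smax : R).
Hypotheses (d0 : dom_pow dot e lam (3 / 4) u0) (d1 : dom_pow dot e lam (1 / 4) u1).

Let p k := dot u0 (e k).
Let q k := dot u1 (e k).
Let S0 := `|pow_op dot e lam (1 / 2) u0| ^+ 2.
Let Q0 := `|u1| ^+ 2.

Hypothesis mSle : forall x, 0 <= x <= S0 -> mh x <= MS.
Hypothesis Smax_ge : (Q0 + MS * S0) / nu + 1 <= Smax.
Hypothesis mhE : forall x, 0 <= x <= Smax -> mh x = m x.

Let nu0 : 0 < nu := coef_nu_gt0 hm.
Let nu1 : nu <= 1 := coef_nu_le1 hm.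
Let M1 : 1 <= M := coef_M_ge1 hm.
Let L1 : 1 <= L := coef_L_ge1 hm.

Lemma data_energy_weighted_sum (w : nat -> R) a b n :
  \sum_(0 <= k < n) w k * data_energy lam a b k =
  \sum_(0 <= k < n) w k * b k ^+ 2 + \sum_(0 <= k < n) w k * (lam k ^+ 2 * a k ^+ 2).
Proof. by rewrite -big_split/=; apply: eq_bigr => k _; rewrite -mulrDr. Qed.

Lemma data_energy_dom_bound z0 z1 n : dom_pow dot e lam (3 / 4) z0 ->
  dom_pow dot e lam (1 / 4) z1 ->
  \sum_(0 <= k < n) lam k * data_energy lam (fun k => dot z0 (e k)) (fun k => dot z1 (e k)) k
  <= `|pow_op dot e lam (1 / 4) z1| ^+ 2 + `|pow_op dot e lam (3 / 4) z0| ^+ 2.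
Proof.
move=> dz0 dz1; rewrite data_energy_weighted_sum; apply: lerD.
  apply: le_trans (pow_op_norm_ge dotN eB lam0 n dz1).
  by apply: ler_sum => k _; rewrite powR_14.
apply: le_trans (pow_op_norm_ge dotN eB lam0 n dz0).
by apply: ler_sum => k _; rewrite powR_34// mulrA -exprS.
Qed.

Lemma half_norm_cvg z : dom_pow dot e lam (3 / 4) z ->
  series (fun k => lam k ^+ 2 * dot z (e k) ^+ 2) @ \oo -->
  `|pow_op dot e lam (1 / 2) z| ^+ 2.
Proof.
move=> dz; have := pow_op_norm dotN eB lam0 (dom_pow_half dotN eB lam0 dz).
rewrite (_ : (fun k => _) = (fun k => lam k ^+ 2 * dot z (e k) ^+ 2))//.
by apply/funext => k; rewrite powR_12.
Qed.

Lemma data_energy_dom_sum z0 z1 : dom_pow dot e lam (3 / 4) z0 ->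
  dom_pow dot e lam (1 / 4) z1 -> exists E, forall n, \sum_(0 <= k < n) (1 + lam k) *
    data_energy lam (fun k => dot z0 (e k)) (fun k => dot z1 (e k)) k <= E.
Proof.
move=> dz0 dz1.
exists (`|z1| ^+ 2 + `|pow_op dot e lam (1 / 2) z0| ^+ 2 +
  (`|pow_op dot e lam (1 / 4) z1| ^+ 2 + `|pow_op dot e lam (3 / 4) z0| ^+ 2)) => n.
under eq_bigr do rewrite mulrDl mul1r.
rewrite big_split/= lerD ?data_energy_dom_bound//.
rewrite big_split/= lerD//.
  by apply: series_le_lim; [move=> k; exact: sqr_ge0|exact: parseval].
apply: (series_le_lim _ _ (half_norm_cvg dz0)) => k.
by rewrite mulr_ge0 ?sqr_ge0.
Qed.

(** Expand [b^2 - a^2] around [a] and apply Young's inequality with weight [eps] to the cross term;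
    [(1 + 1 / eps) * eps ^+ 2 + eps * S] is at most [eps * (S + 2)]. *)
Lemma sqr_norm_perturbation (a b : nat -> R) (S eps : R) n : 0 < eps -> eps <= 1 ->
  \sum_(0 <= k < n) lam k ^+ 2 * a k ^+ 2 <= S ->
  \sum_(0 <= k < n) lam k ^+ 2 * (b k - a k) ^+ 2 <= eps ^+ 2 ->
  `|\sum_(0 <= k < n) lam k ^+ 2 * b k ^+ 2 - \sum_(0 <= k < n) lam k ^+ 2 * a k ^+ 2|
  <= eps * (S + 2).
Proof.
move=> eps0 eps1 aS ba; rewrite -sumrB (le_trans (ler_norm_sum _ _ _))//.
apply: (@le_trans _ _ (\sum_(0 <= k < n) ((1 + eps^-1) * (lam k ^+ 2 * (b k - a k) ^+ 2)
    + eps * (lam k ^+ 2 * a k ^+ 2)))).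
  apply: ler_sum => k _.
  have -> : lam k ^+ 2 * b k ^+ 2 - lam k ^+ 2 * a k ^+ 2 =
    (lam k * (b k - a k)) ^+ 2 + 2 * (lam k * (b k - a k)) * (lam k * a k) by ring.
  rewrite (le_trans (ler_normD _ _))// ger0_norm ?sqr_ge0//.
  have := young_weighted (lam k * (b k - a k)) (lam k * a k) eps0.
  by rewrite !exprMn; lra.
rewrite big_split/= -!mulr_sumr.
have e0 : 0 <= 1 + eps^-1 by rewrite addr_ge0// invr_ge0 ltW.
have h1 := ler_wpM2l e0 ba; have h2 := ler_wpM2l (ltW eps0) aS.
have h3 : (1 + eps^-1) * eps ^+ 2 = eps ^+ 2 + eps.
  by field; rewrite gt_eqF.
have h4 : eps ^+ 2 <= eps by rewrite expr2 ler_piMl// ltW.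
by rewrite h3 in h1; lra.
Qed.

(** The initial gap to the reference is [S0 + 2] times [eps] for the perturbation plus [eps] for the
    truncation. [C0] is one constant for which [B = C0 * Q] meets all the conditions on [B]. *)
Let kap := S0 + 3.
Let C0 := 25 * M * (L ^+ 2 * kap ^+ 2) / nu ^+ 2.

Let S00 : 0 <= S0. Proof. exact: sqr_ge0. Qed.
Let kap1 : 1 <= kap. Proof. by rewrite /kap; have := S00; lra. Qed.

Let constants Q B : 1 <= Q -> B = C0 * Q ->
  [/\ 1 <= B, 2 * (L * (Q / nu + 1) / nu) <= B,
      2 * L ^+ 2 * kap ^+ 2 * Q / nu <= B ^+ 2 & (20 * M + 2 * Q) / nu <= B].
Proof.
move=> Q1 BE; set P := L ^+ 2 * kap ^+ 2; set z := nu^-1.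
have L2 : L <= L ^+ 2 by rewrite expr2 ler_peMr// (le_trans ler01).
have k2 : 1 <= kap ^+ 2 by rewrite exprn_ege1.
have LP : L <= P by rewrite (le_trans L2)// /P ler_peMr ?sqr_ge0.
have P1 : 1 <= P by exact: le_trans L1 LP.
have z1 : 1 <= z by rewrite invf_ge1.
have z2 : z <= z ^+ 2 by rewrite expr2 ler_peMr// (le_trans ler01).
have [z0 P0 M0 Q0'] := And4 (le_trans ler01 z1) (le_trans ler01 P1)
  (le_trans ler01 M1) (le_trans ler01 Q1).
have zz1 : 1 <= z ^+ 2 by exact: le_trans z1 z2.
have {}BE : B = 25 * (M * P * Q * z ^+ 2).
  by rewrite BE /C0 -/P /z exprVn; ring.
have PM : P <= M * P by rewrite ler_peMl.
have PMQ : P * Q <= M * P * Q by rewrite ler_wpM2r.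
have MQ : M * Q <= M * P * Q by rewrite ler_wpM2r// ler_peMr.
have Qz : 0 <= Q * z ^+ 2 by rewrite mulr_ge0// exprn_ge0.
have zz0 : 0 <= z ^+ 2 by exact: sqr_ge0.
have MPQ1 : 1 <= M * P * Q.
  by rewrite (le_trans Q1)// (le_trans _ MQ)// ler_peMl.
have h0 : 1 <= M * P * Q * z ^+ 2 by rewrite mulr_ege1.
have h1 : L * (Q * z ^+ 2) <= M * P * Q * z ^+ 2.
  by rewrite -mulrA ler_wpM2r// (le_trans LP).
have h2 : P * Q * z <= M * P * Q * z ^+ 2.
  by apply: ler_pM => //; rewrite mulr_ge0.
have h3 : M * Q * z <= M * P * Q * z ^+ 2.
  by apply: ler_pM => //; rewrite mulr_ge0.
have h4 : M * z <= M * Q * z by rewrite ler_wpM2r// ler_peMr.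
have h5 : Q * z <= M * Q * z by rewrite ler_wpM2r// ler_peMl.
have h6 : L * z <= L * (Q * z ^+ 2).
  rewrite ler_wpM2l ?(le_trans ler01)// (le_trans z2)//.
  by rewrite ler_peMl.
have B1 : 1 <= B by rewrite BE; lra.
split => //; rewrite -/z.
- by rewrite BE; lra.
- rewrite (@le_trans _ _ B)//; last by rewrite expr2 ler_peMr// (le_trans ler01).
  rewrite (_ : 2 * L ^+ 2 * kap ^+ 2 * Q * z = 2 * (P * Q * z)); last by rewrite /P; ring.
  by rewrite BE; lra.
- by rewrite BE; lra.
Qed.

(** [C2] depends on the unperturbed data only, so it is fixed before [T], [Q], [eps] and the
    perturbed data are given. *)
Lemma life_span_ge : exists2 C2, 0 < C2 & forall T Q eps v0 v1,
  0 < T -> 1 <= Q -> reference_bound mh p q T Q -> 0 < eps -> eps <= 1 ->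
  dom_pow dot e lam (3 / 4) v0 -> dom_pow dot e lam (1 / 4) v1 ->
  `|u1 - v1| ^+ 2 + `|pow_op dot e lam (1 / 4) (u1 - v1)| ^+ 2
    + `|pow_op dot e lam (1 / 2) (u0 - v0)| ^+ 2
    + `|pow_op dot e lam (3 / 4) (u0 - v0)| ^+ 2 <= eps ^+ 2 ->
  C2 * Q * (1 + T) <= - ln eps ->
  (T%:E <= life_span dot e lam m v0 v1)%E.
Proof.
have [C01 _ _ _] := constants (lexx 1) (esym (mulr1 C0)).
exists (kap * C0); first by rewrite mulr_gt0// ?(lt_le_trans ltr01).
move=> T Q eps v0 v1 T0 Q1 refB eps0 eps1 dv0 dv1 dist small.
have [Q0' kap0] := conj (le_trans ler01 Q1) (le_trans ler01 kap1).
have C00 : 0 <= C0 by exact: le_trans ler01 C01.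
pose B := C0 * Q.
have [B1 BK BB BQ] := constants Q1 (erefl B).
(* The prefactor [kap * B] is at most its exponential; this is why [1 + T], not [T], appears in the
   condition on [eps]. *)
have smallT : kap * B * eps * expR (B * T) <= 1.
  apply: (@le_trans _ _ (expR (kap * B) * expR (ln eps) * expR (B * T))).
    rewrite lnK ?posrE// ler_wpM2r ?expR_ge0// ler_wpM2r ?(ltW eps0)//.
    by rewrite (le_trans _ (expR_ge1Dx _))// lerDr.
  rewrite -!expRD -expR0 ler_expR.
  have : B * T <= kap * B * T.
    by rewrite ler_wpM2r ?(ltW T0)// ler_peMl// (le_trans ler01).
  by move: small; rewrite /B; lra.
pose p' k := dot v0 (e k); pose q' k := dot v1 (e k).
have dD0 := dom_powB d0 dv0; have dD1 := dom_powB d1 dv1.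
have [hd hh] : `|pow_op dot e lam (1 / 4) (u1 - v1)| ^+ 2 +
    `|pow_op dot e lam (3 / 4) (u0 - v0)| ^+ 2 <= eps ^+ 2 /\
    `|pow_op dot e lam (1 / 2) (u0 - v0)| ^+ 2 <= eps ^+ 2.
  have a1 := sqr_ge0 `|u1 - v1|.
  have a2 := sqr_ge0 `|pow_op dot e lam (1 / 4) (u1 - v1)|.
  have a3 := sqr_ge0 `|pow_op dot e lam (1 / 2) (u0 - v0)|.
  have a4 := sqr_ge0 `|pow_op dot e lam (3 / 4) (u0 - v0)|.
  by split; lra.
have sqrBC (x y : R) : (x - y) ^+ 2 = (y - x) ^+ 2 by rewrite -opprB sqrrN.
have distS n : \sum_(0 <= k < n) lam k * data_energy lam (fun k => p' k - p k)
    (fun k => q' k - q k) k <= eps ^+ 2.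
  apply: le_trans hd; apply: le_trans (data_energy_dom_bound n dD0 dD1).
  apply: ler_sum => k _.
  by rewrite /data_energy !dotBl (sqrBC (p' k)) (sqrBC (q' k)) lexx.
have halfS n : \sum_(0 <= k < n) lam k ^+ 2 * (p' k - p k) ^+ 2 <= eps ^+ 2.
  apply: le_trans hh; apply: le_trans (series_le_lim n _ (half_norm_cvg dD0)).
    by apply: ler_sum => k _; rewrite dotBl (sqrBC (p' k)) lexx.
  by move=> k; rewrite mulr_ge0 ?sqr_ge0.
pose A k := lam k * data_energy lam p q k.
have A0 k : 0 <= A k by rewrite mulr_ge0 ?data_energy_ge0.
have cA := bounded_series_cvg A0 (fun n => data_energy_dom_bound n d0 d1).
have /cvgrPdist_le/(_ _ (exprn_gt0 2 eps0))[N1 _ HN1] := cA.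
have /cvgrPdist_le/(_ _ eps0)[N2 _ HN2] := half_norm_cvg d0.
(* Beyond [N] the weighted data energy is at most [eps ^+ 2] and the part of [S0] at most [eps]. *)
pose N := maxn N1 N2.
have {HN1} tailA := HN1 N (leq_maxl _ _).
have {HN2} tailS := HN2 N (leq_maxr _ _).
have trunc0 a k : (N <= k)%N -> truncate N a k = 0 by rewrite /truncate ltnNge => ->.
have [rho [r [h ref]]] := reference_exists hm lam0 (ltW T0) (trunc0 p) (trunc0 q).
have momQ := refB _ _ _ _ ref.
have z0T : 0 <= (0 : R) <= T by rewrite lexx ltW.
have rho0 : rho 0 = \sum_(0 <= k < N) lam k ^+ 2 * p k ^+ 2.
  rewrite (ref_rho ref)// big_nat [RHS]big_nat; apply: eq_bigr => k /andP[_ kN].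
  by rewrite (mode_init (ref_modes ref k)) /truncate kN.
have sqr_lp z k : 0 <= lam k ^+ 2 * dot z (e k) ^+ 2 by rewrite mulr_ge0 ?sqr_ge0.
have partS n : \sum_(0 <= k < n) lam k ^+ 2 * p k ^+ 2 <= S0.
  exact: (series_le_lim n (sqr_lp u0) (half_norm_cvg d0)).
pose sig0 := `|pow_op dot e lam (1 / 2) v0| ^+ 2.
have sig0rho : `|sig0 - rho 0| <= kap * eps.
  have h1 : `|sig0 - S0| <= eps * (S0 + 2).
    apply: (cvgn_le (N := 0%N)
      (cvg_norm (cvgB (half_norm_cvg dv0) (half_norm_cvg d0)))) => n _.
    exact: (sqr_norm_perturbation eps0 eps1 (partS n) (halfS n)).
  have -> : sig0 - rho 0 = (sig0 - S0) + (S0 - rho 0) by ring.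
  rewrite (le_trans (ler_normD _ _))// rho0.
  by move: tailS; rewrite /series/= -/S0 /kap; lra.
(* Below [N] the truncation changes nothing; above it, [(a + b)^2 <= 2 a^2 + 2 b^2] separates
   perturbation and tail, each contributing [2 * eps ^+ 2]. *)
have dist_data n : \sum_(0 <= k < n) lam k * data_energy lam
    (fun k => p' k - truncate N p k) (fun k => q' k - truncate N q k) k <= 4 * eps ^+ 2.
  pose t k := if (k < N)%N then 0 else A k.
  have t0 k : 0 <= t k by rewrite /t; case: ifP.
  have sumt : \sum_(0 <= k < n) t k <= eps ^+ 2.
    apply: (@le_trans _ _ (\sum_(0 <= k < maxn N n) t k)).
      by rewrite [leRHS](@big_cat_nat _ _ _ n) ?leq_maxr//= lerDl sumr_ge0.
    have -> : \sum_(0 <= k < maxn N n) t k = \sum_(N <= k < maxn N n) A k.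
      rewrite (@big_cat_nat _ _ _ N) ?leq_maxl//= big_nat big1 ?add0r; last first.
        by move=> k /andP[_ kN]; rewrite /t kN.
      rewrite big_nat [RHS]big_nat; apply: eq_bigr => k /andP[Nk _].
      by rewrite /t ltnNge Nk.
    have := series_le_lim (maxn N n) A0 cA.
    rewrite [X in X <= _](@big_cat_nat _ _ _ N) ?leq_maxl//=.
    by have := le_trans (ler_norm _) tailA; rewrite /series/=; lra.
  apply: (@le_trans _ _ (\sum_(0 <= k < n) (2 * (lam k * data_energy lam
      (fun k => p' k - p k) (fun k => q' k - q k) k) + 2 * t k))); last first.
    by rewrite big_split/= -!mulr_sumr; have := distS n; lra.
  apply: ler_sum => k _.
  have D0 := mulr_ge0 (lam0 k)
    (data_energy_ge0 lam (fun k => p' k - p k) (fun k => q' k - q k) k).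
  move: D0; rewrite /t /A /truncate /data_energy; case: ifP => _ D0; first by lra.
  rewrite !subr0 !(mulrCA 2) -mulrDr ler_wpM2l//.
  have := sqr_ge0 (q' k - 2 * q k).
  have := ler_wpM2l (sqr_ge0 (lam k)) (sqr_ge0 (p' k - 2 * p k)).
  by lra.
have [E bE] := data_energy_dom_sum dv0 dv1.
have [sig [f [g [lips fg sigE sigrho]]]] := perturbation hm lam0 (ltW T0) ref Q1
  (fun t tT => (momQ t tT).1) (fun t tT => (momQ t tT).2)
  kap1 eps0 B1 BK BB BQ smallT dist_data bE (half_norm_cvg dv0) sig0rho.
have K0 : 0 <= Q / nu + 1 by rewrite addr_ge0// divr_ge0// ltW.
(* Energy conservation bounds [rho], and [sig] is within 1 of it: [Smax] has exactly this margin. *)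
have mhsig t : 0 <= t <= T -> mh (sig t) = m (sig t).
  move=> t0T; apply: mhE; apply/andP; split.
    have f0 k : 0 <= lam k ^+ 2 * f k t ^+ 2 by rewrite mulr_ge0 ?sqr_ge0.
    by have := series_le_lim 0 f0 (sigE t t0T); rewrite big_geq.
  apply: le_trans Smax_ge; have := sigrho t t0T.
  move=> /(le_trans (ler_norm _)); rewrite lerBlDl => /le_trans; apply.
  rewrite lerD2r.
  have [] := reference_hamiltonian hm (ltW T0) ref mSle _ _ t0T (Q0 := Q0) => //.
    rewrite (le_trans _ (partS N))//; apply: ler_sum => k _; rewrite /truncate.
    by case: ifP => // _; rewrite expr0n/= mulr0; exact: sqr_lp.
  apply: (@le_trans _ _ (\sum_(0 <= k < N) q k ^+ 2)).
    apply: ler_sum => k _; rewrite /truncate.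
    by case: ifP => // _; rewrite expr0n/= sqr_ge0.
  by apply: series_le_lim; [move=> k; exact: sqr_ge0|exact: parseval].
have [u [u' [sol ui ui']]] := kirchhoff_of_modes dotN eB hm lam0 T0 K0 lips fg bE sigE mhsig.
apply: ereal_sup_ubound; exists T => //; split=> //.
by exists u, u'.
Qed.

End LifeSpan.

(** * The life span criterion and its use for the three classes of data *)

Section Criterion.
Context {R : realType}.

(* The life span criterion in terms of the frequencies [lam] and mode energies
   [A] of the unperturbed data alone; [y] bounds the logarithm of the Gevrey
   energy and [Lm y] the frequencies that matter at that energy. *)
Definition life_span_criterion (lam A : nat -> R) (C1 C2 H0 M : R) (LS : R -> \bar R) :=
  forall (T Q eps : R) (om : nat -> R) (Eom : R) (Lm y y' : R -> R),
  0 < T -> 1 <= Q -> (forall k, 0 <= om k) ->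
  (forall n, \sum_(0 <= k < n) om k * A k <= Eom) -> 1 + M * Eom <= expR (y 0) ->
  (forall t, 0 <= t <= T -> is_derive t 1 y (y' t)) ->
  (forall t, 0 <= t <= T -> 0 <= Lm (y t)) ->
  (forall t, 0 <= t <= T -> C1 * (Lm (y t) * H0 + 1) < y' t) ->
  (forall k t, 0 <= t <= T -> Lm (y t) < lam k ->
    (lam k + lam k ^+ 3) * expR (y t) <= om k) ->
  (forall t, 0 <= t <= T -> Lm (y t) * H0 + 1 <= Q) ->
  (forall t, 0 <= t <= T -> Lm (y t) ^+ 3 * H0 + 1 <= Q) ->
  0 < eps -> eps <= 1 -> C2 * Q * (1 + T) <= - ln eps -> (T%:E <= LS eps)%E.

Variables (lam A : nat -> R) (C1 C2 H0 M : R) (LS : R -> \bar R).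
Hypotheses (lam0 : forall k, 0 <= lam k) (A0 : forall k, 0 <= A k).
Hypotheses (C10 : 0 < C1) (C20 : 0 < C2) (H00 : 0 <= H0) (M0 : 0 < M).
Hypothesis crit : life_span_criterion lam A C1 C2 H0 M LS.

(** No energy sits above [Lam], so [Lm] and [Q] are constant. The condition on [eps] is then linear
    in [T], and half of [|ln eps|] is spent on each part of [1 + T]. *)
Lemma life_span_finite (Lam : R) : 0 <= Lam -> (forall k, Lam < lam k -> A k = 0) ->
  exists gamma eps0 : R, [/\ 0 < gamma, 0 < eps0 & forall eps, 0 < eps < eps0 ->
    ((gamma^-1 * `|ln eps|)%:E <= LS eps)%E].
Proof.
move=> Lam0 AL; have l1 := mulr_ge0 Lam0 H00.
have l3 := mulr_ge0 (exprn_ge0 3 Lam0) H00.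
pose Q := 1 + Lam * H0 + Lam ^+ 3 * H0.
have Q1 : 1 <= Q by rewrite /Q; lra.
have CQ : 0 < C2 * Q by rewrite mulr_gt0// (lt_le_trans ltr01).
pose a := C1 * (Lam * H0 + 1) + 1.
have a0 : 0 < a.
  have : 0 <= C1 * (Lam * H0 + 1) by rewrite mulr_ge0 ?(ltW C10)// addr_ge0.
  by rewrite /a; lra.
exists (2 * (C2 * Q)), (expR (- (2 * (C2 * Q)))); split.
- by rewrite mulr_gt0.
- exact: expR_gt0.
move=> eps /andP[eps0 epslt].
have leps : ln eps < - (2 * (C2 * Q)) by rewrite -[ltRHS]expRK ltr_ln ?posrE ?expR_gt0.
rewrite ltr0_norm; last by lra.
set l := - ln eps; have ll : 2 * (C2 * Q) < l by rewrite /l; lra.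
have T0 : 0 < (2 * (C2 * Q))^-1 * l by rewrite mulr_gt0 ?invr_gt0 ?mulr_gt0//; lra.
set T := _ * l in T0 *.
have CQT : C2 * Q * T = l / 2 by rewrite /T; field; rewrite !gt_eqF// (lt_le_trans ltr01).
(* Frequencies above [Lam] carry no data, so this weight can be as large as the splitting demands
   while its energy sum stays 0. *)
pose om k := if Lam < lam k then (lam k + lam k ^+ 3) * expR (a * T) else 0.
have dy (t : R) : is_derive t 1 (a \*: (@idfun R)) a.
  by apply: is_derive_eq; rewrite /GRing.scale/= mulr1.
apply: (crit (om := om) (Eom := 0) (Lm := fun=> Lam) (y := fun t => a * t)
  (y' := fun=> a) (Q := Q)) => //.
- by move=> k; rewrite /om; case: ifP => // _;
    rewrite mulr_ge0 ?expR_ge0// addr_ge0// exprn_ge0.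
- move=> n; rewrite big1// => k _; rewrite /om; case: ifP => [/AL->|_]; first by rewrite mulr0.
  by rewrite mul0r.
- by rewrite !mulr0 addr0 expR0.
- by move=> t _; rewrite /a; lra.
- move=> k t /andP[_ tT] Lk; rewrite /om Lk ler_wpM2l//.
    by rewrite addr_ge0// exprn_ge0.
  by rewrite ler_expR ler_wpM2l// ltW.
- by move=> t _; rewrite /Q; lra.
- by move=> t _; rewrite /Q; lra.
- rewrite -ler_ln ?posrE// ln1; have := CQ; lra.
- by rewrite mulrDr mulr1 CQT -/l; lra.
Qed.

Section Gevrey.
Variables (phi : R -> R) (C E : R).
Hypothesis phiC : forall l, 0 <= l -> 1 + l ^+ 2 <= C * expR (phi l / 2).
Hypothesis phiE : forall n, \sum_(0 <= k < n) lam k * expR (phi (lam k)) * A k <= E.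

(** Half of the Gevrey exponent is spent on the polynomial factor, through [phiC]; the other half
    drives the splitting, hence [phi l / 2] in what follows. *)
Let om k := (lam k + lam k ^+ 3) * expR (phi (lam k) / 2).

Let om0 k : 0 <= om k.
Proof. by rewrite mulr_ge0 ?expR_ge0// addr_ge0// exprn_ge0. Qed.

Let C0 : 0 < C.
Proof.
have := phiC (lexx 0); rewrite expr0n/= addr0 => h.
by rewrite -(pmulr_lgt0 _ (expR_gt0 (phi 0 / 2))) (lt_le_trans ltr01).
Qed.

Let om_sum n : \sum_(0 <= k < n) om k * A k <= C * E.
Proof.
apply: le_trans (ler_wpM2l (ltW C0) (phiE n)); rewrite mulr_sumr.
apply: ler_sum => k _; rewrite mulrA ler_wpM2r// /om.
have := phiC (lam0 k); set x := phi (lam k) / 2 => h.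
have -> : expR (phi (lam k)) = expR x * expR x by rewrite -expRD; congr expR; rewrite /x; lra.
rewrite [leLHS](_ : _ = lam k * expR x * (1 + lam k ^+ 2)); last by ring.
rewrite [leRHS](_ : _ = lam k * expR x * (C * expR x)); last by ring.
by rewrite ler_wpM2l// mulr_ge0// expR_ge0.
Qed.

Let E0 : 0 <= C * E. Proof. by have := om_sum 0; rewrite big_geq. Qed.

Let om_ge (Y : R) (Lm : R -> R) : (forall l, 0 <= l -> Lm Y < l -> Y <= phi l / 2) ->
  forall k, Lm Y < lam k -> (lam k + lam k ^+ 3) * expR Y <= om k.
Proof.
move=> LmY k Lk; rewrite ler_wpM2l ?addr_ge0 ?exprn_ge0//.
by rewrite ler_expR; exact: LmY.
Qed.

(** A linear [phi] gives [Lm y = B * y], so the bound on the logarithm of the energy solves a linear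
    equation: [y] is an exponential in time and [Q] a constant times its cube. *)
Lemma life_span_linear (B : R) : 0 < B -> (forall l, 0 <= l -> l = B * (phi l / 2)) ->
  exists gamma eps1 : R, [/\ 0 < gamma, 0 < eps1 & forall eps, 0 < eps < eps1 ->
    ((gamma^-1 * ln `|ln eps|)%:E <= LS eps)%E].
Proof.
move=> B0 phiB.
have B3 := exprn_gt0 3 B0.
pose y0 := 1 + M * (C * E).
have ME0 : 0 <= M * (C * E) by rewrite mulr_ge0// ltW.
have y01 : 1 <= y0 by rewrite lerDl.
have y00 : 0 < y0 by rewrite (lt_le_trans ltr01).
have BH := mulr_ge0 (ltW B0) H00; have B3H := mulr_ge0 (ltW B3) H00.
pose a := C1 * (B * H0 + 1) + 1.
have a0 : 0 < a.
  have : 0 <= C1 * (B * H0 + 1) by rewrite mulr_ge0 ?(ltW C10)// addr_ge0.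
  by rewrite /a; lra.
pose K3 := 1 + B * H0 + B ^+ 3 * H0.
have K31 : 1 <= K3 by rewrite /K3; lra.
pose K2 := K3 * y0 ^+ 3.
have K21 : 1 <= K2 by rewrite mulr_ege1// exprn_ege1.
have D0 : 0 < C2 * K2 by rewrite mulr_gt0// (lt_le_trans ltr01).
(* [3 * a] is the exponential rate of [Q]; the [1] pays for [1 + T <= expR T]. *)
pose b := 3 * a + 1.
have b0 : 0 < b by rewrite /b; lra.
exists (2 * b), (expR (- expR (2 * (C2 * K2) + 1))); split.
- by rewrite mulr_gt0.
- exact: expR_gt0.
move=> eps /andP[eps0 epslt].
have leps : ln eps < - expR (2 * (C2 * K2) + 1).
  by rewrite -[ltRHS]expRK ltr_ln ?posrE ?expR_gt0.
have lneg : ln eps < 0 by rewrite (lt_trans leps)// oppr_lt0 expR_gt0.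
rewrite ltr0_norm//; set l := - ln eps.
have l0 : 0 < l by rewrite oppr_gt0.
have ll : 2 * (C2 * K2) + 1 < ln l.
  by rewrite -[ltLHS]expRK ltr_ln ?posrE ?expR_gt0// /l; lra.
have T0 : 0 < (2 * b)^-1 * ln l by rewrite mulr_gt0 ?invr_gt0 ?mulr_gt0//; lra.
set T := _ * ln l in T0 *.
have bT : b * T = ln l / 2 by rewrite /T; field; rewrite gt_eqF.
pose y t := y0 * expR (a * t).
have y1 t : 0 <= t <= T -> 1 <= y t.
  by move=> /andP[t0 _]; rewrite mulr_ege1// -expR0 ler_expR mulr_ge0// ltW.
have yT t : 0 <= t <= T -> y t <= y T.
  by move=> /andP[_ tT]; rewrite ler_wpM2l ?(ltW y00)// ler_expR ler_wpM2l// ltW.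
have YT1 : 1 <= y T by apply: y1; rewrite lexx ltW.
have pow13 (x : R) : 1 <= x -> 1 <= x ^+ 3 /\ x <= x ^+ 3.
  move=> x1; split; first exact: exprn_ege1.
  by rewrite [leRHS]exprS ler_peMr ?exprn_ege1// (le_trans ler01).
have [YT3 YT3'] := pow13 _ YT1.
pose Q := K3 * y T ^+ 3.
have Q1 : 1 <= Q by rewrite mulr_ege1.
apply: (crit (om := om) (Eom := C * E) (Lm := fun y => B * y) (y := y)
  (y' := fun t => y0 * a * expR (a * t)) (Q := Q)) => //.
- rewrite /y mulr0 expR0 mulr1 -/y0 (le_trans _ (expR_ge1Dx _))//; lra.
- by move=> t _; exact: is_derive_expR_scale.
- by move=> t t0T; rewrite mulr_ge0 ?(ltW B0)// (le_trans ler01)// y1.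
- move=> t t0T; have yt1 := y1 t t0T.
  have -> : y0 * a * expR (a * t) = a * y t by rewrite /y; ring.
  have : C1 * (B * y t * H0 + 1) <= C1 * (B * H0 + 1) * y t.
    by rewrite -[leRHS]mulrA ler_wpM2l ?(ltW C10)//; lra.
  by move=> /le_lt_trans; apply; rewrite ltr_pM2r ?(lt_le_trans ltr01)// /a ltrDl.
- move=> k t t0T; apply: (@om_ge (y t) (fun y => B * y)) => x x0.
  by rewrite {1}(phiB x x0) ltr_pM2l// => /ltW.
- move=> t t0T; have h1 := ler_wpM2l BH (le_trans (yT t t0T) YT3').
  have h2 := ler_wpM2l B3H (le_trans ler01 YT3).
  by rewrite /Q /K3; lra.
- move=> t t0T; have yt0 := le_trans ler01 (y1 t t0T).
  have yT0 := le_trans ler01 YT1.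
  have h0 : y t ^+ 3 <= y T ^+ 3 by rewrite lerXn2r ?nnegrE// yT.
  have h1 := ler_wpM2l B3H h0; have h2 := ler_wpM2l BH (le_trans ler01 YT3).
  by rewrite exprMn /Q /K3; lra.
- rewrite -ler_ln ?posrE// ln1 ltW//.
(* [w] is the square root of [|ln eps|]: one copy absorbs [C2 * K2] by the choice of the threshold,
   the other [expR (3 * a * T) * (1 + T)]. *)
set w := expR (b * T).
have ww : w * w = l by rewrite -expRD bT -[RHS]lnK ?posrE//; congr expR; lra.
have w0 : 0 < w by exact: expR_gt0.
have CK : C2 * K2 <= w.
  by rewrite (le_trans _ (expR_ge1Dx _))// bT; lra.
rewrite -/l -ww; apply: (@le_trans _ _ (C2 * K2 * w)); last by rewrite ler_wpM2r// ltW.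
rewrite /Q /y exprMn -expRM_natl.
rewrite (_ : C2 * _ * _ = C2 * K2 * (expR (3%:R * (a * T)) * (1 + T))); last first.
  by rewrite /K2; ring.
rewrite ler_wpM2l ?(ltW D0)//.
have -> : w = expR (3%:R * (a * T)) * expR T.
  by rewrite -expRD; congr expR; rewrite /b; ring.
by rewrite ler_wpM2l ?expR_ge0// expR_ge1Dx.
Qed.

(** Now [Lm y] is of order [y ln y]. The equation [y' = a y ln y] is solved by [y = expR z] with [z]
    an exponential, so [Q] is doubly exponential in [T]. *)
Lemma life_span_loglinear :
  (forall y l : R, 1 <= y -> 0 <= l -> 6 * y * ln (2 + 2 * y) < l -> y <= phi l / 2) ->
  exists gamma eps2 : R, [/\ 0 < gamma, 0 < eps2 & forall eps, 0 < eps < eps2 ->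
    ((gamma^-1 * ln (ln `|ln eps|))%:E <= LS eps)%E].
Proof.
move=> phiL.
pose z0 := 1 + M * (C * E).
have ME0 : 0 <= M * (C * E) by rewrite mulr_ge0// ltW.
have z01 : 1 <= z0 by rewrite lerDl.
have z00 : 0 < z0 by rewrite (lt_le_trans ltr01).
(* [18 = 6 * 3]: for [y >= 2] one has [ln (2 + 2 * y) <= 3 * ln y]. *)
pose c1 := 18 * H0; pose c3 := 18 ^+ 3 * H0.
have c10 : 0 <= c1 by rewrite mulr_ge0.
have c30 : 0 <= c3 by rewrite mulr_ge0// exprn_ge0.
pose a := C1 * (c1 + 1) + 1.
have a0 : 0 < a.
  have : 0 <= C1 * (c1 + 1) by rewrite mulr_ge0 ?(ltW C10)// addr_ge0.
  by rewrite /a; lra.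
pose K3 := 1 + c1 + c3.
have K31 : 1 <= K3 by rewrite /K3; lra.
have CK0 : 0 < C2 * K3 by rewrite mulr_gt0// (lt_le_trans ltr01).
(* The exponent to be bounded is [C2 * K3 + 6 * z T + T], with both [z T] and [T] at most
   [z0 * w]. *)
pose D := C2 * K3 + 7 * z0.
have D0 : 0 < D by rewrite /D; lra.
pose b := a + 1.
have b0 : 0 < b by rewrite /b; lra.
exists (2 * b), (expR (- expR (expR (2 * D + 1)))); split.
- by rewrite mulr_gt0.
- exact: expR_gt0.
move=> eps /andP[eps0 epslt].
have leps : ln eps < - expR (expR (2 * D + 1)).
  by rewrite -[ltRHS]expRK ltr_ln ?posrE ?expR_gt0.
have lneg : ln eps < 0 by rewrite (lt_trans leps)// oppr_lt0 expR_gt0.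
rewrite ltr0_norm//; set l := - ln eps.
have l0 : 0 < l by rewrite oppr_gt0.
have ll : expR (2 * D + 1) < ln l.
  by rewrite -[ltLHS]expRK ltr_ln ?posrE ?expR_gt0// /l; lra.
have ll0 : 0 < ln l by rewrite (lt_trans _ ll)// expR_gt0.
have lll : 2 * D + 1 < ln (ln l).
  by rewrite -[ltLHS]expRK ltr_ln ?posrE ?expR_gt0.
have T0 : 0 < (2 * b)^-1 * ln (ln l).
  by rewrite mulr_gt0 ?invr_gt0 ?mulr_gt0//; lra.
set T := _ * ln (ln l) in T0 *.
have bT : b * T = ln (ln l) / 2 by rewrite /T; field; rewrite gt_eqF.
pose z t := z0 * expR (a * t); pose y t := expR (z t).
have z1 t : 0 <= t <= T -> 1 <= z t.
  by move=> /andP[t0 _]; rewrite mulr_ege1// -expR0 ler_expR mulr_ge0// ltW.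
have yz t : z t + 1 <= y t by rewrite addrC; exact: expR_ge1Dx.
have y2 t : 0 <= t <= T -> 2 <= y t by move=> /z1; have := yz t; lra.
have yT t : 0 <= t <= T -> y t <= y T.
  move=> /andP[_ tT]; rewrite ler_expR ler_wpM2l ?(ltW z00)// ler_expR ler_wpM2l//.
  exact: ltW.
have YT2 : 2 <= y T by apply: y2; rewrite lexx ltW.
have YT1 : 1 <= y T by rewrite (le_trans _ YT2)// ler1n.
have y6 (k : nat) : (k <= 6)%N -> y T ^+ k <= y T ^+ 6 by move=> k6; exact: ler_weXn2l.
have y61 : 1 <= y T ^+ 6 by exact: (y6 0%N).
pose Lm (x : R) := 6 * x * ln (2 + 2 * x).
have LmE t : 0 <= t <= T -> 0 <= Lm (y t) <= 18 * (y t * z t).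
  move=> t0T; have yt2 := y2 t t0T; have yt0 : 0 < y t by exact: expR_gt0.
  have h1 : 0 <= ln (2 + 2 * y t) by rewrite ln_ge0//; lra.
  have h2 : ln (2 + 2 * y t) <= 3 * z t.
    have -> : 3 * z t = ln (y t ^+ 3).
      by rewrite /y lnXn ?expR_gt0// expRK mulr_natl.
    rewrite ler_ln ?posrE ?exprn_gt0//; last by lra.
    rewrite (_ : y t ^+ 3 = y t * (y t * y t)); last by rewrite !exprS expr0 mulr1.
    have h3 : 2 * 2 <= y t * y t by apply: ler_pM.
    have := ler_wpM2l (ltW yt0) h3; lra.
  have y60 : 0 <= 6 * y t by rewrite mulr_ge0// ltW.
  rewrite mulr_ge0//=; have := ler_wpM2l y60 h2; rewrite /Lm; lra.
have LmT t : 0 <= t <= T -> 0 <= Lm (y t) <= 18 * y T ^+ 2.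
  move=> t0T; have /andP[-> h] := LmE t t0T; rewrite (le_trans h)// ler_wpM2l//.
  have zy : z t <= y t by have := yz t; lra.
  have zt0 := le_trans ler01 (z1 t t0T).
  have yTt := yT t t0T; rewrite expr2.
  by apply: ler_pM; [exact: expR_ge0|exact: zt0|exact: yTt|exact: le_trans zy yTt].
(* Since [z <= y], [Lm (y t)] is at most [18 * y T ^+ 2], and its cube enters the criterion. *)
pose Q := K3 * y T ^+ 6.
have Q1 : 1 <= Q by rewrite mulr_ege1.
apply: (crit (om := om) (Eom := C * E) (Lm := Lm) (y := y)
  (y' := fun t => expR (z t) * (z0 * a * expR (a * t))) (Q := Q)) => //.
- have -> : y 0 = expR z0 by rewrite /y /z mulr0 expR0 mulr1.
  by rewrite -/z0; have := expR_ge1Dx z0; have := expR_ge1Dx (expR z0); lra.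
- move=> t _; have dz : is_derive t 1 z (z0 * a * expR (a * t)).
    exact: is_derive_expR_scale.
  exact: is_derive1_comp.
- by move=> t /LmE/andP[].
- move=> t t0T; have zt1 := z1 t t0T; have yt2 := y2 t t0T.
  have -> : expR (z t) * (z0 * a * expR (a * t)) = a * (y t * z t) by rewrite /y /z; ring.
  have yt1 : 1 <= y t by apply: le_trans yt2; rewrite ler1n.
  have yzt : 1 <= y t * z t by exact: mulr_ege1.
  have /andP[_ h] := LmE t t0T.
  have h2 : Lm (y t) * H0 + 1 <= (c1 + 1) * (y t * z t).
    by have := ler_wpM2r H00 h; rewrite /c1; lra.
  rewrite (le_lt_trans (ler_wpM2l (ltW C10) h2))// [ltLHS]mulrA.
  rewrite ltr_pM2r ?(lt_le_trans ltr01)//.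
  by rewrite /a ltrDl.
- move=> k t t0T; apply: (@om_ge (y t) Lm) => x x0; apply: phiL => //.
  by have := y2 t t0T; lra.
- move=> t t0T; have /andP[_ h] := LmT t t0T.
  have h1 := ler_wpM2r H00 h; have h2 := ler_wpM2l c10 (y6 2%N isT).
  have h3 := ler_wpM2l c30 (le_trans ler01 y61).
  by move: h1 h2 h3; rewrite /Q /K3 /c1 /c3; move: (18 ^+ 3) => N; lra.
- move=> t t0T; have /andP[h0 h] := LmT t t0T.
  have h1 : Lm (y t) ^+ 3 <= 18 ^+ 3 * y T ^+ 6.
    rewrite (_ : 18 ^+ 3 * y T ^+ 6 = (18 * y T ^+ 2) ^+ 3); last by rewrite exprMn -exprM.
    by rewrite lerXn2r ?nnegrE// mulr_ge0// exprn_ge0// (le_trans ler01).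
  have h2 := ler_wpM2r H00 h1; have h3 := ler_wpM2l c10 (le_trans ler01 y61).
  by move: h2 h3; rewrite /Q /K3 /c1 /c3; move: (18 ^+ 3) => N; lra.
- by rewrite -ler_ln ?posrE// ln1 ltW.
(* Here [w] is the square root of [ln |ln eps|], so it suffices that the exponent be at most [D * w]
   with [D <= w]. *)
set w := expR (b * T).
have ww : w * w = ln l by rewrite -expRD bT -[RHS]lnK ?posrE//; congr expR; lra.
have w0 : 0 < w by exact: expR_gt0.
have wD : D <= w by rewrite (le_trans _ (expR_ge1Dx _))// bT; lra.
have w1 : 1 <= w by rewrite -expR0 ler_expR mulr_ge0 ?ltW.
have aTw : expR (a * T) <= w by rewrite ler_expR ler_wpM2r ?(ltW T0)// /b lerDl.
have Tw : T <= z0 * w.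
  have h1 : T <= w.
    rewrite (le_trans _ (expR_ge1Dx _))// /b mulrDl mul1r.
    by have := mulr_ge0 (ltW a0) (ltW T0); lra.
  by rewrite (le_trans h1)// ler_peMl// ltW.
rewrite -/l -[l]lnK ?posrE// -ww.
apply: (@le_trans _ _ (expR (C2 * K3) * expR (6 * z T) * expR T)).
  have -> : C2 * Q * (1 + T) = C2 * K3 * expR (6 * z T) * (1 + T).
    by rewrite /Q /y -expRM_natl; ring.
  apply: ler_pM; rewrite ?expR_ge1Dx//.
  - by rewrite mulr_ge0 ?expR_ge0// ltW.
  - by rewrite addr_ge0// ltW.
  - by rewrite ler_wpM2r ?expR_ge0// (le_trans _ (expR_ge1Dx _))// lerDr.
have -> : expR (C2 * K3) * expR (6 * z T) * expR T = expR (C2 * K3 + 6 * z T + T).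
  by rewrite !expRD.
rewrite ler_expR; apply: (@le_trans _ _ (D * w)); last first.
  by rewrite ler_wpM2r// ltW.
have h1 : z T <= z0 * w by rewrite ler_wpM2l// ltW.
have h2 : C2 * K3 <= C2 * K3 * w by rewrite ler_peMr// ltW.
by rewrite /D; lra.
Qed.

End Gevrey.

End Criterion.

(** * Elementary inequalities for the two Gevrey weights *)

Section LogLinearWeight.
Context {R : realType}.
Implicit Types (x y l a b : R).

Lemma ln_le_sub1 x : 0 < x -> ln x <= x - 1.
Proof.
move=> x0; have := @le_ln1Dx R (x - 1).
by rewrite (_ : 1 + (x - 1) = x); [apply; lra|ring].
Qed.

Lemma ln_ge_half x : 2 <= x -> 1 / 2 <= ln x.
Proof.
move=> x2; have x0 : 0 < x by rewrite (lt_le_trans _ x2).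
have : ln x^-1 <= x^-1 - 1.
  by rewrite ln_le_sub1// invr_gt0.
have : x^-1 <= 2^-1 by rewrite lef_pV2 ?posrE.
by rewrite lnV ?posrE//; lra.
Qed.

Lemma ln_2D_gt0 x : 0 <= x -> 0 < ln (2 + x).
Proof. by move=> x0; rewrite ln_gt0//; lra. Qed.

(** Monotonicity of [x / ln (2 + x)] in cross-multiplied form. Concavity bounds [ln (2 + b)] by the
    tangent at [a], and [a / (2 + a) <= ln (2 + a)] absorbs the slope. *)
Lemma loglinear_mono a b : 0 <= a -> a <= b -> a * ln (2 + b) <= b * ln (2 + a).
Proof.
move=> a0 ab; have a2 : 0 < 2 + a by rewrite ltr_pwDl.
have b2 : 0 < 2 + b by rewrite ltr_pwDl// (le_trans a0).
have h1 : ln (2 + b) <= ln (2 + a) + (b - a) / (2 + a).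
  rewrite -lerBlDl -ln_div ?posrE//.
  rewrite (le_trans (ln_le_sub1 _)) ?divr_gt0//.
  rewrite le_eqVlt; apply/orP; left; apply/eqP; field.
  by rewrite gt_eqF.
have h2 : a / (2 + a) <= ln (2 + a).
  have : - ln (2 + a) <= (2 + a)^-1 - 1.
    by rewrite -lnV ?posrE// ln_le_sub1// invr_gt0.
  have -> : a / (2 + a) = 1 - (2 + a)^-1 - (2 + a)^-1 by field; rewrite gt_eqF.
  have : 0 < (2 + a)^-1 by rewrite invr_gt0.
  by lra.
have ba : 0 <= b - a by rewrite subr_ge0.
have h3 := ler_wpM2l a0 h1; have h4 := ler_wpM2r ba h2.
by lra.
Qed.

(** With [Y = 2 * y] and [a = 3 * Y * ln (2 + Y)], the bound [2 + a <= (2 + Y) ^+ 3] gives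
    [a / ln (2 + a) >= Y]; monotonicity carries this to [l >= a]. *)
Lemma loglinear_threshold y l : 1 <= y -> 0 <= l -> 6 * y * ln (2 + 2 * y) < l ->
  y <= l / ln (2 + l) / 2.
Proof.
move=> y1 l0 yl; set Y := 2 * y.
have Y2 : 2 <= Y by rewrite /Y; lra.
have Y0 : 0 <= Y by rewrite (le_trans _ Y2).
have Y3 : 0 < 2 + Y by rewrite ltr_pwDl.
set s := ln (2 + Y); have s0 : 0 < s by exact: ln_2D_gt0.
pose a := 3 * Y * s.
have al : a <= l by apply: ltW; move: yl; rewrite /a /s /Y; lra.
have a0 : 0 <= a by rewrite /a mulr_ge0 ?(ltW s0)// mulr_ge0.
have sY : s <= 1 + Y.
  have -> : s = ln (1 + (1 + Y)) by rewrite /s; congr ln; lra.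
  by apply: le_ln1Dx; lra.
have h1 : ln (2 + a) <= 3 * s.
  have -> : 3 * s = ln ((2 + Y) ^+ 3) by rewrite lnXn// mulr_natl.
  rewrite ler_ln ?posrE ?exprn_gt0//; last by rewrite ltr_pwDl.
  have h := ler_wpM2l Y0 sY; rewrite /a.
  have h2 := exprn_ge0 3 Y0; have h3 := sqr_ge0 Y.
  rewrite (_ : (2 + Y) ^+ 3 = 8 + 12 * Y + 6 * Y ^+ 2 + Y ^+ 3); last by ring.
  by lra.
have L0 : 0 < ln (2 + l) by exact: ln_2D_gt0.
have h2 : Y * ln (2 + l) <= l.
  have := le_trans (loglinear_mono a0 al) (ler_wpM2l l0 h1).
  rewrite /a (_ : 3 * Y * s * ln (2 + l) = 3 * s * (Y * ln (2 + l))); last by ring.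
  by rewrite mulrC ler_pM2r// mulr_gt0.
by rewrite ler_pdivlMr// ler_pdivlMr// mulrC [y * 2]mulrC mulrC.
Qed.

Lemma cube_le_expR x : 0 <= x -> x ^+ 3 / 27 <= expR x.
Proof.
move=> x0; have -> : x ^+ 3 / 27 = (x / 3) ^+ 3 by field.
have -> : expR x = expR (x / 3) ^+ 3.
  by rewrite -expRM_natl; congr expR; field.
rewrite lerXn2r ?nnegrE ?expR_ge0// ?divr_ge0//.
by rewrite (le_trans _ (expR_ge1Dx _))// lerDr.
Qed.

(** With [s = ln (2 + l)] the claim follows from [2 s - 218 <= (e^s - 2) / (2 s)]. For [s <= 108]
    the left side is at most [-2], enough because [s >= 1/2]; beyond, [e^s >= s^3 / 27 >= 4 s^2]. *)
Lemma loglinear_absorbs_sqr l : 0 <= l ->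
  1 + l ^+ 2 <= expR 218 * expR (l / ln (2 + l) / 2).
Proof.
move=> l0; set s := ln (2 + l).
have s12 : 1 / 2 <= s by apply: ln_ge_half; rewrite lerDl.
have s0 : 0 < s by lra.
have l2 : 0 < 2 + l by rewrite ltr_pwDl.
have ls : l = expR s - 2 by rewrite /s lnK ?posrE//; lra.
apply: (@le_trans _ _ (expR (2 * s))).
  rewrite expRM_natl lnK ?posrE//.
  by rewrite sqrrD; lra.
rewrite -expRD ler_expR.
suff : 2 * s - 218 <= l / s / 2 by lra.
rewrite ler_pdivlMr// ler_pdivlMr// ls.
have es := expR_ge0 s.
have [s108|s108] := leP s 108.
  by have := ler_wpM2r (ltW s0) s108; lra.
have := cube_le_expR (ltW s0).
have : 108 * s ^+ 2 <= s ^+ 3 by rewrite [leRHS]exprS ler_wpM2r ?sqr_ge0// ltW.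
by lra.
Qed.

Lemma sqr_le_expR_linear (r0 l : R) : 0 < r0 -> 0 <= l ->
  1 + l ^+ 2 <= (1 + 16 / r0 ^+ 2) * expR (r0 * l / 2).
Proof.
move=> r00 l0; set x := r0 * l / 2.
have x0 : 0 <= x by rewrite divr_ge0// mulr_ge0// ltW.
have x20 : 0 <= x / 2 by rewrite divr_ge0.
have e1 : 1 <= expR x by rewrite -expR0 ler_expR.
have e2 : (x / 2) ^+ 2 <= expR x.
  have -> : expR x = expR (x / 2) ^+ 2 by rewrite -expRM_natl; congr expR; field.
  rewrite lerXn2r ?nnegrE ?expR_ge0//.
  by rewrite (le_trans _ (expR_ge1Dx _))// lerDr.
have -> : l ^+ 2 = 16 / r0 ^+ 2 * (x / 2) ^+ 2 by rewrite /x; field; rewrite gt_eqF.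
by rewrite [leRHS]mulrDl mul1r lerD// ler_wpM2l// divr_ge0// sqr_ge0.
Qed.

End LogLinearWeight.

(** * The theorem *)

Section MainResult.
Context {R : realType} {H : completeNormedModType R}.
Variables (dot : {dot H for idfun}) (e : nat -> H) (lam : nat -> R).
Hypotheses (dotN : inner_product_norm dot) (eB : orthonormal_basis dot e).
Hypothesis lam0 : forall k, 0 <= lam k.

Lemma data_energy_truncate (w p q : nat -> R) N n :
  (forall k, 0 <= w k) ->
  \sum_(0 <= k < n) w k * data_energy lam (truncate N p) (truncate N q) k <=
  \sum_(0 <= k < n) w k * data_energy lam p q k.
Proof.
move=> w0; apply: ler_sum => k _; rewrite /data_energy /truncate; case: ifP => // _.
rewrite !expr0n/= mulr0 addr0 mulr0 mulr_ge0//.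
exact: (data_energy_ge0 lam p q).
Qed.

(** [m] is truncated twice with the same lower bound: at [S0], to get the bound [MS] on the initial
    range, and then at [Smax], the level that energy conservation derives from [MS], with a margin
    of 1. *)
Lemma life_span_criterion_holds (m : R -> R) nu0 (u0 u1 : H) :
  class_C1 `[0, +oo[ m -> 0 < nu0 -> (forall s, 0 <= s -> nu0 <= m s) ->
  dom_pow dot e lam (3 / 4) u0 -> dom_pow dot e lam (1 / 4) u1 ->
  exists C1 C2 H0 M, [/\ 0 < C1, 0 < C2, 0 <= H0 & 0 < M] /\
  forall u0e u1e : R -> H, (forall eps, 0 < eps ->
    [/\ dom_pow dot e lam (3 / 4) (u0e eps),
        dom_pow dot e lam (1 / 4) (u1e eps) &
        `|u1 - u1e eps| ^+ 2
        + `|pow_op dot e lam (1 / 4) (u1 - u1e eps)| ^+ 2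
        + `|pow_op dot e lam (1 / 2) (u0 - u0e eps)| ^+ 2
        + `|pow_op dot e lam (3 / 4) (u0 - u0e eps)| ^+ 2 <= eps ^+ 2]) ->
  life_span_criterion lam
    (data_energy lam (fun k => dot u0 (e k)) (fun k => dot u1 (e k)))
    C1 C2 H0 M (fun eps => life_span dot e lam m (u0e eps) (u1e eps)).
Proof.
move=> mC1 nu00 num d0 d1.
set p := fun k => dot u0 (e k); set q := fun k => dot u1 (e k).
pose S0 := `|pow_op dot e lam (1 / 2) u0| ^+ 2; pose Q0 := `|u1| ^+ 2.
have S00 : 0 <= S0 by exact: sqr_ge0.
have Q00 : 0 <= Q0 by exact: sqr_ge0.
have [MS [L0 hm0]] := coef_of_class_C1 mC1 nu00 num S00.
set nu := Num.min nu0 1 in hm0.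
have nugt0 : 0 < nu := coef_nu_gt0 hm0.
have numS : nu <= MS by exact: le_trans (coef_ge hm0 0) (coef_le hm0 0).
have MS0 : 0 <= MS by rewrite (le_trans _ numS)// ltW.
pose H1 := Q0 + MS * S0.
have H10 : 0 <= H1 by rewrite addr_ge0// mulr_ge0.
pose Smax := H1 / nu + 1.
have S0max : S0 <= Smax.
  have : S0 <= H1 / nu.
    by rewrite ler_pdivlMr// /H1; have := ler_wpM2l S00 numS; lra.
  by rewrite /Smax; lra.
have Smax0 : 0 <= Smax by exact: le_trans S00 S0max.
have [M [L hm]] := coef_of_class_C1 mC1 nu00 num Smax0.
rewrite -/nu in hm; set mh := m \o clamp Smax in hm.
have mhE x : 0 <= x <= Smax -> mh x = m x by move=> xS; rewrite /mh/= clamp_id.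
have mSle x : 0 <= x <= S0 -> mh x <= MS.
  move=> /[dup] xS /andP[x0 xS0]; rewrite mhE ?x0 ?(le_trans xS0)//.
  by have := coef_le hm0 x; rewrite /= clamp_id.
have M0 : 0 < M by rewrite (lt_le_trans ltr01)// (coef_M_ge1 hm).
have L00 : 0 < L by rewrite (lt_le_trans ltr01)// (coef_L_ge1 hm).
have [C2 C20 HC2] := life_span_ge dotN eB lam0 hm d0 d1 mSle (lexx Smax) mhE.
pose H0 := H1 * (1 + M / nu).
have H00 : 0 <= H0 by rewrite mulr_ge0// addr_ge0// divr_ge0// ltW.
exists (L / nu ^+ 2), C2, H0, M; split.
  by split => //; rewrite divr_gt0// exprn_gt0.
move=> u0e u1e ue T Q eps om Eom Lm y y' T0 Q1 om0 omE init dy Lm0 Lmy' omge LQ L3Q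
  eps0 eps1 small.
have [dv0 dv1 dist] := ue eps eps0.
apply: (HC2 T Q eps) => // N rho r h ref t t0T.
have zero_trunc (a : nat -> R) k : truncate N a k ^+ 2 <= a k ^+ 2.
  by rewrite /truncate; case: ifP => // _; rewrite expr0n/= sqr_ge0.
have mH s : 0 <= s <= T -> moment mh lam N T rho r h (fun=> 1) s <= H0.
  move=> s0T; have [] := reference_hamiltonian hm (ltW T0) ref mSle _ _ s0T (Q0 := Q0) => //.
    apply: (@le_trans _ _ (\sum_(0 <= k < N) lam k ^+ 2 * p k ^+ 2)).
      by apply: ler_sum => k _; rewrite ler_wpM2l ?sqr_ge0//; exact: zero_trunc.
    apply: (series_le_lim _ _ (half_norm_cvg dotN eB lam0 d0)) => k.
    by rewrite mulr_ge0 ?sqr_ge0.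
  apply: (@le_trans _ _ (\sum_(0 <= k < N) q k ^+ 2)).
    by apply: ler_sum => k _; exact: zero_trunc.
  by apply: series_le_lim; [move=> k; exact: sqr_ge0|exact: parseval].
have init' : 1 + moment mh lam N T rho r h om 0 <= expR (y 0).
  apply: le_trans init; rewrite lerD2l (le_trans (moment_init hm ref om0))//.
  by rewrite ler_wpM2l ?(ltW M0)// (le_trans (data_energy_truncate _ _ _ _ om0)).
have [h1 h2] := reference_gevrey hm lam0 (ltW T0) ref om0 mH H00 dy Lm0 Lmy' omge init' t0T.
by split; [exact: le_trans h1 (LQ t t0T)|exact: le_trans h2 (L3Q t t0T)].
Qed.

(** The eigenvectors need not belong to the basis. By symmetry of [A], one with eigenvalue [mu] is
    orthogonal to [e k] unless [mu = lam k ^+ 2], which is impossible once [lam k] is large. *)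
Lemma eigenvector_combination_coef (DA : set H) (A : H -> H) z :
  self_adjoint dot DA A -> (forall k, DA (e k) /\ A (e k) = lam k ^+ 2 *: e k) ->
  eigenvector_combination DA A z ->
  exists2 Lam, 0 <= Lam & forall k, Lam < lam k -> dot z (e k) = 0.
Proof.
move=> [_ _ adj] Ae [n [c [w [wE ->]]]].
have symA x k : DA x -> dot (A x) (e k) = dot x (A (e k)).
  by have [_ adjk] := adj (e k) (A (e k)); apply: adjk; have [] := Ae k.
have /choice[mu wmu] : forall i, exists mu : R, A (w i) = mu *: w i.
  by move=> i; have [_ _] := wE i.
(* The sum dominates each [1 + |mu i|]; [mu i = lam k ^+ 2] would give [1 + lam k ^+ 2 < lam k],
   which never holds. *)
exists (\sum_(i < n) (1 + `|mu i|)).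
  by rewrite sumr_ge0// => i _; rewrite addr_ge0.
move=> k Lk.
have orth i : dot (w i) (e k) = 0.
  have [Dw _ _] := wE i.
  have := symA (w i) k Dw; rewrite wmu (Ae k).2 dotZl dotZr => /eqP.
  rewrite -subr_eq0 -mulrBl mulf_eq0 => /orP[|/eqP//].
  rewrite subr_eq0 => /eqP muE.
  have muL : 1 + `|mu i| <= \sum_(i < n) (1 + `|mu i|).
    rewrite (bigD1 i)//= lerDl sumr_ge0// => j _; exact: addr_ge0.
  have lk1 : 1 + `|mu i| < lam k by exact: le_lt_trans Lk.
  have lk : 1 <= lam k by rewrite (le_trans _ (ltW lk1))// lerDl.
  move: lk1; rewrite muE ger0_norm ?sqr_ge0// => lk1.
  have : lam k <= lam k ^+ 2 by rewrite expr2 ler_peMr.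
  by lra.
suff : forall s : seq 'I_n, dot (\sum_(i <- s) c i *: w i) (e k) = 0 by apply.
elim=> [|i s IH]; first by rewrite big_nil -[0](subrr (0 : H)) dotBl subrr.
by rewrite big_cons dotDl IH dotZl orth mulr0 addr0.
Qed.

Lemma gevrey_energy_sum phi (z0 z1 : H) :
  gevrey dot e lam phi (3 / 4) z0 -> gevrey dot e lam phi (1 / 4) z1 ->
  exists E, forall n, \sum_(0 <= k < n) lam k * expR (phi (lam k)) *
    data_energy lam (fun k => dot z0 (e k)) (fun k => dot z1 (e k)) k <= E.
Proof.
move=> /gevreyP[b0 g0] /gevreyP[b1 g1]; exists (b1 + b0) => n.
rewrite data_energy_weighted_sum lerD//.
  by apply: le_trans (g1 n); apply: ler_sum => k _; rewrite powR_14.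
apply: le_trans (g0 n); apply: ler_sum => k _; rewrite powR_34// le_eqVlt.
by apply/orP; left; apply/eqP; ring.
Qed.

End MainResult.

Theorem theorem2p6 (R : realType) (H : completeNormedModType R)
  (dot : {dot H for idfun}) (DA : set H) (A : H -> H)
  (e : nat -> H) (lam : nat -> R) (m : R -> R) (nu0 : R)
  (u0 u1 : H) (u0e u1e : R -> H) :
  inner_product_norm dot ->
  self_adjoint dot DA A ->
  orthonormal_basis dot e ->
  (forall k, 0 <= lam k) ->
  (forall k, DA (e k) /\ A (e k) = lam k ^+ 2 *: e k) ->
  class_C1 `[0, +oo[ m ->
  0 < nu0 ->
  (forall s, 0 <= s -> nu0 <= m s) ->
  dom_pow dot e lam (3 / 4) u0 ->
  dom_pow dot e lam (1 / 4) u1 ->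
  (forall eps, 0 < eps ->
    [/\ dom_pow dot e lam (3 / 4) (u0e eps),
        dom_pow dot e lam (1 / 4) (u1e eps) &
        `|u1 - u1e eps| ^+ 2
        + `|pow_op dot e lam (1 / 4) (u1 - u1e eps)| ^+ 2
        + `|pow_op dot e lam (1 / 2) (u0 - u0e eps)| ^+ 2
        + `|pow_op dot e lam (3 / 4) (u0 - u0e eps)| ^+ 2 <= eps ^+ 2]) ->
  [/\
    (eigenvector_combination DA A u0 ->
     eigenvector_combination DA A u1 ->
     exists gamma0 eps0 : R, [/\ 0 < gamma0, 0 < eps0 &
       forall eps, 0 < eps < eps0 ->
         ((gamma0^-1 * `|ln eps|)%:E
            <= life_span dot e lam m (u0e eps) (u1e eps))%E]),
    (forall r0 : R, 0 < r0 ->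
     gevrey dot e lam (fun s => r0 * s) (3 / 4) u0 ->
     gevrey dot e lam (fun s => r0 * s) (1 / 4) u1 ->
     exists gamma1 eps1 : R, [/\ 0 < gamma1, 0 < eps1 &
       forall eps, 0 < eps < eps1 ->
         ((gamma1^-1 * ln `|ln eps|)%:E
            <= life_span dot e lam m (u0e eps) (u1e eps))%E]) &
    (gevrey dot e lam (fun s => s / ln (2 + s)) (3 / 4) u0 ->
     gevrey dot e lam (fun s => s / ln (2 + s)) (1 / 4) u1 ->
     exists gamma2 eps2 : R, [/\ 0 < gamma2, 0 < eps2 &
       forall eps, 0 < eps < eps2 ->
         ((gamma2^-1 * ln (ln `|ln eps|))%:E
            <= life_span dot e lam m (u0e eps) (u1e eps))%E])].
Proof.
move=> dotN sa eB lam0 Ae mC1 nu00 num d0 d1 ue.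
have [C1 [C2 [H0 [M [[C10 C20 H00 M0] crit]]]]] :=
  life_span_criterion_holds dotN eB lam0 mC1 nu00 num d0 d1.
have {}crit := crit u0e u1e ue.
have A0 k := data_energy_ge0 lam (fun k => dot u0 (e k)) (fun k => dot u1 (e k)) k.
split.
- move=> c0 c1.
  have [La La0 hLa] := eigenvector_combination_coef lam0 sa Ae c0.
  have [Lb Lb0 hLb] := eigenvector_combination_coef lam0 sa Ae c1.
  apply: (life_span_finite lam0 C10 C20 H00 crit (Lam := La + Lb)); first exact: addr_ge0.
  move=> k Lk; rewrite /data_energy hLa ?hLb ?expr0n/= ?mulr0 ?addr0//.
    by rewrite (le_lt_trans _ Lk)// lerDr.
  by rewrite (le_lt_trans _ Lk)// lerDl.
- move=> r0 r00 g0 g1; have [E hE] := gevrey_energy_sum lam0 g0 g1.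
  apply: (life_span_linear lam0 A0 C10 C20 H00 M0 crit _ hE (C := 1 + 16 / r0 ^+ 2)
    (B := 2 / r0)) => [l l0||l _].
  + exact: sqr_le_expR_linear.
  + by rewrite divr_gt0.
  + by field; rewrite gt_eqF.
- move=> g0 g1; have [E hE] := gevrey_energy_sum lam0 g0 g1.
  apply: (life_span_loglinear lam0 A0 C10 C20 H00 M0 crit _ hE (C := expR 218)).
    by move=> l l0; exact: loglinear_absorbs_sqr.
  by move=> y l y1 l0; exact: loglinear_threshold.
Qed.
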